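(* Let $\mathcal{L}=\mathcal{L}(d;m_1,\ldots,m_r)$ be a standard class which is not of the form $\mathcal{L}(2m;m^8,m_9,\ldots,m_r)$ (i.e. it is not the case that $r\ge 8$, $d=2m$ and $m_1=\cdots=m_8=m$ for some integer $m$). Assume that \[ 1+m_r(8-r)\leq C\cdot\mathcal{L}\leq 0 \] and $d\geq m_1+t$, where \[ t=\left\lceil\frac{-C\cdot\mathcal{L}+1}{r-8}\right\rceil . \] Set $t_1:=\max\{0,m_2+m_3-d\}$ and $t_i:=\max\{0,m_1+m_i-d\}$ for $i=2,\ldots,r$. Then \[ \dim\mathcal{L}=v(\mathcal{L})+\sum_{i=1}^r\binom{t_i+1}{3}+(r-8)\binom{t+1}{3}+n\binom{t+1}{2}, \] where $n=(8-r)(t-1)-C\cdot\mathcal{L}$ is a non-negative integer with $n\leq r-9$.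
   Context: The ground field is algebraically closed of characteristic $0$. Let $Q\subset\mathbb{P}^3$ be a smooth quadric and $B\in|-K_Q|$ a general anticanonical curve, i.e. $B$ is a smooth elliptic quartic curve. Let $p_1,\ldots,p_r$ be points in general position on $B$. Let $\pi:X\to\mathbb{P}^3$ be the blow-up of $\mathbb{P}^3$ along $p_1,\ldots,p_r$, let $H$ be the pull-back of a plane, $E_i$ the exceptional divisor over $p_i$, and $C\subset X$ the strict transform of $B$. For non-negative integers $m_1,\ldots,m_r$, write $\mathcal{L}(d;m_1,\ldots,m_r):=|dH-m_1E_1-\cdots-m_rE_r|$ for the complete linear system on $X$ (equivalently, the linear system of surfaces of degree $d$ in $\mathbb{P}^3$ with multiplicity at least $m_i$ at each $p_i$), and $\dim$ for its projective dimension, $\dim=h^0-1$. Its virtual dimension is \[ v(\mathcal{L})=\binom{d+3}{3}-\sum_{i=1}^r\binom{m_i+2}{3}-1 . \] The system is called standard if $m_1\geq\cdots\geq m_r\geq 0$ and $2d\geq m_1+m_2+m_3+m_4$. The intersection number of $C$ with the system is $C\cdot\mathcal{L}=4d-m_1-\cdots-m_r$. (The displayed inequalities on $C\cdot\mathcal{L}$ can only hold for $r\geq 9$, so $t$ is well defined.) *)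

(* Defs.v *)
From HB Require Import structures.
From mathcomp Require Import all_boot all_order all_algebra.
From mathcomp.multinomials Require Export mpoly.

Set Implicit Arguments.
Unset Strict Implicit.
Unset Printing Implicit Defensive.

Import GRing.Theory Num.Theory.

Local Open Scope ring_scope.

(* Points of P^3 are given by nonzero row vectors of homogeneous coordinates, *)
(* and r-tuples of points by the rows of an r x 4 matrix.                     *)

Section Geometry.

Variable K : closedFieldType.
Implicit Types (f q g : {mpoly K[4]}) (v : 'rV[K]_4).

Definition jacobian_at c (F : c.-tuple {mpoly K[4]}) v : 'M[K]_(c, 4) :=
  \matrix_(i, j) ((tnth F i)^`M(j)).@[v 0].

(* Jacobian criterion for the subscheme of P^3 cut out by homogeneous forms   *)
(* F_1, ..., F_c to be smooth of codimension c.                               *)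
Definition smooth_complete_intersection c (F : c.-tuple {mpoly K[4]}) : Prop :=
  forall v, v != 0 -> (forall i, (tnth F i).@[v 0] = 0) ->
  \rank (jacobian_at F v) = c.

Definition smooth_quadric q : Prop :=
  q \is 2.-homog /\ smooth_complete_intersection [tuple q].

(* By adjunction -K_Q = O_Q(2), and quadratic forms on P^3 restrict onto      *)
(* H^0(Q, O_Q(2)): the members of |-K_Q| are the complete intersections       *)
(* {q = g = 0} with g a quadratic form.  The smooth ones are exactly the      *)
(* smooth elliptic quartic curves lying on Q.                                 *)
Definition smooth_anticanonical_curve q g : Prop :=
  g \is 2.-homog /\ smooth_complete_intersection [tuple q; g].

Definition on_curve q g v : Prop := q.@[v 0] = 0 /\ g.@[v 0] = 0.

(* A polynomial in the homogeneous coordinates of r points, homogeneous       *)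
(* separately in the coordinates of each of them.                             *)
Definition multihomogeneous r (G : {mpoly K[r * 4]}) : Prop :=
  exists e : 'I_r -> nat, forall a, a \in msupp G ->
    forall i, (\sum_(j < 4) a (mxvec_index i j))%N = e i.

(* P holds for r points in general position on the (irreducible) variety X:   *)
(* it holds on some nonempty Zariski open subset U of X^r, where U is the     *)
(* complement in X^r of the common zeros of the multihomogeneous forms in S.  *)
Definition for_general_points r (X : 'rV[K]_4 -> Prop)
    (P : 'M[K]_(r, 4) -> Prop) : Prop :=
  exists2 S : seq {mpoly K[r * 4]},
    forall G, G \in S -> multihomogeneous G &
    let U (p : 'M[K]_(r, 4)) :=
      (forall i, row i p != 0 /\ X (row i p)) /\
      (exists2 G, G \in S & G.@[mxvec p 0] != 0) in
    (exists p, U p) /\ (forall p, U p -> P p).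

(* The equation of the surface {f = 0} in the affine chart x_j = 1, expanded  *)
(* around the point v (which must satisfy v_j != 0).  The chart is A^3 with   *)
(* coordinates 'X_i, i != j; the variable 'X_j does not occur in the result.  *)
Definition local_equation v (j : 'I_4) f : {mpoly K[4]} :=
  f \mPo [tuple if i == j then 1 else (v 0 i / v 0 j)%:MP + 'X_i | i < 4].

Definition mult_at_least (k : nat) v f : bool :=
  [forall j, (v 0 j != 0) ==>
    [forall a : 'X_{1..4 < k}, (local_equation v j f)@_a == 0]].

(* H^0(X, dH - m_1 E_1 - ... - m_r E_r), as the space of forms of degree d    *)
(* with multiplicity at least m_i at the i-th point; see mem_linsys.          *)
Definition linsys (d r : nat) (m : r.-tuple nat) (p : 'M[K]_(r, 4)) :
    {vspace dhomog 4 K d} :=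
  (\bigcap_(i < r) \bigcap_(j < 4 | row i p ord0 j != 0%R)
     \bigcap_(a : 'X_{1..4 < tnth m i})
       lker (linfun (fun f : dhomog 4 K d =>
         (local_equation (row i p) j f)@_a : K^o)))%VS.

Lemma mem_linsys (d r : nat) (m : r.-tuple nat) (p : 'M[K]_(r, 4))
    (f : dhomog 4 K d) :
  (f \in linsys d m p) = [forall i, mult_at_least (tnth m i) (row i p) f].
Proof.
have lin i j (a : 'X_{1..4}) : linear (fun f : dhomog 4 K d =>
    (local_equation (row i p) j f)@_a : K^o).
  by move=> c x y; rewrite /local_equation !linearP.
have E i j a (h : dhomog 4 K d) :
    (h \in lker (linfun (fun f : dhomog 4 K d =>
         (local_equation (row i p) j f)@_a : K^o)))
    = ((local_equation (row i p) j h)@_a == 0).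
  pose L := GRing.isLinear.Build _ _ _ _ _ (lin i j a).
  pose phi : {linear dhomog 4 K d -> K^o} := HB.pack
    (fun f : dhomog 4 K d => (local_equation (row i p) j f)@_a : K^o) L.
  by rewrite memv_ker (lfunE phi h).
rewrite memvE; apply/subv_bigcapP/forallP => H i.
- apply/forallP => j; apply/implyP => vj; apply/forallP => a.
  have /subv_bigcapP/(_ j vj)/subv_bigcapP/(_ a isT) := H i isT.
  by rewrite -memvE E.
- move=> _; apply/subv_bigcapP => j vj; apply/subv_bigcapP => a _.
  rewrite -memvE E.
  by have /forallP/(_ j)/implyP/(_ vj)/forallP := H i.
Qed.

(* h^0 - 1, hence -1 for the empty system.                                    *)
Definition linsys_dim (d r : nat) (m : r.-tuple nat) (p : 'M[K]_(r, 4)) : int :=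
  (\dim (linsys d m p))%:Z - 1.

End Geometry.

Section Numerics.

Variables (d r : nat) (m : r.-tuple nat).

(* m_i, numbered from 1                                                       *)
Definition mu (i : nat) : nat := nth 0%N m i.-1.

Definition vdim : int :=
  'C(d + 3, 3)%:Z - \sum_(1 <= i < r.+1) 'C(mu i + 2, 3)%:Z - 1.

Definition standard : bool :=
  sorted geq m && (mu 1 + mu 2 + mu 3 + mu 4 <= 2 * d)%N.

(* The form L(2k; k^8, m_9, ..., m_r)                                         *)
Definition double_form : Prop :=
  (8 <= r)%N /\
  exists k, d = (2 * k)%N /\ forall i, (1 <= i <= 8)%N -> mu i = k.

Definition Cdot : int := 4 * d%:Z - \sum_(1 <= i < r.+1) (mu i)%:Z.

Definition t_curve : int :=
  Num.ceil ((1 - Cdot)%:~R / (r%:Z - 8)%:~R : rat).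

(* Truncated subtraction on nat is max {0, _ - _}.                            *)
Definition t_line (i : nat) : nat :=
  if i == 1%N then (mu 2 + mu 3 - d)%N else (mu 1 + mu i - d)%N.

Definition n_curve : int := (8 - r%:Z) * (t_curve - 1) - Cdot.

End Numerics.

(* Main.v *)
From HB Require Import structures.
Require Import Defs.
From mathcomp Require Import all_boot all_order all_algebra all_field perm.
From mathcomp.multinomials Require Import mpoly.
From mathcomp Require Import zify ring lra.
From Stdlib Require Import Classical ClassicalEpsilon.

(* After an isomorphism Q = P^1 x P^1 that puts p_1 at a ramification point of
   one of the two rulings of B, the curve B is u^2 + B(s) u + C(s) = 0 in the
   chart (1, s, u, su).  Restricting forms to Q, and then forms on Q to B,
   bounds the dimension of L from above by those of systems on B; the latter
   are computed for general points of B with Wronskians, over the function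
   field of B.  The towers end when at most three points are left, where one
   counts monomials.  This bounds dim L at one configuration, and hence, by
   semicontinuity, at a general one.  Conversely the conditions at the points
   give a lower bound for L(d - 2t; m_i - t), and multiplication by the
   equations of Q and of a second quadric through B lifts it to L. *)

(** Write L_k for L(d-2k; m_i-k). Then C.L_k = C.L + k(r-8), and t is the first level with C.L_t >
    0. Below t the degree on B is nonpositive, so every L_k with k < t has at most the restriction
    to Q that L_t has, multiplied by powers of the equation of B. Hence dim L is that of L_t plus t
    times the rank of L_t on Q; summing twice over the levels gives the binomials in t, with n =
    -C.L_(t-1). The lines p_1 p_i and p_2 p_3 account for the t_i. The lower bound needs that rank
    from below. It is obtained as a lower bound for L_t minus an upper bound for the forms of L_t
    vanishing on Q, so semicontinuity is applied to that kernel too. The ramification point, put at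
    infinity, makes the equation of B monic in u: division with remainder works over K[s], and p_1
    only cuts a corner off Newton polygons, a description that survives when the multiplicity at p_1
    overtakes the degree. The other points are chosen successively, outside the zeros of finitely
    many Wronskians, one for each level of the tower on Q. *)

Set Implicit Arguments.
Unset Strict Implicit.
Unset Printing Implicit Defensive.

Import GRing.Theory Num.Theory.
Local Open Scope ring_scope.

(** * Linear algebra: finite-dimensional subspaces of commutative rings over [K] *)

Section Dimension.

Variables (K : fieldType) (V : comNzRingType) (io : {rmorphism K -> V}).

Definition lincomb n (x : 'I_n -> V) (c : 'rV[K]_n) : V :=
  \sum_i io (c 0 i) * x i.

Definition subspace (P : V -> Prop) :=
  P 0 /\ forall c x y, P x -> P y -> P (io c * x + y).

Definition independent n (x : 'I_n -> V) := forall c, lincomb x c = 0 -> c = 0.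

(** Scalars act through [io], so that one notion serves forms on P^3, polynomials in s and u,
    polynomials in s, and the function field of the curve; all these rings are infinite-dimensional,
    and subspaces are mere predicates. *)
Definition hasdim (P : V -> Prop) (n : nat) := exists x : 'I_n -> V,
  [/\ forall i, P (x i), independent x
    & forall v, P v -> exists c, v = lincomb x c].

Lemma lincombP n (x : 'I_n -> V) a c e :
  lincomb x (a *: c + e) = io a * lincomb x c + lincomb x e.
Proof.
rewrite /lincomb mulr_sumr -big_split; apply: eq_bigr => i _ /=.
by rewrite !mxE rmorphD rmorphM mulrDl mulrA.
Qed.

Lemma lincomb0 n (x : 'I_n -> V) : lincomb x 0 = 0.
Proof. by rewrite /lincomb big1 // => i _; rewrite mxE rmorph0 mul0r. Qed.

Lemma lincomb_mulmx k n (x : 'I_n -> V) (M : 'M[K]_(k, n)) c :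
  lincomb (fun i => lincomb x (row i M)) c = lincomb x (c *m M).
Proof.
rewrite /lincomb; under eq_bigr do rewrite mulr_sumr.
rewrite exchange_big; apply: eq_bigr => j _ /=.
rewrite mxE rmorph_sum mulr_suml; apply: eq_bigr => i _.
by rewrite mxE rmorphM mulrA.
Qed.

Lemma subspace_lincomb P n (x : 'I_n -> V) c :
  subspace P -> (forall i, P (x i)) -> P (lincomb x c).
Proof.
move=> [P0 PP] Px; rewrite /lincomb.
by elim/big_rec: _ => // i y _ Py; apply: PP.
Qed.

Lemma independent_row_free k n (x : 'I_n -> V) (M : 'M[K]_(k, n)) :
  independent x -> row_free M -> independent (fun i => lincomb x (row i M)).
Proof.
move=> fx fM c; rewrite lincomb_mulmx => /fx H.
by apply/(row_free_inj fM); rewrite H mul0mx.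
Qed.

(** As long as some vector of [S] escapes the row space of [A], adding it raises the rank, which
    cannot exceed [n]. *)
Lemma subspace_row_space n (S : 'rV[K]_n -> Prop) : S 0 ->
    (forall a c e, S c -> S e -> S (a *: c + e)) ->
  exists A : 'M[K]_n, forall c, S c <-> (c <= A)%MS.
Proof.
move=> S0 SS.
suff [A [A1 A2]] : exists A : 'M[K]_n,
    (forall c, (c <= A)%MS -> S c) /\ forall c, S c -> (c <= A)%MS.
  by exists A => c; split; [apply: A2 | apply: A1].
suff H k (A : 'M[K]_n) : (forall c : 'rV_n, (c <= A)%MS -> S c) ->
    (n - \rank A <= k)%N -> exists A : 'M[K]_n,
    (forall c, (c <= A)%MS -> S c) /\ forall c, S c -> (c <= A)%MS.
  by apply: (H n 0); [move=> c /submx0null -> | apply: leq_subr].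
elim: k A => [|k IH] A A1 rA.
  exists A; split=> // c _; apply: submx_full.
  by rewrite row_full_unit -row_free_unit /row_free eqn_leq rank_leq_row -subn_eq0 -leqn0.
have [A2|] := classic (forall c, S c -> (c <= A)%MS); first by exists A.
move=> /not_all_ex_not [c Hc]; have [Sc Nc] := imply_to_and _ _ Hc.
apply: (IH (A + c)%MS) => [e /sub_addsmxP [[u v] /= ->]|].
  rewrite addrC [v]mx11_scalar mul_scalar_mx; apply: SS => //.
  by apply: A1; apply: submxMl.
suff: (\rank A < \rank (A + c)%MS)%N by lia.
have sA : (A <= A + c)%MS by apply: addsmxSl.
rewrite ltn_neqAle mxrankS // andbT; apply/eqP => E; apply: Nc.
by apply: submx_trans (addsmxSr A c) _; have := (mxrank_leqif_eq sA).2; rewrite E eqxx => /esym /andP[].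
Qed.

Lemma hasdim_sub (P P' : V -> Prop) n : subspace P' -> (forall v, P' v -> P v) ->
  hasdim P n -> exists2 k, (k <= n)%N & hasdim P' k.
Proof.
move=> sP' PP [x [Px fx gx]].
have [||A HA] := @subspace_row_space n (fun c => P' (lincomb x c)).
- by rewrite lincomb0; case: sP'.
- by move=> a c e *; rewrite lincombP; case: sP' => _; apply.
exists (\rank A); first exact: rank_leq_row.
exists (fun i => lincomb x (row i (row_base A))); split.
- by move=> i; apply/HA; rewrite -(eq_row_base A) row_sub.
- by apply: independent_row_free => //; apply: row_base_free.
- move=> v P'v; have [c Ec] := gx v (PP _ P'v).
  have : (c <= row_base A)%MS by rewrite eq_row_base; apply/HA; rewrite -Ec.
  by case/submxP => e Ee; exists e; rewrite lincomb_mulmx -Ee.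
Qed.

Lemma independent_leq (P : V -> Prop) n k (y : 'I_k -> V) :
  hasdim P n -> (forall i, P (y i)) -> independent y -> (k <= n)%N.
Proof.
move=> [x [Px fx gx]] Py fy.
have [M HM] : exists M : 'M[K]_(k, n), forall i, y i = lincomb x (row i M).
  have [f Hf] := choice _ (fun i => gx (y i) (Py i)).
  by exists (\matrix_i f i) => i; rewrite rowK.
suff : row_free M by rewrite /row_free => /eqP <-; apply: rank_leq_col.
rewrite -kermx_eq0; apply/eqP/row_matrixP => i; rewrite row0; apply: fy.
rewrite /lincomb; under eq_bigr do rewrite HM.
rewrite -/(lincomb (fun i => lincomb x (row i M)) _) lincomb_mulmx.
by rewrite -row_mul mulmx_ker row0 lincomb0.
Qed.

Lemma hasdim_leq (P P' : V -> Prop) n k : (forall v, P' v -> P v) ->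
  hasdim P n -> hasdim P' k -> (k <= n)%N.
Proof.
by move=> PP dP [y [Py fy _]]; apply: independent_leq dP _ fy => i; apply: PP.
Qed.

Lemma hasdim_uniq (P : V -> Prop) n k : hasdim P n -> hasdim P k -> n = k.
Proof. by move=> *; apply/eqP; rewrite eqn_leq !(@hasdim_leq P P). Qed.

Lemma hasdim_eq (P P' : V -> Prop) n : (forall v, P' v <-> P v) ->
  hasdim P n -> hasdim P' n.
Proof.
move=> E [x [Px fx gx]]; exists x; split=> // [i|v /E]; first exact/E.
exact: gx.
Qed.

End Dimension.

Section RankNullity.

Variables (K : fieldType) (V W : comNzRingType).
Variables (io : {rmorphism K -> V}) (jo : {rmorphism K -> W}).

Definition klinear (f : V -> W) :=
  forall c x y, f (io c * x + y) = jo c * f x + f y.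

Definition imageof (f : V -> W) (P : V -> Prop) w := exists2 v, P v & w = f v.

Definition kernelof (f : V -> W) (P : V -> Prop) v := P v /\ f v = 0.

Variables (f : V -> W) (lf : klinear f).

Lemma klinear0 : f 0 = 0.
Proof.
have := lf (-1) 0 0; rewrite mulr0 addr0 rmorphN rmorph1 mulN1r addrC => E.
by rewrite E subrr.
Qed.

Lemma klinear_lincomb n (x : 'I_n -> V) c :
  f (lincomb io x c) = lincomb jo (f \o x) c.
Proof.
apply: (big_ind2 (fun u w => f u = w)); first exact: klinear0.
  by move=> u1 _ u2 _ <- <-; have := lf 1 u1 u2; rewrite !rmorph1 !mul1r.
by move=> i _; have := lf (c 0 i) (x i) 0; rewrite klinear0 !addr0.
Qed.

Lemma subspace_image P : subspace io P -> subspace jo (imageof f P).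
Proof.
move=> [P0 PP]; split; first by exists 0; rewrite ?klinear0.
move=> c _ _ [x Px ->] [y Py ->]; exists (io c * x + y); first exact: PP.
by rewrite lf.
Qed.

Lemma subspace_kernel P : subspace io P -> subspace io (kernelof f P).
Proof.
move=> [P0 PP]; split; first by split; rewrite ?klinear0.
move=> c x y [Px fx] [Py fy]; split; first exact: PP.
by rewrite lf fx fy mulr0 addr0.
Qed.

(** In coordinates on a basis of [P], the kernel is a row space [A]; a complement of [A] is mapped
    isomorphically onto the image. *)
Lemma rank_nullity P n : subspace io P -> hasdim io P n ->
  exists a b, [/\ n = (a + b)%N, hasdim jo (imageof f P) a &
                  hasdim io (kernelof f P) b].
Proof.
move=> sP [x [Px fx gx]].
have [||A HA] := @subspace_row_space _ n (fun c => f (lincomb io x c) = 0).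
- by rewrite lincomb0 klinear0.
- by move=> a c e H1 H2; rewrite lincombP lf H1 H2 mulr0 addr0.
exists (\rank A^C%MS), (\rank A); split.
- by rewrite mxrank_compl subnK // rank_leq_row.
- exists (fun i => f (lincomb io x (row i (row_base A^C%MS)))); split.
  + by move=> i; exists (lincomb io x (row i (row_base A^C%MS))) => //; apply: subspace_lincomb.
  + move=> c; rewrite -[LHS](klinear_lincomb (fun i => lincomb io x (row i (row_base A^C%MS)))).
    rewrite lincomb_mulmx => /HA H.
    have H2 : (c *m row_base A^C <= A^C)%MS by rewrite -(eq_row_base A^C%MS) submxMl.
    have /submx0null E : (c *m row_base A^C <= (0 : 'M_n))%MS.
      by rewrite -(capmx_compl A) sub_capmx H.
    by apply/(row_free_inj (row_base_free A^C%MS)); rewrite E mul0mx.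
  + move=> _ [v Pv ->]; have [c ->] := gx v Pv.
    have : (c <= A + A^C)%MS by apply: submx_full; apply: addsmx_compl_full.
    case/sub_addsmxP => [[c1 c2] /= ->].
    have : (c2 *m A^C <= row_base A^C)%MS by rewrite eq_row_base submxMl.
    case/submxP => e ->; exists e.
    rewrite -[RHS](klinear_lincomb (fun i => lincomb io x (row i (row_base A^C%MS)))).
    rewrite lincomb_mulmx -[c1 *m A]scale1r lincombP lf.
    have /HA -> : (c1 *m A <= A)%MS by apply: submxMl.
    by rewrite mulr0 add0r.
- exists (fun i => lincomb io x (row i (row_base A))); split.
  + move=> i; split; first exact: subspace_lincomb.
    by apply/HA; rewrite -(eq_row_base A) row_sub.
  + by apply: independent_row_free => //; apply: row_base_free.
  + move=> v [Pv fv]; have [c Ec] := gx v Pv.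
    have : (c <= row_base A)%MS by rewrite eq_row_base; apply/HA; rewrite -Ec.
    by case/submxP => e Ee; exists e; rewrite lincomb_mulmx -Ee.
Qed.

Lemma hasdim_image_inj P n : (forall v, P v -> f v = 0 -> v = 0) ->
  subspace io P -> hasdim io P n -> hasdim jo (imageof f P) n.
Proof.
move=> inj sP [x [Px fx gx]]; exists (f \o x); split.
- by move=> i; exists (x i).
- move=> c; rewrite -klinear_lincomb => /inj; rewrite -/(lincomb io x c) => H.
  by apply: fx; apply: H; apply: subspace_lincomb.
- move=> _ [v Pv ->]; have [c ->] := gx v Pv; exists c.
  by rewrite klinear_lincomb.
Qed.

End RankNullity.

(** * Evaluation morphisms, and multiplicities on the cone over P^3 and on a chart of the quadric *)

Section Evaluation.

Variables (K : fieldType).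

Lemma rmorph_mpoly_ext n (S : comNzRingType) (f g : {rmorphism {mpoly K[n]} -> S}) :
  (forall c, f c%:MP = g c%:MP) -> (forall i, f 'X_i = g 'X_i) -> f =1 g.
Proof.
move=> E1 E2; apply: mpolyind; first by rewrite !rmorph0.
move=> c m p _ _ Ep; rewrite !rmorphD Ep -mul_mpolyC !rmorphM E1; congr (_ * _ + _).
by rewrite mpolyXE_id !rmorph_prod; apply: eq_bigr => i _; rewrite !rmorphXn E2.
Qed.

Lemma rmorph_poly2_ext (S : comNzRingType) (f g : {rmorphism {poly {poly K}} -> S}) :
  (forall c, f c%:P%:P = g c%:P%:P) -> f 'X%:P = g 'X%:P -> f 'X = g 'X -> f =1 g.
Proof.
move=> E1 E2 E3; elim/poly_ind => [|F p EF]; first by rewrite !rmorph0.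
rewrite !rmorphD !rmorphM EF E3; congr (_ + _); clear F EF.
elim/poly_ind: p => [|p c Ep]; first by rewrite !rmorph0.
by rewrite !rmorphD !rmorphM /= Ep E2 E1.
Qed.

(** Throughout, the inner variable ['X%:P] of [{poly {poly K}}] is the coordinate s and the outer
    variable ['X] is u, on an affine chart of P^1 x P^1. *)
Definition ev2 (S : comNzRingType) (io : {rmorphism K -> S}) (a b : S) :
    {poly {poly K}} -> S :=
  locked (horner_eval b \o map_poly (horner_eval a \o map_poly io)).

Section Ev2Morphism.

Variables (S : comNzRingType) (io : {rmorphism K -> S}) (a b : S).

Fact ev2_is_zmod_morphism : zmod_morphism (ev2 io a b).
Proof. by rewrite /ev2 -lock; apply: raddfB. Qed.

Fact ev2_is_monoid_morphism : monoid_morphism (ev2 io a b).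
Proof. by rewrite /ev2 -lock; split; [apply: rmorph1 | apply: rmorphM]. Qed.

HB.instance Definition _ := GRing.isZmodMorphism.Build _ _ (ev2 io a b)
  ev2_is_zmod_morphism.
HB.instance Definition _ := GRing.isMonoidMorphism.Build _ _ (ev2 io a b)
  ev2_is_monoid_morphism.

End Ev2Morphism.

Definition mev n (S : comNzRingType) (io : {rmorphism K -> S}) (h : 'I_n -> S) :
  {mpoly K[n]} -> S := locked (mmap io h).

Section MevMorphism.

Variables (n : nat) (S : comNzRingType) (io : {rmorphism K -> S}) (h : 'I_n -> S).

Lemma mevE_mmap : mev io h = mmap io h. Proof. by rewrite /mev -lock. Qed.

Fact mev_is_zmod_morphism : zmod_morphism (mev io h).
Proof. by rewrite mevE_mmap; apply: raddfB. Qed.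

Fact mev_is_monoid_morphism : monoid_morphism (mev io h).
Proof. by rewrite mevE_mmap; split; [apply: rmorph1 | apply: rmorphM]. Qed.

HB.instance Definition _ := GRing.isZmodMorphism.Build _ _ (mev io h)
  mev_is_zmod_morphism.
HB.instance Definition _ := GRing.isMonoidMorphism.Build _ _ (mev io h)
  mev_is_monoid_morphism.

Lemma mevC c : mev io h c%:MP = io c.
Proof. by rewrite mevE_mmap mmapC. Qed.

Lemma mevX i : mev io h 'X_i = h i.
Proof. by rewrite mevE_mmap mmapX mmap1U. Qed.

End MevMorphism.

Lemma ev2C S io a b c : @ev2 S io a b c%:P%:P = io c.
Proof. by rewrite /ev2 -lock /= map_polyC /= map_polyC /= !horner_evalE !hornerC. Qed.

Lemma ev2s S io a b : @ev2 S io a b 'X%:P = a.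
Proof. by rewrite /ev2 -lock /= map_polyC /= map_polyX !horner_evalE hornerC hornerX. Qed.

Lemma ev2u S io a b : @ev2 S io a b 'X = b.
Proof. by rewrite /ev2 -lock /= map_polyX !horner_evalE hornerX. Qed.

Lemma ev2_comp (S S' : comNzRingType) (io : {rmorphism K -> S})
    (io' : {rmorphism K -> S'}) a b (f : {rmorphism S -> S'}) :
  (forall c, f (io c) = io' c) ->
  forall F, f (ev2 io a b F) = ev2 io' (f a) (f b) F.
Proof.
move=> E F; apply: (@rmorph_poly2_ext _ (f \o ev2 io a b) (ev2 io' (f a) (f b))) => [c||] /=.
- by rewrite !ev2C.
- by rewrite !ev2s.
- by rewrite !ev2u.
Qed.

Lemma mev_comp n (S S' : comNzRingType) (io : {rmorphism K -> S})
    (io' : {rmorphism K -> S'}) (h : 'I_n -> S) (f : {rmorphism S -> S'}) :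
  (forall c, f (io c) = io' c) ->
  forall F, f (mev io h F) = mev io' (f \o h) F.
Proof.
move=> E F; apply: (@rmorph_mpoly_ext _ _ (f \o mev io h) (mev io' (f \o h))) => [c|i] /=.
- by rewrite !mevC E.
- by rewrite !mevX.
Qed.

Lemma eq_mev n (S : comNzRingType) (io : {rmorphism K -> S}) (h h' : 'I_n -> S) :
  h =1 h' -> mev io h =1 mev io h'.
Proof.
move=> E F; apply: (@rmorph_mpoly_ext _ _ (mev io h) (mev io h')) => [c|i] /=.
- by rewrite !mevC.
- by rewrite !mevX.
Qed.

Lemma mev_homog n d (f : {mpoly K[n]}) (S : comNzRingType) (io : {rmorphism K -> S}) c h :
  f \is d.-homog -> mev io (fun i => c * h i) f = c ^+ d * mev io h f.
Proof.
move=> /dhomogP fd; rewrite !mevE_mmap /mmap mulr_sumr; apply: eq_big_seq => a /fd ad.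
rewrite mulrCA; congr (_ * _); rewrite /mmap1.
under eq_bigr do rewrite exprMn; rewrite big_split /= prodrXr; congr (_ ^+ _ * _).
by rewrite -ad /= mdegE.
Qed.

Lemma mev_congr n (f : {mpoly K[n]}) (S : comNzRingType) (io : {rmorphism K -> S}) (h h' : 'I_n -> S) t :
  (forall i, exists k, h i - h' i = k * t) ->
  exists k, mev io h f - mev io h' f = k * t.
Proof.
move=> H.
have cM a a' b b' : (exists k, a - a' = k * t) -> (exists k, b - b' = k * t) ->
    exists k, a * b - a' * b' = k * t.
  move=> [k E] [k' E']; exists (k * b + a' * k').
  have -> : a = a' + k * t by rewrite -E addrC subrK.
  have -> : b = b' + k' * t by rewrite -E' addrC subrK.
  by ring.
have c0 a : exists k, a - a = k * t by exists 0; rewrite subrr mul0r.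
elim/mpolyind: f => [|c m p _ _ IH]; first by rewrite !rmorph0 subrr; exists 0; rewrite mul0r.
rewrite !rmorphD; case: IH => k Ek.
have [k' Ek'] : exists k, mev io h (c *: 'X_[m]) - mev io h' (c *: 'X_[m]) = k * t.
  rewrite !mevE_mmap !mmapZ !mmapX; apply: (cM _ _ _ _) => //; rewrite /mmap1.
  elim: (index_enum _) => [|i s IHs]; first by rewrite !big_nil.
  rewrite !big_cons; apply: (cM _ _ _ _) => //.
  by elim: (m i) => [|j IHj]; rewrite ?expr0 ?exprS //; apply: (cM _ _ _ _).
by exists (k' + k); rewrite mulrDl -Ek -Ek'; ring.
Qed.

Lemma dvdXn_mull (R : idomainType) (a b : {poly R}) m h :
  a`_0 != 0 -> a * b = h * 'X^m -> exists h', b = h' * 'X^m.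
Proof.
move=> a0; elim: m b h => [|m IH] b h E; first by exists b; rewrite expr0 mulr1.
have : (a * b)`_0 = 0 by rewrite E exprSr mulrA coefMX.
rewrite coef0M => /eqP; rewrite mulf_eq0 (negbTE a0) /= => /eqP b0.
have : root b 0 by rewrite /root horner_coef0 b0.
case/factor_theorem => b1; rewrite subr0 => Eb.
have [|h' Eh] := IH b1 h.
  apply/(@mulIf _ 'X); first by rewrite polyX_eq0.
  by rewrite -mulrA -Eb E exprSr mulrA.
by exists h'; rewrite Eb Eh exprSr mulrA.
Qed.

Lemma poly_split0 (R : comNzRingType) (p : {poly R}) :
  exists w, p = (p`_0)%:P + w * 'X.
Proof.
have : root (p - (p`_0)%:P) 0 by rewrite /root hornerD hornerN hornerC horner_coef0 subrr.
case/factor_theorem => w; rewrite subr0 => E.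
by exists w; rewrite -E addrC subrK.
Qed.

Section Multiplicity.

Variable n : nat.
Implicit Types (v : 'rV[K]_n) (f : {mpoly K[n]}).

Definition AM : comNzRingType := {mpoly K[n]}.
Definition ioM : {rmorphism K -> AM} := @mpolyC n K.

Definition mpC2 : K -> {poly {mpoly K[n]}} := polyC \o @mpolyC n K.
HB.instance Definition _ := GRing.RMorphism.on mpC2.

Definition mevT (h : 'I_n -> {poly {mpoly K[n]}}) :
  {mpoly K[n]} -> {poly {mpoly K[n]}} := mev mpC2 h.
HB.instance Definition _ h := GRing.RMorphism.on (mevT h).

Lemma mevTC h c : mevT h c%:MP = (c%:MP)%:P.
Proof. exact: mevC. Qed.

Lemma mevTX h i : mevT h 'X_i = h i.
Proof. exact: mevX. Qed.

Lemma mevT_comp (h : 'I_n -> {poly {mpoly K[n]}})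
    (f : {rmorphism {poly {mpoly K[n]}} -> {poly {mpoly K[n]}}}) :
  (forall c, f (c%:MP)%:P = (c%:MP)%:P) ->
  forall F, f (mevT h F) = mevT (f \o h) F.
Proof. by move=> E F; rewrite /mevT (mev_comp (io' := mpC2)) // => c; apply: E. Qed.

Lemma eq_mevT h h' : h =1 h' -> mevT h =1 mevT h'.
Proof. exact: eq_mev. Qed.

Lemma mevT_homog d f c h : f \is d.-homog ->
  mevT (fun i => c * h i) f = c ^+ d * mevT h f.
Proof. exact: mev_homog. Qed.

(** The Taylor expansion f(v + T x) on the affine cone, T being the outer variable. Its order in T
    is the multiplicity at v, and no chart has to be chosen. *)
Definition germ v : {mpoly K[n]} -> {poly {mpoly K[n]}} :=
  mevT (fun i => mpC2 (v 0 i) + ('X_i)%:P * 'X).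
HB.instance Definition _ v := GRing.RMorphism.on (germ v).

Definition mult m v f := exists h, germ v f = h * 'X^m.

Lemma germC v c : germ v c%:MP = (c%:MP)%:P.
Proof. by rewrite /germ mevTC. Qed.

Lemma germX v i : germ v 'X_i = mpC2 (v 0 i) + ('X_i)%:P * 'X.
Proof. by rewrite /germ mevTX. Qed.

Lemma mult_eval m v f (S : comNzRingType) (io : {rmorphism K -> S}) t w :
  mult m v f -> exists h, mev io (fun i => io (v 0 i) + w i * t) f = h * t ^+ m.
Proof.
move=> [h E].
(* Specialising T to [t] and the direction variables to [w] turns the universal expansion into the
   one along the given arc. *)
pose th : {rmorphism {poly {mpoly K[n]}} -> S} :=
  horner_eval t \o map_poly (mev io w).
have Eth : forall c, th (mpC2 c) = io c.
  by move=> c; rewrite /th /= map_polyC /= mevC horner_evalE hornerC.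
exists (th h); have := congr1 th E; rewrite rmorphM rmorphXn.
have -> : th 'X = t by rewrite /th /= map_polyX horner_evalE hornerX.
move=> <-; rewrite /germ /mevT (mev_comp _ Eth); apply: eq_mev => i /=.
have -> : horner_eval t (map_poly (mev io w) (mpC2 (v 0 i) + ('X_i)%:P * 'X)) =
  th (mpC2 (v 0 i) + ('X_i)%:P * 'X) by [].
rewrite rmorphD rmorphM Eth /th /= map_polyX map_polyC /= !horner_evalE hornerX hornerC.
by rewrite mevX.
Qed.

Lemma mult_evalT m v f t w : mult m v f ->
  exists h, mevT (fun i => mpC2 (v 0 i) + w i * t) f = h * t ^+ m.
Proof. exact: mult_eval. Qed.

Lemma mult0 v f : mult 0 v f.
Proof. by exists (germ v f); rewrite expr0 mulr1. Qed.

Lemma mult_leq m k v f : (k <= m)%N -> mult m v f -> mult k v f.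
Proof.
move=> km [h E]; exists (h * 'X^(m - k)).
by rewrite E -mulrA -exprD subnK.
Qed.

Lemma multM m k v f g : mult m v f -> mult k v g -> mult (m + k) v (f * g).
Proof.
by move=> [h E] [h' E']; exists (h * h'); rewrite rmorphM /= E E' exprD mulrACA.
Qed.

Lemma mult_subspace m v : subspace ioM (mult m v).
Proof.
split; first by exists 0; rewrite rmorph0 mul0r.
move=> c x y [h E] [h' E']; exists ((c%:MP)%:P * h + h').
by rewrite /ioM /= rmorphD rmorphM /= E E' germC mulrDl mulrA.
Qed.

Lemma germ0 v f : (germ v f)`_0 = (f.@[v 0])%:MP.
Proof.
rewrite -horner_coef0.
apply: (@rmorph_mpoly_ext _ _ (horner_eval 0 \o germ v) (@mpolyC n K \o meval (v 0))) => [c|i] /=.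
- by rewrite germC horner_evalE hornerC mevalC.
- by rewrite germX mevalXU horner_evalE hornerD hornerM hornerX mulr0 addr0 hornerC.
Qed.

Lemma mult1 v f : f.@[v 0] = 0 <-> mult 1 v f.
Proof.
split=> [E|[h E]].
  have [w Ew] := poly_split0 (germ v f); exists w.
  by rewrite Ew germ0 E mpolyC0 add0r.
have := germ0 v f; rewrite E expr1 coefMX /= => /esym/eqP.
by rewrite mpolyC_eq0 => /eqP.
Qed.

Lemma germ1 v f : (germ v f)`_1 = \sum_i ((f^`M(i)).@[v 0])%:MP * 'X_i.
Proof.
have H0 : (germ v 0)`_1 = \sum_i ((0^`M(i)).@[v 0])%:MP * 'X_i.
  by rewrite rmorph0 coef0 big1 // => i _; rewrite mderiv0 meval0 mpolyC0 mul0r.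
have HD f' g : (germ v f')`_1 = \sum_i ((f'^`M(i)).@[v 0])%:MP * 'X_i ->
    (germ v g)`_1 = \sum_i ((g^`M(i)).@[v 0])%:MP * 'X_i ->
    (germ v (f' + g))`_1 = \sum_i (((f' + g)^`M(i)).@[v 0])%:MP * 'X_i.
  move=> Ef Eg; rewrite rmorphD /= coefD Ef Eg -big_split; apply: eq_bigr => i _.
  by rewrite mderivD mevalD mpolyCD mulrDl.
have HM f' g : (germ v f')`_1 = \sum_i ((f'^`M(i)).@[v 0])%:MP * 'X_i ->
    (germ v g)`_1 = \sum_i ((g^`M(i)).@[v 0])%:MP * 'X_i ->
    (germ v (f' * g))`_1 = \sum_i (((f' * g)^`M(i)).@[v 0])%:MP * 'X_i.
  move=> Ef Eg; rewrite rmorphM /= coefM 2!big_ord_recl big_ord0 addr0 /= /bump /= ?subn0.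
  rewrite Ef Eg !germ0 mulr_sumr mulr_suml -big_split; apply: eq_bigr => i _ /=.
  by rewrite mderivM mevalD !mevalM mpolyCD !mpolyCM; ring.
have HC k : (germ v k%:MP)`_1 = \sum_i (((k%:MP)^`M(i)).@[v 0])%:MP * 'X_i.
  by rewrite germC coefC big1 // => i _; rewrite mderivC meval0 mpolyC0 mul0r.
elim/mpolyind: f => // c m p _ _ IH; apply: (HD) IH.
rewrite -mul_mpolyC; apply: (HM) => //; rewrite mpolyXE_id; elim/big_ind: _ => //.
  by rewrite -mpolyC1; apply: HC.
move=> i _; elim: (m i) => [|k IH]; first by rewrite expr0 -mpolyC1; apply: HC.
rewrite exprS; apply: (HM) => //.
rewrite germX coefD coefC coefCM coefX mulr1 add0r (bigD1 i) //= big1 => [|j ji].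
  have -> : ('X_i)^`M(i) = 1 :> {mpoly K[n]}.
    rewrite mderivX mnm1E eqxx scale1r -mpolyX0; congr 'X_[_].
    by apply/mnmP => l; rewrite mnmBE subnn mnm0E.
  by rewrite addr0 meval1 mpolyC1 mul1r.
by rewrite mderivX mnm1E eq_sym (negbTE ji) scale0r meval0 mpolyC0 mul0r.
Qed.

(** The expansion f(T x) at the origin: the coefficient of T^k is the homogeneous component of
    degree k. *)
Definition spread : {mpoly K[n]} -> {poly {mpoly K[n]}} := germ 0.
HB.instance Definition _ := GRing.RMorphism.on spread.

Lemma spreadC c : spread c%:MP = mpC2 c.
Proof. exact: germC. Qed.

Lemma spreadX i : spread 'X_i = ('X_i)%:P * 'X.
Proof. by rewrite /spread germX mxE rmorph0 add0r. Qed.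

Lemma spread_coef f k a : ((spread f)`_k)@_a = f@_a * (mdeg a == k)%:R.
Proof.
elim/mpolyind: f => [|c m p _ _ IH]; first by rewrite rmorph0 coef0 !mcoeff0 mul0r.
rewrite rmorphD /= coefD !mcoeffD IH mulrDl; congr (_ + _).
rewrite -mul_mpolyC rmorphM /= spreadC /mpC2 /= mpolyXE_id rmorph_prod /=.
under eq_bigr do rewrite rmorphXn /= spreadX exprMn -polyC_exp.
rewrite big_split /= prodrXr -rmorph_prod /= -mpolyXE_id -mdegE.
rewrite mulrA -polyCM coefCM coefXn mul_mpolyC.
have [->|km] := eqVneq k (mdeg m); last first.
  rewrite mulr0 mcoeff0 mcoeffZ mcoeffX; case: eqVneq => [<-|]; last by rewrite mulr0 mul0r.
  by rewrite eq_sym (negbTE km) mulr0.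
rewrite mulr1 mcoeffZ mcoeffX; case: eqVneq => [<-|]; last by rewrite mulr0 mul0r.
by rewrite eqxx !mulr1.
Qed.

Lemma spreadP f m :
  (forall a, (mdeg a < m)%N -> f@_a = 0) <-> exists h, spread f = h * 'X^m.
Proof.
split=> [H|[h E] a am].
  exists (drop_poly m (spread f)).
  rewrite -[LHS](poly_take_drop m); suff -> : take_poly m (spread f) = 0 by rewrite add0r.
  apply/polyP => k; rewrite coef_take_poly coef0; case: ltnP => // km.
  apply/mpolyP => a; rewrite spread_coef mcoeff0.
  by case: eqP => [E|]; rewrite ?mulr0 // mulr1 H // E.
have := spread_coef f (mdeg a) a.
by rewrite E coefMXn am mcoeff0 eqxx mulr1.
Qed.

(** The germ of [q] is T times a polynomial whose constant term is the differential of [q] at [v], a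
    nonzero linear form; such a factor can be cancelled without losing powers of T. *)
Lemma mult_div m v q f : q.@[v 0] = 0 -> (exists i, (q^`M(i)).@[v 0] != 0) ->
  mult m.+1 v (q * f) -> mult m v f.
Proof.
move=> q0 [i qi] [h]; rewrite rmorphM /= => E.
have [w Ew] := poly_split0 (germ v q).
rewrite germ0 q0 mpolyC0 add0r in Ew.
have := germ1 v q; rewrite Ew coefMX /= => w0.
apply: (@dvdXn_mull _ w _ _ h).
  apply/eqP => /(congr1 (mcoeff U_(i)%MM)); rewrite w0 raddf_sum /= mcoeff0.
  rewrite (bigD1 i) //= big1 => [|j ji]; last first.
    by rewrite mcoeffCM mcoeffXU (negbTE ji) mulr0.
  by rewrite mcoeffCM mcoeffXU eqxx mulr1 addr0 => /eqP; rewrite (negbTE qi).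
apply: (@mulIf _ 'X); first by rewrite polyX_eq0.
by rewrite mulrAC -Ew E exprSr mulrA.
Qed.

End Multiplicity.

Definition polyC2 : K -> {poly {poly K}} := polyC \o polyC.
HB.instance Definition _ := GRing.RMorphism.on polyC2.

Definition A2 : comNzRingType := {poly {poly K}}.
Definition io2 : {rmorphism K -> A2} := polyC2.

Definition dS : {poly {poly K}} -> {poly {poly K}} := map_poly (@deriv K).
HB.instance Definition _ := GRing.Additive.on dS.

Lemma dSC p : dS p%:P = (p^`())%:P.
Proof. by rewrite /dS map_polyC. Qed.

Lemma dSX : dS 'X = 0.
Proof.
by apply/polyP => i; rewrite /dS coef_map /= coefX coef0; case: (i == _); rewrite ?deriv0 // -[1%R]/(1%:P) derivC.
Qed.

Lemma dSM F G : dS (F * G) = dS F * G + F * dS G.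
Proof.
apply/polyP => i; rewrite coefD !coefM /dS coef_map /= coefM raddf_sum -big_split.
by apply: eq_bigr => j _; rewrite /= derivM !coef_map.
Qed.

Lemma chain_rule2 (S : comNzRingType) (th : {rmorphism {poly {poly K}} -> S})
    (dl : {additive {poly {poly K}} -> S}) :
    (forall F G, dl (F * G) = dl F * th G + th F * dl G) ->
    (forall c, dl c%:P%:P = 0) ->
  forall F, dl F = th (dS F) * dl 'X%:P + th F^`() * dl 'X.
Proof.
move=> dM dC; elim/poly_ind => [|F p EF].
  by rewrite /dS raddf0 deriv0 !raddf0 ?rmorph0 !mul0r addr0.
rewrite derivD derivM derivC derivX mulr1 addr0.
rewrite [dS _]raddfD /= dSM dSC dSX mulr0 addr0 raddfD /= dM EF.
have -> : dl p%:P = th (p^`())%:P * dl 'X%:P.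
  elim/poly_ind: p => [|p c Ep]; first by rewrite deriv0 !rmorph0 raddf0 mul0r.
  rewrite derivD derivM derivC derivX mulr1 addr0 !rmorphD !rmorphM /= raddfD /= dM Ep dC addr0.
  by ring.
by rewrite !rmorphD !rmorphM /=; ring.
Qed.

Section Multiplicity2.

Implicit Types (z : K * K) (F G : {poly {poly K}}).

Definition pt z : {poly {poly K}} -> K := ev2 idfun z.1 z.2.
HB.instance Definition _ z := GRing.RMorphism.on (pt z).

(** A chart of the blow-up of the plane at [z]: s - z.1 becomes s u and u - z.2 becomes u. The
    exceptional curve is u = 0, and the order along it is the multiplicity at [z]. *)
Definition blow z : {poly {poly K}} -> {poly {poly K}} :=
  ev2 polyC2 (polyC2 z.1 + 'X%:P * 'X) (polyC2 z.2 + 'X).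
HB.instance Definition _ z := GRing.RMorphism.on (blow z).

Definition mult2 m z F := exists h, blow z F = h * 'X^m.

Lemma ptE z F : pt z F = F.[z.2%:P].[z.1].
Proof.
pose f : {rmorphism {poly {poly K}} -> K} := horner_eval z.1 \o horner_eval z.2%:P.
apply: (@rmorph_poly2_ext _ (pt z) f) => [c||]; rewrite /f /= /pt !horner_evalE.
- by rewrite ev2C !hornerC.
- by rewrite ev2s hornerC hornerX.
- by rewrite ev2u hornerX hornerC.
Qed.

Lemma blow0 z F : (blow z F)`_0 = (pt z F)%:P.
Proof.
rewrite -horner_coef0.
apply: (@rmorph_poly2_ext _ (horner_eval 0 \o blow z) (polyC \o pt z)) => [c||] /=; rewrite /blow /pt.
- by rewrite !ev2C horner_evalE hornerC.
- by rewrite !ev2s horner_evalE hornerD hornerM hornerX mulr0 addr0 hornerC.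
- by rewrite !ev2u horner_evalE hornerD hornerX addr0 hornerC.
Qed.

(** After blowing up, each [psi i] is its value at [z] plus a multiple of u, that is, an arc through
    [v] to which [mult_eval] applies. *)
Lemma mult2_comp n m (v : 'rV[K]_n) f z (psi : 'I_n -> {poly {poly K}}) :
  (forall i, pt z (psi i) = v 0 i) -> mult m v f -> mult2 m z (mev polyC2 psi f).
Proof.
move=> Ev mf.
have [w Hw] := choice _ (fun i => poly_split0 (blow z (psi i))).
have [h Eh] := mult_eval polyC2 'X w mf; exists h; rewrite -Eh.
have Ec c : blow z (polyC2 c) = polyC2 c by rewrite /blow ev2C.
rewrite (mev_comp (f := blow z) _ Ec); apply: eq_mev => i /=.
by rewrite Hw blow0 Ev.
Qed.

Lemma mult2_0 z F : mult2 0 z F.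
Proof. by exists (blow z F); rewrite expr0 mulr1. Qed.

Lemma mult2M m k z F G : mult2 m z F -> mult2 k z G -> mult2 (m + k) z (F * G).
Proof.
by move=> [h E] [h' E']; exists (h * h'); rewrite rmorphM /= E E' exprD mulrACA.
Qed.

Lemma mult2B m z F G : mult2 m z F -> mult2 m z G -> mult2 m z (F - G).
Proof.
by move=> [h E] [h' E']; exists (h - h'); rewrite rmorphB /= E E' mulrBl.
Qed.

Lemma mult2_subspace m z : subspace io2 (mult2 m z).
Proof.
split; first by exists 0; rewrite rmorph0 mul0r.
move=> c x y [h E] [h' E']; exists (polyC2 c * h + h').
by rewrite /io2 /= rmorphD rmorphM /= E E' {1}/blow ev2C mulrDl mulrA.
Qed.

Lemma mult2_pt m z F : mult2 m.+1 z F -> pt z F = 0.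
Proof.
move=> [h E]; have := blow0 z F; rewrite E exprSr mulrA coefMX /= => /esym/eqP.
by rewrite polyC_eq0 => /eqP.
Qed.

Lemma blow_dS z F : dS (blow z F) = blow z (dS F) * 'X.
Proof.
pose dl : {additive {poly {poly K}} -> {poly {poly K}}} := dS \o blow z.
rewrite -[LHS]/(dl F) (@chain_rule2 _ (blow z) dl) /dl /=.
- by rewrite /blow ev2s ev2u /polyC2 /= !raddfD /= !dSM !dSC !dSX !derivC !derivX; ring.
- by move=> F' G; rewrite rmorphM /= dSM.
- by move=> c; rewrite /blow ev2C dSC derivC.
Qed.

Lemma blow_dU z F : (blow z F)^`() = blow z (dS F) * 'X%:P + blow z F^`().
Proof.
pose dl : {additive {poly {poly K}} -> {poly {poly K}}} := @deriv _ \o blow z.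
rewrite -[LHS]/(dl F) (@chain_rule2 _ (blow z) dl) /dl /=.
- by rewrite /blow ev2s ev2u /polyC2 /= !derivD !derivM !derivC !derivX; ring.
- by move=> F' G; rewrite rmorphM /= derivM.
- by move=> c; rewrite /blow ev2C derivC.
Qed.

Lemma mult2_dS m z F : mult2 m.+1 z F -> mult2 m z (dS F).
Proof.
move=> [h E]; exists (dS h); apply: (@mulIf _ 'X); first by rewrite polyX_eq0.
rewrite -blow_dS E dSM.
have -> : dS 'X^(m.+1) = 0.
  by elim: (m.+1) => [|k IH]; rewrite ?exprS ?dSM ?IH ?dSX ?mulr0 ?mul0r ?addr0 // expr0 -[1]/(1%:P) dSC -[1]/(1%:P) derivC.
by rewrite mulr0 addr0 exprSr mulrA.
Qed.

Lemma mult2_dU m z F : mult2 m.+1 z F -> mult2 m z F^`().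
Proof.
move=> mF; have [h E] := mF; have [h' E'] := mult2_dS mF.
exists (h^`() * 'X + h *+ m.+1 - h' * 'X%:P).
have := blow_dU z F; rewrite E E' derivM derivXn /= => H.
have -> : blow z F^`() = h^`() * 'X^(m.+1) + h * ('X^m *+ m.+1) - h' * 'X^m * 'X%:P.
  by rewrite H addrAC subrr add0r.
by rewrite mulrBl mulrDl exprS mulrA mulrnAr mulrnAl (mulrAC h').
Qed.

(** The u-coefficient of the blown-up [G] is G_s(z) s + G_u(z), nonzero because G_u(z) is. So the
    curve has multiplicity exactly one at [z] and dividing by it costs one order only. *)
Lemma mult2_div m z F G :
  pt z G = 0 -> pt z G^`() != 0 -> mult2 m.+1 z (G * F) -> mult2 m z F.
Proof.
move=> G0 G1 [h]; rewrite rmorphM /= => E.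
have [w Ew] := poly_split0 (blow z G); rewrite blow0 G0 polyC0 add0r in Ew.
have w0 : w`_0 != 0.
  have := congr1 (fun p : {poly _} => p`_0) (blow_dU z G).
  rewrite Ew derivM derivX mulr1 coefD coefMX add0r coefD coefMC !blow0 => ->.
  apply/eqP => /(congr1 (fun p : {poly _} => p`_0)).
  by rewrite coefD coefMX /= add0r coefC coef0 /= => E1; rewrite E1 eqxx in G1.
apply: (@dvdXn_mull _ w _ _ h) => //.
apply: (@mulIf _ 'X); first by rewrite polyX_eq0.
by rewrite mulrAC -Ew E exprSr mulrA.
Qed.

End Multiplicity2.

End Evaluation.

(** * Multiplicity in affine charts agrees with multiplicity on the cone *)

Section LocalMultiplicity.

Variable K : closedFieldType.
Implicit Types (f : {mpoly K[4]}) (v : 'rV[K]_4).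

Definition chart v (j i : 'I_4) : {poly {mpoly K[4]}} :=
  if i == j then 1 else ((v 0 i / v 0 j)%:MP)%:P + ('X_i)%:P * 'X.

Lemma spread_local_equation v j f :
  spread (local_equation v j f) = mevT (chart v j) f.
Proof.
pose g : {rmorphism {mpoly K[4]} -> {poly {mpoly K[4]}}} := mevT (chart v j).
rewrite /local_equation -[RHS]/(g f).
apply: (@rmorph_mpoly_ext _ _ _ (@spread K 4 \o comp_mpoly _) g) => [c|i] /=.
  by rewrite comp_mpolyC mevTC spreadC.
rewrite comp_mpolyXU mevTX -tnth_nth tnth_mktuple /chart; case: eqP => _; first by rewrite rmorph1.
by rewrite rmorphD /= spreadX spreadC.
Qed.

(** The point v + T x of the cone and its normalisation in the chart x_j = 1 differ by the factor
    v_j + T x_j. For a form of degree d this factor comes out as a d-th power, and it is invertible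
    modulo T^m. *)
Lemma mult_at_leastP d v f m : f \is d.-homog -> v != 0 ->
  mult_at_least m v f <-> mult m v f.
Proof.
move=> fd v0.
have E0 : mult_at_least m v f <->
    forall j, v 0 j != 0 -> exists h, mevT (chart v j) f = h * 'X^m.
  split=> [/forallP H j vj|H].
    rewrite -spread_local_equation; apply/spreadP => a am.
    have /implyP/(_ vj)/forallP/(_ (BMultinom am)) := H j.
    by move/eqP.
  apply/forallP => j; apply/implyP => vj; apply/forallP => a; apply/eqP.
  have := H j vj; rewrite -spread_local_equation => /spreadP; apply.
  exact: bmdeg.
rewrite E0; split=> [H|mf j vj].
  have [j vj] : exists j, v 0 j != 0.
    apply/existsP; apply: contraNT v0; rewrite negb_exists => /forallP v0.
    by apply/eqP/rowP => j; rewrite mxE; apply/eqP; rewrite -[_ == _]negbK.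
  have [h Eh] := H j vj.
  pose b : {mpoly K[4]} := (v 0 j)^-1%:MP * 'X_j.
  (* The truncated geometric series inverting 1 + T b modulo T^m; here v_j (1 + T b) is the j-th
     coordinate of v + T x. *)
  pose e : {poly {mpoly K[4]}} := \sum_(i < m) (- ('X * b%:P)) ^+ i.
  have Ee : (1 + 'X * b%:P) * e = 1 - (- b%:P) ^+ m * 'X^m.
    have -> : 1 + 'X * b%:P = - (- ('X * b%:P) - 1) by rewrite opprB opprK.
    rewrite mulNr -subrX1 opprB -exprMn; congr (1 - _ ^+ m).
    by rewrite mulNr mulrC.
  (* The substitution comes from (v_i + T x_i) / (v_j (1 + T b)) = v_i / v_j + T (x_i - v_i b) /
     (v_j (1 + T b)), with [e] in place of the inverse. *)
  pose th : {rmorphism {poly {mpoly K[4]}} -> {poly {mpoly K[4]}}} :=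
    horner_eval ('X * e) \o map_poly (mevT
      (fun i => ((v 0 j)^-1%:MP * ('X_i - (v 0 i)%:MP * b))%:P)).
  have thC c : th (c%:MP)%:P = (c%:MP)%:P.
    by rewrite /th /= map_polyC /= mevTC horner_evalE hornerC.
  have thX : th 'X = 'X * e by rewrite /th /= map_polyX horner_evalE hornerX.
  have thXi i : th ('X_i)%:P = ((v 0 j)^-1%:MP * ('X_i - (v 0 i)%:MP * b))%:P.
    by rewrite /th /= map_polyC /= mevTX horner_evalE hornerC.
  have := congr1 th Eh; rewrite (@mevT_comp _ _ _ th thC) rmorphM rmorphXn thX => E1.
  have [k Ek] : exists k, germ v f -
      mevT (fun i => (1 + 'X * b%:P) * mpC2 _ (v 0 j) * th (chart v j i)) f = k * 'X^m.
    apply: mev_congr => i; exists (('X_i - (v 0 i)%:MP * b)%:P * 'X * (- b%:P) ^+ m).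
    pose cc c : {poly {mpoly K[4]}} := (c%:MP)%:P.
    have vjP : cc (v 0 j) * cc (v 0 j)^-1 = 1.
      by rewrite /cc -polyCM -mpolyCM divff // mpolyC1.
    have bE : cc (v 0 j) * b%:P = ('X_j)%:P.
      by rewrite /b polyCM mulrA vjP mul1r.
    have Eth : cc (v 0 j) * th (chart v j i) =
        cc (v 0 i) + ('X_i - (v 0 i)%:MP * b)%:P * ('X * e).
      rewrite /chart; case: eqP => [->|_].
        by rewrite rmorph1 mulr1 polyCB polyCM -/(cc (v 0 j)) bE subrr mul0r addr0.
      rewrite rmorphD [th (_ * _)]rmorphM thC thXi thX mulrDr; congr (_ + _).
        by rewrite /cc -polyCM -mpolyCM mulrCA divff // mulr1.
      by rewrite polyCM -/(cc (v 0 j)^-1) !mulrA vjP mul1r.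
    rewrite -mulrA -/(cc (v 0 j)) Eth /mpC2 /= -/(cc (v 0 i)).
    rewrite mulrDr [(1 + _) * (_ * ('X * e))]mulrCA [(1 + _) * ('X * e)]mulrCA Ee.
    have Eb : ((v 0 i)%:MP * b)%:P = cc (v 0 i) * b%:P by apply: polyCM.
    rewrite polyCB Eb; move: (cc (v 0 i)) (b%:P) (('X_i)%:P) => c b' x; ring.
  have Eh2 : mevT (fun i => (1 + 'X * b%:P) * mpC2 _ (v 0 j) * th (chart v j i)) f =
      ((1 + 'X * b%:P) * mpC2 _ (v 0 j)) ^+ d * (th h * ('X * e) ^+ m).
    by rewrite (mevT_homog _ _ fd) -E1.
  exists (k + ((1 + 'X * b%:P) * mpC2 _ (v 0 j)) ^+ d * th h * e ^+ m).
  rewrite mulrDl -Ek Eh2 [('X * e) ^+ m]exprMn.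
  move: (_ ^+ d) (th h) (e ^+ m) (germ v f) ('X^m) => x1 x2 x3 x4 x5; ring.
pose cc c : {poly {mpoly K[4]}} := (c%:MP)%:P.
have vjP : cc (v 0 j) * cc (v 0 j)^-1 = 1.
  by rewrite /cc -polyCM -mpolyCM divff // mpolyC1.
(* Conversely the moving point of the chart is v_j^-1 times v + T w, where w_j = 0 and w_i = v_j x_i
   otherwise. *)
have [h Eh] := mult_evalT 'X (fun i => if i == j then 0 else cc (v 0 j) * ('X_i)%:P) mf.
exists (cc (v 0 j)^-1 ^+ d * h).
rewrite -mulrA -Eh -(mevT_homog _ _ fd); apply: eq_mevT => i.
rewrite /chart mulrDr /mpC2 /= -/(cc (v 0 i)); case: eqP => [->|_].
  by rewrite mul0r mulr0 addr0 mulrC vjP.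
by rewrite !mulrA [_ * cc (v 0 j)]mulrC vjP mul1r /cc -polyCM -mpolyCM mulrC.
Qed.

End LocalMultiplicity.

(** * Wronskians for a derivation that descends to a field *)

Section Wronskian.

Variables (K L : fieldType) (A : comNzRingType).
Variables (io : {rmorphism K -> A}) (phi : {rmorphism A -> L}).
Variable D : {additive A -> A}.
Hypothesis DM : forall x y, D (x * y) = D x * y + x * D y.
Hypothesis DC : forall c, D (io c) = 0.
Hypothesis phiD : forall x, phi x = 0 -> phi (D x) = 0.
Hypothesis constants : forall a b, phi b != 0 ->
  phi (b * D a - D b * a) = 0 -> exists c, phi (a - io c * b) = 0.

Definition wronskian n (F : 'I_n -> A) := \det (\matrix_(i, j) iter i D (F j)).

(** If it vanished, the cofactors x_j of the last row would satisfy sum_j D^i(F_j) x_j = 0 for every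
    i, the last of them being nonzero by induction. Differentiation shows that the ratios x_j /
    x_max are constants, and then i = 0 is a forbidden linear relation between the F_j. *)
Lemma wronskian_neq0 n (F : 'I_n -> A) :
  (forall c : 'rV[K]_n, phi (lincomb io F c) = 0 -> c = 0) ->
  phi (wronskian F) != 0.
Proof.
elim: n F => [|n IH] F iF; first by rewrite /wronskian det_mx00 rmorph1 oner_neq0.
apply/eqP => W0.
pose W : 'M[A]_n.+1 := \matrix_(i, j) iter i D (F j).
pose x j := cofactor W ord_max j.
have Wx i : \sum_j W i j * x j = wronskian F *+ (i == ord_max).
  have := congr1 (fun M : 'M_n.+1 => M i ord_max) (mul_mx_adj W).
  rewrite !mxE => E; rewrite -[wronskian F]/(\det W) -E.
  by apply: eq_bigr => j _; rewrite !mxE.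
have phiWx i : phi (\sum_j W i j * x j) = 0.
  by rewrite Wx rmorphMn /= [phi _]W0 mul0rn.
have xmax : phi (x ord_max) != 0.
  rewrite /x /cofactor rmorphM rmorphXn rmorphN1 mulf_neq0 ?expf_neq0 ?oppr_eq0 ?oner_eq0 //.
  have -> : row' ord_max (col' ord_max W) =
      \matrix_(i < n, j < n) iter i D (F (lift ord_max j)).
    by apply/matrixP => i j; rewrite !mxE lift_max.
  apply: IH => c Hc.
  have /iF : phi (lincomb io F (\row_j (if unlift ord_max j is Some i then c 0 i else 0))) = 0.
    rewrite /lincomb (bigD1 ord_max) //= mxE unlift_none rmorph0 mul0r add0r.
    rewrite -[RHS]Hc; congr (phi _); rewrite /lincomb (reindex_omap (lift ord_max) (unlift ord_max)) /=; last first.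
      by move=> i; case: unliftP => [j ->|->]; rewrite ?eqxx // => _; rewrite liftK.
    apply: eq_big => [i|i _]; first by rewrite liftK eqxx eq_sym neq_lift.
    by rewrite mxE liftK.
  move=> /rowP c0; apply/rowP => i; have := c0 (lift ord_max i).
  by rewrite !mxE liftK.
pose y j := x ord_max * D (x j) - D (x ord_max) * x j.
(* Differentiating relation i gives relation i + 1, which is zero, plus the same combination with
   x_j replaced by D x_j. *)
have phiWD (i : 'I_n) : phi (\sum_j W (lift ord_max i) j * D (x j)) = 0.
  have := congr1 D (Wx (lift ord_max i)).
  rewrite eq_sym (negbTE (neq_lift _ _)) mulr0n raddf0 raddf_sum /=.
  under eq_bigr do rewrite DM.
  rewrite big_split /= => /(congr1 phi); rewrite rmorph0 rmorphD /=.
  set a := phi _; suff -> : a = 0 by rewrite add0r.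
  have iS : (i.+1 < n.+1)%N by rewrite ltnS.
  rewrite -(phiWx (Ordinal iS)); congr (phi _); apply: eq_bigr => j _.
  by rewrite !mxE lift_max.
have phiy (j : 'I_n.+1) : phi (y j) = 0.
  case: (unliftP ord_max j) => [j' ->|->]; last first.
    by rewrite /y mulrC subrr rmorph0.
  pose N : 'M[L]_n := map_mx phi (row' ord_max (col' ord_max W)).
  have N1 : N \in unitmx.
    rewrite unitmxE unitfE /N det_map_mx; move: xmax; rewrite /x /cofactor rmorphM.
    by rewrite mulf_eq0 negb_or => /andP [].
  pose Y : 'cV[L]_n := \col_i phi (y (lift ord_max i)).
  have : N *m Y = 0.
    apply/colP => i; rewrite !mxE.
    transitivity (phi (\sum_k W (lift ord_max i) k * y k)).
      have y0 : y ord_max = 0 by rewrite /y mulrC subrr.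
      rewrite (bigD1 ord_max) //= y0 mulr0 add0r rmorph_sum.
      rewrite [RHS](reindex_omap (lift ord_max) (unlift ord_max)) /=; last first.
        by move=> k; case: unliftP => [k' ->|->]; rewrite ?eqxx // => _; rewrite liftK.
      apply: eq_big => [k|k _]; first by rewrite liftK eqxx eq_sym neq_lift.
      by rewrite rmorphM /= !mxE.
    have -> : \sum_k W (lift ord_max i) k * y k =
        x ord_max * (\sum_k W (lift ord_max i) k * D (x k))
        - D (x ord_max) * (\sum_k W (lift ord_max i) k * x k).
      rewrite !mulr_sumr -sumrB; apply: eq_bigr => k _; rewrite /y.
      by move: (W _ _) (x ord_max) => w1 w2; ring.
    by rewrite rmorphB !rmorphM /= phiWD phiWx !mulr0 subrr.
  move=> /(congr1 (mulmx (invmx N))); rewrite mulKmx // mulmx0 => /colP /(_ j').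
  by rewrite !mxE.
have [c Hc] := choice _ (fun j => constants xmax (phiy j)).
have /rowP/(_ ord_max) : \row_j c j = 0 :> 'rV[K]_n.+1.
  apply: iF; have := phiWx ord0; rewrite rmorph_sum /= => E.
  apply: (mulIf xmax); rewrite mul0r -[RHS]E /lincomb rmorph_sum mulr_suml.
  apply: eq_bigr => j _.
  have Ej : phi (x j) = phi (io (c j)) * phi (x ord_max).
    by have := Hc j; rewrite rmorphB [phi (io _ * _)]rmorphM => /eqP; rewrite subr_eq0 => /eqP.
  rewrite [phi (W _ _ * _)]rmorphM Ej !mxE /= [phi (io _ * F j)]rmorphM /=.
  by rewrite mulrCA mulrA.
rewrite !mxE => c0; have := Hc ord_max; rewrite c0 rmorph0 mul0r subr0 => /eqP.
by rewrite (negbTE xmax).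
Qed.

Lemma iterD_klinear k : klinear io io (iter k D).
Proof.
move=> c x y; elim: k => //= k ->.
by rewrite raddfD /= DM DC mul0r add0r.
Qed.

(** Vanishing to order m at the point [pi], measured along the vector field D. *)
Definition osculating (pi : A -> K) m x := forall j, (j < m)%N -> pi (iter j D x) = 0.

Lemma osculating_subspace (pi : {rmorphism A -> K}) m :
  (forall c, pi (io c) = c) -> subspace io (osculating pi m).
Proof.
move=> piC; split=> [j _|c x y Hx Hy j jm].
  by rewrite (klinear0 (iterD_klinear j)) rmorph0.
by rewrite iterD_klinear rmorphD rmorphM /= Hx // Hy // mulr0 addr0.
Qed.

Variable S : A -> Prop.
Hypothesis sS : subspace io S.

Lemma phi_klinear : klinear io (phi \o io) phi.
Proof. by move=> c x y; rewrite rmorphD rmorphM. Qed.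

(** [w] is the Wronskian of lifts of a basis. Its value at [pi] is the determinant of the
    derivatives of order below n there, so where it is nonzero these n conditions are independent,
    and the first m of them cut the dimension down by m. One [w] serves all m. *)
Lemma osculating_dim n : hasdim (phi \o io) (imageof phi S) n ->
  exists2 w, phi w != 0 & forall pi : {rmorphism A -> K},
    (forall c, pi (io c) = c) -> (forall x, phi x = 0 -> pi x = 0) ->
    pi w != 0 -> forall m, exists2 k, (k <= n - m)%N &
    hasdim (phi \o io) (imageof phi (fun x => S x /\ osculating pi m x)) k.
Proof.
move=> [y [Sy fy gy]].
have [F HF] := choice _ (fun i => let: ex_intro2 v Sv Ev := Sy i in
  ex_intro (fun v => S v /\ y i = phi v) v (conj Sv Ev)).
exists (wronskian F).
  apply: wronskian_neq0 => c Hc; apply: fy; rewrite -[RHS]Hc /lincomb rmorph_sum.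
  by apply: eq_bigr => i _; rewrite rmorphM /= (HF i).2.
move=> pi piC piK piw m.
have kD j x : phi x = 0 -> phi (iter j D x) = 0.
  by move=> x0; elim: j => //= j; apply: phiD.
pose N : 'M[K]_n := \matrix_(i, j) pi (iter i D (F j)).
have N1 : N \in unitmx.
  rewrite unitmxE unitfE; move: piw; rewrite /wronskian -det_map_mx.
  by congr (\det _ != 0); apply/matrixP => i j; rewrite !mxE.
have sO : subspace io (fun x => S x /\ osculating pi m x).
  have [o0 oP] := osculating_subspace m piC; case: (sS) => s0 sP; split=> // c x z [? ?] [? ?].
  by split; [apply: sP | apply: oP].
have dS : hasdim (phi \o io) (imageof phi S) n by exists y.
have [k kn dk] : exists2 k, (k <= n)%N &
    hasdim (phi \o io) (imageof phi (fun x => S x /\ osculating pi m x)) k.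
  apply: hasdim_sub dS; first by apply: subspace_image sO; apply: phi_klinear.
  by move=> _ [v [Sv _] ->]; exists v.
exists k => //; case: dk => u [Su fu _].
have [X HX] := choice _ (fun i => let: ex_intro2 v Sv Ev := Su i in
  ex_intro (fun v => (S v /\ osculating pi m v) /\ u i = phi v) v (conj Sv Ev)).
have [c Hc] := choice _ (fun i => gy (u i) (ex_intro2 _ _ (X i) (HX i).1.1 (HX i).2)).
pose C : 'M[K]_(k, n) := \matrix_i c i.
have fC : row_free C.
  rewrite -kermx_eq0; apply/eqP/row_matrixP => i; rewrite row0; apply: fu.
  have -> : lincomb (phi \o io) u (row i (kermx C)) =
    lincomb (phi \o io) (fun i => lincomb (phi \o io) y (row i C)) (row i (kermx C)).
    by apply: eq_bigr => j _; rewrite [u j]Hc rowK.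
  by rewrite lincomb_mulmx -row_mul mulmx_ker row0 lincomb0.
have CN (i : 'I_k) (l : 'I_n) : (l < m)%N -> (C *m N^T) i l = 0.
  move=> lm; have := (HX i).1.2 l lm.
  have E0 : phi (X i - lincomb io F (c i)) = 0.
    rewrite rmorphB /= -(HX i).2 Hc (klinear_lincomb phi_klinear) /lincomb.
    by apply/eqP; rewrite subr_eq0; apply/eqP; apply: eq_bigr => j _ /=; rewrite (HF j).2.
  have := piK _ (kD l _ E0); have lD := iterD_klinear l.
  have -> : iter l D (X i - lincomb io F (c i)) = iter l D (X i) - iter l D (lincomb io F (c i)).
    by have := lD (-1) (lincomb io F (c i)) (X i); rewrite !rmorphN1 !mulN1r addrC => ->; rewrite addrC.
  rewrite rmorphB /= => /eqP; rewrite subr_eq0 => /eqP -> <-.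
  rewrite (klinear_lincomb lD) /lincomb rmorph_sum mxE; apply: eq_bigr => j _.
  by rewrite rmorphM /= piC !mxE.
have rC : \rank (C *m N^T) = k.
  by rewrite mxrankMfree; [apply/eqP | rewrite row_free_unit unitmx_tr].
(* The coordinates of osculating elements, after the invertible matrix [N^T], have their first m
   columns zero, so their rank is at most n - m. *)
have : (C *m N^T <= kermx (pid_mx (minn m n) : 'M[K]_n))%MS.
  apply/sub_kermxP/matrixP => i l; rewrite !mxE big1 // => j _; rewrite [pid_mx _ _ _]mxE.
  case: (ltnP j m) => jm; first by rewrite CN // mul0r.
  have /negbTE -> : ~~ (j < minn m n)%N by rewrite leq_min negb_and -leqNgt jm.
  by rewrite andbF mulr0.
move=> /mxrankS; rewrite rC mxrank_ker rank_pid_mx ?geq_minr // => /leq_trans; apply.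
by rewrite -[n in (_ <= n - _)%N]/n; lia.
Qed.

End Wronskian.

(** * The function field of u^2 + B u + C and its constants *)

Lemma deriv_eq0_const (K : fieldType) (charK : [pchar K] =i pred0) (f : {poly K}) :
  f^`() = 0 -> (size f <= 1)%N.
Proof.
move=> f0; apply/leq_sizeP => -[//|j _].
have := congr1 (fun p : {poly K} => p`_j) f0; rewrite coef_deriv coef0 => /eqP.
by rewrite -mulr_natr mulf_eq0 ((pcharf0P K).1 charK) orbF => /eqP.
Qed.

(** In lowest terms f1 / g1 the relation makes f1 divide its own derivative and g1 likewise; in
    characteristic 0 both are then constants. *)
Lemma wronskian2_poly (K : fieldType) (charK : [pchar K] =i pred0) (f g : {poly K}) :
  g != 0 -> g * f^`() = g^`() * f -> exists c, f = c%:P * g.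
Proof.
move=> g0 E; have [->|f0] := eqVneq f 0; first by exists 0; rewrite mul0r.
pose h := gcdp f g; have h0 : h != 0 by rewrite gcdp_eq0 negb_and f0.
have /dvdpP [f1 Ef] : h %| f by apply: dvdp_gcdl.
have /dvdpP [g1 Eg] : h %| g by apply: dvdp_gcdr.
have cop : coprimep f1 g1.
  have := coprimep_div_gcd (p := f) (q := g); rewrite f0 => /(_ isT).
  by rewrite -/h {1}Ef {1}Eg !mulpK.
have f10 : f1 != 0 by apply: contraNneq f0; rewrite Ef => ->; rewrite mul0r.
have g10 : g1 != 0 by apply: contraNneq g0; rewrite Eg => ->; rewrite mul0r.
have E1 : g1 * f1^`() = g1^`() * f1.
  apply: (mulIf (mulf_neq0 h0 h0)).
  have : g * f^`() - g^`() * f = (g1 * f1^`() - g1^`() * f1) * (h * h).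
    by rewrite Ef Eg !derivM; ring.
  by rewrite E subrr => /esym/eqP; rewrite mulrBl subr_eq0 => /eqP.
have f1c : (size f1 <= 1)%N.
  apply: deriv_eq0_const => //; apply/eqP; apply: contraTT isT => f1'.
  have : f1 %| f1^`() by rewrite -(Gauss_dvdpr _ cop) E1 dvdp_mull.
  by move=> /(dvdp_leq f1'); rewrite leqNgt lt_size_deriv.
have g1c : (size g1 <= 1)%N.
  apply: deriv_eq0_const => //; apply/eqP; apply: contraTT isT => g1'.
  have : g1 %| g1^`() by rewrite coprimep_sym in cop; rewrite -(Gauss_dvdpr _ cop) mulrC -E1 dvdp_mulr.
  by move=> /(dvdp_leq g1'); rewrite leqNgt lt_size_deriv.
have Cf := size1_polyC f1c; have Cg := size1_polyC g1c.
have g10' : g1`_0 != 0 by apply: contraNneq g10 => E0; rewrite Cg E0.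
exists (f1`_0 / g1`_0); rewrite Ef Eg {1}Cf {2}Cg mulrA -polyCM.
by rewrite divfK.
Qed.

Section Curve.

Variable K : fieldType.
Hypothesis closedK : forall p : {poly K}, size p != 1%N -> exists x, root p x.
Hypothesis charK : [pchar K] =i pred0.
Variables B C : {poly K}.
Let Delta := B ^+ 2 - 4%:R * C.
Hypothesis nsq : forall e, Delta <> e ^+ 2.

Local Notation A := {poly {poly K}}.

Definition curve : A := 'X^2 + B%:P * 'X + C%:P.
Local Notation G := curve.

(** The Hamiltonian derivation G_u d/ds - G_s d/du. It kills G, hence acts on the curve, where it is
    the vector field dual to the invariant differential ds / G_u. *)
Definition dC (F : A) : A := G^`() * dS F - dS G * F^`().

Fact dC_is_zmod_morphism : zmod_morphism dC.
Proof. by move=> x y; rewrite /dC raddfB derivB /=; ring. Qed.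
HB.instance Definition _ := GRing.isZmodMorphism.Build A A dC dC_is_zmod_morphism.

Lemma dCM x y : dC (x * y) = dC x * y + x * dC y.
Proof. by rewrite /dC dSM derivM; ring. Qed.

Lemma dCC c : dC (polyC2 c) = 0.
Proof. by rewrite /dC dSC !derivC polyC0 !mulr0 subrr. Qed.

Lemma dCG : dC G = 0.
Proof. by rewrite /dC mulrC subrr. Qed.

Lemma curve_monic : G \is monic.
Proof.
rewrite /curve -addrA monicE lead_coefDl ?lead_coefXn //.
by rewrite size_polyXn ltnS (leq_trans (size_polyD _ _)) // geq_max size_polyC (leq_trans (leq_b1 _)) // andbT (leq_trans (size_polyMleq _ _)) // size_polyX size_polyC; case: eqP.
Qed.

Lemma size_curve : size G = 3%N.
Proof.
rewrite /curve -addrA size_polyDl ?size_polyXn //.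
by rewrite ltnS (leq_trans (size_polyD _ _)) // geq_max size_polyC (leq_trans (leq_b1 _)) // andbT (leq_trans (size_polyMleq _ _)) // size_polyX size_polyC; case: eqP.
Qed.

Lemma deriv_curve : G^`() = 'X *+ 2 + B%:P.
Proof. by rewrite /curve !derivD derivXn derivM !derivC derivX /=; ring. Qed.

Lemma dS_curve : dS G = B^`()%:P * 'X + C^`()%:P.
Proof.
by rewrite /curve !raddfD /= !dSM !dSC !dSX; ring.
Qed.

(** With Y = G_u the curve is the double cover Y^2 = Delta of the s-line. Since 2 is invertible, 1
    and Y replace 1 and u as a basis over K[s], and conjugation is Y -> -Y. *)
Lemma deriv_curve_sq : G^`() ^+ 2 = Delta%:P + 4%:R * G.
Proof.
rewrite deriv_curve /curve /Delta polyCB !polyCM polyC_natr.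
by rewrite -mulr_natr; ring.
Qed.

Lemma dC_deriv_curve : 2%:R * dC G^`() = Delta^`()%:P.
Proof.
have E1 : dS G^`() = B^`()%:P.
  by rewrite deriv_curve [dS _]raddfD /= dSC [dS _]raddfMn /= dSX mul0rn add0r.
have E2 : (G^`())^`() = 2%:R by rewrite deriv_curve derivD derivMn derivX derivC addr0.
rewrite /dC E1 E2 dS_curve deriv_curve /Delta.
have -> : (B ^+ 2 - 4%:R * C)^`() = 2%:R * B * B^`() - 4%:R * C^`().
  by rewrite derivB !derivM -(polyC_natr K 4) derivC; ring.
rewrite polyCB !polyCM !polyC_natr.
by ring.
Qed.

Lemma dC_inner p : dC p%:P = G^`() * p^`()%:P.
Proof. by rewrite /dC dSC derivC mulr0 subr0. Qed.

Lemma nonroot (p : {poly K}) : p != 0 -> exists x, p.[x] != 0.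
Proof.
move=> p0; have [N1|N1] := eqVneq (size (p - 1)) 1%N.
  have sp : (size p <= 1)%N.
    by rewrite -[p](subrK 1) (leq_trans (size_polyD _ _)) // N1 size_poly1.
  by exists 0; rewrite (size1_polyC sp) hornerC -polyC_eq0 -size1_polyC.
have [s] := closedK N1; rewrite /root !hornerE subr_eq0 => /eqP Es.
by exists s; rewrite Es oner_neq0.
Qed.

Lemma two_neq0 : 2%:R != 0 :> K.
Proof. by rewrite ((pcharf0P K).1 charK). Qed.

Lemma curve_division (F : A) : exists Q a b, F = G * Q + (a%:P + b%:P * 'X).
Proof.
have mG := curve_monic.
exists (Pdiv.Ring.rdivp F G), (Pdiv.Ring.rmodp F G)`_0, (Pdiv.Ring.rmodp F G)`_1.
rewrite {1}(Pdiv.RingMonic.rdivp_eq mG F) mulrC; congr (_ + _).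
have : (size (Pdiv.Ring.rmodp F G) < 3)%N by rewrite -size_curve Pdiv.Ring.ltn_rmodpN0 // monic_neq0.
move: (Pdiv.Ring.rmodp F G) => r sr; apply/polyP => i; rewrite coefD coefCM coefC coefX.
case: i => [|[|i]] /=; rewrite ?mulr0 ?addr0 ?mulr1 ?add0r //.
by rewrite nth_default //; move: sr; rewrite ltnS => /leq_trans; apply.
Qed.

(** Completing the square gives (2a + B b)^2 = Delta b^2, so that Delta would be a square. *)
Lemma curve_no_root (a b : {poly K}) : b != 0 -> a ^+ 2 + B * a * b + C * b ^+ 2 <> 0.
Proof.
move=> b0 E.
have E2 : (2%:R * a + B * b) ^+ 2 = Delta * b ^+ 2.
  by rewrite /Delta -[RHS]addr0 -(mulr0 4%:R) -E; ring.
have : b ^+ 2 %| (2%:R * a + B * b) ^+ 2 by rewrite E2 dvdp_mull.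
rewrite dvdp_pexp2r // => /dvdpP [e Ee]; apply: (@nsq e).
by apply: (mulIf (expf_neq0 2 b0)); rewrite -E2 Ee exprMn.
Qed.

Lemma fraction_div (R : idomainType) (x : {fraction R}) :
  exists a b, b != 0 /\ x * FracField.tofrac b = FracField.tofrac a.
Proof.
exists (frac (repr x)).1, (frac (repr x)).2; split; first exact: denom_ratioP.
rewrite -{1}[x]reprK; unlock FracField.tofrac; rewrite -[LHS]FracField.pi_mul.
apply/eqmodP; rewrite /= FracField.equivfE /FracField.mulf.
by rewrite !numden_Ratio ?mulr1 ?mul1r ?oner_neq0 ?denom_ratioP // mulrC.
Qed.

(** Of degree two without roots, the polynomial is irreducible over K(s), and L adjoins a root.
    Since G is monic in u, division with remainder happens already over K[s]; a nonzero remainder,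
    of degree at most one in u, is coprime to G and cannot vanish at the root. *)
Lemma function_field : exists (L : fieldType) (phi : {rmorphism A -> L}),
  forall F, phi F = 0 <-> exists F', F = G * F'.
Proof.
pose F0 : fieldType := {fraction {poly K}}.
pose tf : {rmorphism {poly K} -> F0} := @FracField.tofrac {poly K}.
have tf0 a : (tf a == 0) = (a == 0) by apply: tofrac_eq0.
pose p := map_poly tf G.
have sp : size p = 3%N.
  by rewrite size_map_poly_id0 ?size_curve // (monicP curve_monic) rmorph1 oner_neq0.
have irr : irreducible_poly p.
  apply: cubic_irreducible; first by rewrite sp.
  move=> x; apply/negP => /eqP px; have [a [b [b0 E]]] := fraction_div x.
  apply: (@curve_no_root a b b0); apply/eqP; rewrite -tf0; apply/eqP.
  rewrite !rmorphD !rmorphM /= -[FracField.tofrac a]E.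
  transitivity (p.[x] * FracField.tofrac b ^+ 2); last by rewrite px mul0r.
  rewrite /p /curve !rmorphD !rmorphM /= !map_polyX !map_polyC /=.
  by rewrite !(hornerD, hornerM, hornerX, hornerC); ring.
have [L _ [z rz _]] := irredp_FAdjoin irr.
pose phi : {rmorphism A -> L} := horner_eval z \o map_poly (in_alg L \o tf).
have phiE F : phi F = (map_poly (in_alg L) (map_poly tf F)).[z].
  by rewrite /phi /= horner_evalE map_poly_comp.
have phiG : phi G = 0 by rewrite phiE; apply/eqP.
exists L, phi => F; split=> [|[F' ->]]; last by rewrite rmorphM phiG mul0r.
have [Q [a [b ->]]] := curve_division F.
rewrite rmorphD rmorphM phiG mul0r add0r => E; exists Q.
suff -> : a%:P + b%:P * 'X = 0 :> A by rewrite addr0.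
apply/eqP; apply: contraTT isT => R0.
pose r := map_poly tf (a%:P + b%:P * 'X).
have r0 : r != 0.
  apply: contraNneq R0 => r0; apply/eqP/polyP => i; rewrite coef0; apply/eqP.
  by rewrite -tf0 -coef_map -/r r0 coef0.
have sr : (size r <= 2)%N.
  rewrite (leq_trans (size_poly _ _)) // (leq_trans (size_polyD _ _)) // geq_max.
  rewrite size_polyC (leq_trans (leq_b1 _)) // (leq_trans (size_polyMleq _ _)) //.
  by rewrite size_polyX size_polyC; case: eqP.
have cop : coprimep p r.
  have [g1|g1] := eqVneq (size (gcdp p r)) 1%N; first by rewrite /coprimep g1.
  have := irr.2 _ g1 (dvdp_gcdl _ _) => /eqp_size sg.
  have := dvdp_leq r0 (dvdp_gcdr p r); rewrite sg sp => /leq_trans /(_ sr).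
  by [].
have : coprimep (map_poly (in_alg L) p) (map_poly (in_alg L) r) by rewrite coprimep_map.
by move=> /coprimep_root /(_ rz); rewrite -phiE E eqxx.
Qed.

Section FunctionField.

Variables (L : fieldType) (phi : {rmorphism A -> L}).
Hypothesis phi0 : forall F, phi F = 0 <-> exists F', F = G * F'.

Lemma phi_eq0_dC F : phi F = 0 -> phi (dC F) = 0.
Proof. by move=> /phi0 [F' ->]; apply/phi0; exists (dC F'); rewrite dCM dCG mul0r add0r. Qed.

Lemma phi_linear_eq0 (a b : {poly K}) : phi (a%:P + b%:P * 'X) = 0 -> a = 0 /\ b = 0.
Proof.
move=> /phi0 [Q E].
have Q0 : Q = 0.
  apply/eqP; apply: contraTT isT => Q0.
  have := congr1 (fun p : {poly _} => size p) E.
  rewrite (size_monicM curve_monic Q0) size_curve.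
  have : (0 < size Q)%N by rewrite size_poly_gt0.
  have : (size (a%:P + b%:P * 'X : A)%R <= 2)%N.
    rewrite (leq_trans (size_polyD _ _)) // geq_max.
    rewrite size_polyC (leq_trans (leq_b1 _)) // (leq_trans (size_polyMleq _ _)) //.
    by rewrite size_polyX size_polyC; case: eqP.
  by lia.
rewrite Q0 mulr0 in E; split.
  by have := congr1 (fun p : A => p`_0) E; rewrite coefD coefCM coefC coefX mulr0 addr0 coef0.
by have := congr1 (fun p : A => p`_1) E; rewrite coefD coefCM coefC coefX mulr1 add0r coef0.
Qed.

Local Notation Y := (G^`()).

Lemma phi_linear_eq0' (a b : {poly K}) : phi (a%:P + b%:P * Y) = 0 -> a = 0 /\ b = 0.
Proof.
have -> : a%:P + b%:P * Y = (a + b * B)%:P + (2%:R * b)%:P * 'X.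
  by rewrite deriv_curve polyCD !polyCM polyC_natr; ring.
case/phi_linear_eq0 => Ea Eb.
have b0 : b = 0.
  apply/eqP; move/eqP: Eb; rewrite mulf_eq0 -polyC_natr polyC_eq0.
  by rewrite (negbTE two_neq0).
by move: Ea; rewrite b0 mul0r addr0.
Qed.

Lemma phi_normal_form (F : A) : exists a b, phi (2%:R * F) = phi (a%:P + b%:P * Y).
Proof.
have [Q [a [b E]]] := curve_division F.
exists (2%:R * a - b * B), b; apply/eqP; rewrite -subr_eq0 -rmorphB; apply/eqP.
apply/phi0; exists (2%:R * Q).
by rewrite E deriv_curve polyCB !polyCM polyC_natr; ring.
Qed.

Lemma norm_neq0 (a b : {poly K}) :
  phi (a%:P + b%:P * Y) != 0 -> a ^+ 2 - b ^+ 2 * Delta != 0.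
Proof.
apply: contraNneq => N0.
have [b0|b0] := eqVneq b 0.
  move: N0; rewrite b0 expr0n mul0r subr0 => /eqP; rewrite sqrf_eq0 => /eqP ->.
  by rewrite !polyC0 mul0r addr0 rmorph0.
have : b ^+ 2 %| a ^+ 2 by move/eqP: N0; rewrite subr_eq0 => /eqP ->; apply: dvdp_mulr.
rewrite dvdp_pexp2r // => /dvdpP [e Ee]; case: (@nsq e).
apply: (mulIf (expf_neq0 2 b0)); move/eqP: N0; rewrite subr_eq0 => /eqP.
by rewrite Ee exprMn => ->; rewrite mulrC.
Qed.

(** Multiplying by the conjugate of [b] makes the denominator a polynomial N in s and the numerator
    a1 + b1 Y. The equation then splits on the basis 1, Y: one component makes a1 / N constant, the
    other makes b1^2 Delta / N^2 constant. As constants are squares in [K], b1 != 0 would make Delta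
    a square. *)
Lemma curve_constants a b : phi b != 0 -> phi (b * dC a - dC b * a) = 0 ->
  exists c, phi (a - polyC2 c * b) = 0.
Proof.
move=> b0 W0.
have [al [be Ea]] := phi_normal_form a.
have [ga [de Eb]] := phi_normal_form b.
have two0 : phi 2%:R != 0.
  have -> : 2%:R = (2%:R)%:P + 0%:P * Y :> A by rewrite polyC0 mul0r addr0 polyC_natr.
  apply/eqP => /phi_linear_eq0' [/eqP]; rewrite -polyC_natr polyC_eq0.
  by rewrite (negbTE two_neq0).
(* The conjugate of 2b, whose product with 2b is the norm [N]. *)
pose bs : A := ga%:P - de%:P * Y.
pose N := ga ^+ 2 - de ^+ 2 * Delta.
have N0 : N != 0 by apply: norm_neq0; rewrite -Eb rmorphM mulf_neq0.
have phiN : phi N%:P = phi (2%:R * b * bs).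
  apply/eqP; rewrite -subr_eq0 rmorphM Eb -rmorphM -rmorphB; apply/eqP.
  apply/phi0; exists (4%:R * de%:P ^+ 2).
  rewrite /N /bs polyCB !polyCM.
  transitivity (de%:P ^+ 2 * (Y ^+ 2 - Delta%:P)); first by ring.
  by rewrite deriv_curve_sq; ring.
have bs0 : phi bs != 0.
  have : phi N%:P != 0.
    apply: contra_neq N0 => E; have := @phi_linear_eq0' N 0.
    by rewrite polyC0 mul0r addr0 => /(_ E) [].
  by rewrite phiN rmorphM mulf_eq0 negb_or => /andP [].
pose a1 := al * ga - be * de * Delta.
pose b1 := be * ga - al * de.
pose a' : A := a1%:P + b1%:P * Y.
have phia' : phi a' = phi (2%:R * a * bs).
  apply/eqP; rewrite -subr_eq0 rmorphM Ea -rmorphM -rmorphB; apply/eqP.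
  apply/phi0; exists (4%:R * be%:P * de%:P).
  rewrite /a' /a1 /b1 /bs !polyCB !polyCM.
  transitivity (be%:P * de%:P * (Y ^+ 2 - Delta%:P)); first by ring.
  by rewrite deriv_curve_sq; ring.
have phiD x y : phi x = phi y -> phi (dC x) = phi (dC y).
  move=> /eqP; rewrite -subr_eq0 -rmorphB => /eqP /phi_eq0_dC.
  have -> : dC (x - y) = dC x - dC y by apply: raddfB.
  by rewrite rmorphB => /eqP; rewrite subr_eq0 => /eqP.
have W1 : phi (N%:P * dC a' - dC N%:P * a') = 0.
  rewrite rmorphB !rmorphM (phiD _ _ phia') (phiD _ _ phiN) phia' phiN.
  rewrite -!rmorphM -rmorphB.
  have -> : 2%:R * b * bs * dC (2%:R * a * bs) - dC (2%:R * b * bs) * (2%:R * a * bs) =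
     (2%:R * bs) ^+ 2 * (b * dC a - dC b * a).
    by rewrite -!mulrA !dCM; ring.
  by rewrite rmorphM W0 mulr0.
have W2 : phi ((N * (2%:R * b1^`() * Delta + b1 * Delta^`()) - 2%:R * N^`() * b1 * Delta)%:P
    + (2%:R * (N * a1^`() - N^`() * a1))%:P * Y) = 0.
  rewrite -[RHS](mulr0 (phi 2%:R)) -W1 -rmorphM.
  apply/eqP; rewrite -subr_eq0 -rmorphB; apply/eqP; apply/phi0.
  exists (2%:R * 4%:R * (N^`()%:P * b1%:P - N%:P * b1^`()%:P)).
  have -> : dC a' = dC a1%:P + (dC b1%:P * Y + b1%:P * dC Y) by rewrite -dCM; apply: raddfD.
  rewrite /a' !dC_inner.
  have pE (n n' x x' y y' : {poly K}) : (n * (2%:R * x' * y + x * y') - 2%:R * n' * x * y)%:P =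
      n%:P * (2%:R * x'%:P * y%:P + x%:P * y'%:P) - 2%:R * n'%:P * x%:P * y%:P.
    by rewrite polyCB !polyCM !polyC_natr polyCD !polyCM !polyC_natr.
  have pE' (n n' x x' : {poly K}) : (2%:R * (n * x' - n' * x))%:P =
      2%:R * (n%:P * x'%:P - n'%:P * x%:P).
    by rewrite polyCM polyC_natr polyCB !polyCM.
  rewrite pE pE' -dC_deriv_curve.
  transitivity (2%:R * (N%:P * b1^`()%:P - N^`()%:P * b1%:P) * (Delta%:P - Y ^+ 2)); first by ring.
  by rewrite deriv_curve_sq; ring.
have [E1 /eqP E2] := phi_linear_eq0' W2.
have {E2} E2 : N * a1^`() = N^`() * a1.
  move: E2; rewrite mulf_eq0 -polyC_natr polyC_eq0 (negbTE two_neq0) /= subr_eq0.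
  by move/eqP.
have [c Ec] := wronskian2_poly charK N0 E2.
have b10 : b1 = 0.
  apply/eqP; apply: contraTT isT => b10.
  have N20 : N ^+ 2 != 0 by rewrite expf_neq0.
  have [|c' Ec'] := @wronskian2_poly _ charK (b1 ^+ 2 * Delta) (N ^+ 2) N20.
    move/eqP: E1; rewrite subr_eq0 => /eqP E1; rewrite !derivM.
    transitivity (N * b1 * (N * (2%:R * b1^`() * Delta + b1 * Delta^`()))); first by ring.
    by rewrite E1; ring.
  have c'0 : c' != 0.
    apply/eqP => c'0; move: Ec'; rewrite c'0 polyC0 mul0r => /eqP.
    rewrite mulf_eq0 sqrf_eq0 (negbTE b10) /= => /eqP D0.
    by apply: (@nsq 0); rewrite D0 expr0n.
  have [e He] : exists e, e ^+ 2 = c'.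
    have /closedK [e] : size ('X^2 - c'%:P) != 1%N by rewrite size_XnsubC.
    by rewrite /root !hornerE subr_eq0 => /eqP <-; exists e.
  have Esq : b1 ^+ 2 * Delta = (e%:P * N) ^+ 2 by rewrite Ec' exprMn -He rmorphXn.
  have : b1 ^+ 2 %| (e%:P * N) ^+ 2 by rewrite -Esq dvdp_mulr.
  rewrite dvdp_pexp2r // => /dvdpP [h Eh]; case: (@nsq h).
  by apply: (mulfI (expf_neq0 2 b10)); rewrite Esq Eh exprMn mulrC.
exists c; apply: (mulIf bs0); apply: (mulfI two0); rewrite mul0r mulr0 -!rmorphM.
have -> : 2%:R * ((a - polyC2 c * b) * bs) = 2%:R * a * bs - polyC2 c * (2%:R * b * bs) by ring.
rewrite rmorphB [phi (polyC2 c * _)]rmorphM -phia' -phiN -rmorphM -rmorphB.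
by rewrite /a' b10 polyC0 mul0r addr0 Ec polyCM subrr rmorph0.
Qed.

(** Twice [w], times its conjugate, is a nonzero polynomial N in s. Any point of the curve over an
    s0 with N(s0) != 0 will do, and one exists because G is monic in u. *)
Lemma nonvanishing_point (w : A) : phi w != 0 -> exists z, pt z G = 0 /\ pt z w != 0.
Proof.
move=> w0; have [a [b E]] := phi_normal_form w.
have two0 : phi 2%:R != 0.
  have -> : 2%:R = (2%:R)%:P + 0%:P * Y :> A by rewrite polyC0 mul0r addr0 polyC_natr.
  apply/eqP => /phi_linear_eq0' [/eqP]; rewrite -polyC_natr polyC_eq0.
  by rewrite (negbTE two_neq0).
have N0 : a ^+ 2 - b ^+ 2 * Delta != 0 by apply: norm_neq0; rewrite -E rmorphM mulf_neq0.
set N := _ - _ in N0.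
have [s0 Hs] := nonroot N0.
pose p : {poly K} := 'X^2 + (B.[s0])%:P * 'X + (C.[s0])%:P.
have /closedK [u0 ru] : size p != 1%N.
  rewrite /p -addrA size_polyDl ?size_polyXn //.
  rewrite ltnS (leq_trans (size_polyD _ _)) // geq_max size_polyC (leq_trans (leq_b1 _)) // andbT.
  by rewrite (leq_trans (size_polyMleq _ _)) // size_polyX size_polyC; case: eqP.
exists (s0, u0).
have zG : pt (s0, u0) G = 0.
  rewrite ptE /curve /= !(hornerD, hornerM, hornerXn, hornerX, hornerC) /=.
  by move: ru; rewrite /root /p !(hornerD, hornerM, hornerXn, hornerX, hornerC) => /eqP.
split=> //.
have ker x : phi x = 0 -> pt (s0, u0) x = 0.
  by move=> /phi0 [x' ->]; rewrite rmorphM /= zG mul0r.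
have eqK x y : phi x = phi y -> pt (s0, u0) x = pt (s0, u0) y.
  move=> Exy; apply/eqP; rewrite -subr_eq0.
  have <- : pt (s0, u0) (x - y) = pt (s0, u0) x - pt (s0, u0) y by apply: raddfB.
  apply/eqP/ker; have -> : phi (x - y) = phi x - phi y by apply: raddfB.
  by rewrite Exy subrr.
have E2 := eqK _ _ E.
have : pt (s0, u0) (2%:R * w) * pt (s0, u0) (a%:P - b%:P * Y) = N.[s0].
  rewrite E2; transitivity (pt (s0, u0) (N%:P)); last by rewrite ptE /= hornerC.
  rewrite -[LHS]/(pt (s0, u0) _ * pt (s0, u0) _).
  have <- : pt (s0, u0) ((a%:P + b%:P * Y) * (a%:P - b%:P * Y)) =
     pt (s0, u0) (a%:P + b%:P * Y) * pt (s0, u0) (a%:P - b%:P * Y) by apply: rmorphM.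
  apply: eqK; apply/eqP; rewrite -subr_eq0 -rmorphB; apply/eqP.
  apply/phi0; exists (- 4%:R * b%:P ^+ 2).
  rewrite /N polyCB !polyCM.
  transitivity (- (b%:P ^+ 2) * (Y ^+ 2 - Delta%:P)); first by ring.
  by rewrite deriv_curve_sq; ring.
apply: contra_eq_neq => w00.
have -> : pt (s0, u0) (2%:R * w) = pt (s0, u0) 2%:R * pt (s0, u0) w by apply: rmorphM.
by rewrite w00 mulr0 mul0r eq_sym; apply: Hs.
Qed.

End FunctionField.

End Curve.

(** * Points on the curve that are general for several systems at once *)

Lemma prod3_neq0 (R : comNzRingType) (L : fieldType) (f : {rmorphism R -> L})
    m (w : 'I_m -> R) g r (h : 'I_r -> R) :
  f ((\prod_k w k) * g * \prod_i h i) != 0 <->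
  (forall k, f (w k) != 0) /\ f g != 0 /\ forall i, f (h i) != 0.
Proof.
rewrite !rmorphM !rmorph_prod !mulf_eq0 !negb_or.
split=> [/andP[/andP[/prodf_neq0 Hw Hg] /prodf_neq0 Hh]|[Hw [Hg Hh]]].
  by split=> [k|]; [apply: Hw | split=> // i; apply: Hh].
by rewrite Hg andbT; apply/andP; split; apply/prodf_neq0 => i _.
Qed.

Section GeneralPoints.

Variable K : fieldType.
Hypothesis closedK : forall p : {poly K}, size p != 1%N -> exists x, root p x.
Hypothesis charK : [pchar K] =i pred0.
Variables B C : {poly K}.
Hypothesis nsq : forall e, B ^+ 2 - 4%:R * C <> e ^+ 2.

Local Notation A := {poly {poly K}}.
Local Notation G := (curve B C).

Variables (L : fieldType) (phi : {rmorphism A -> L}).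
Definition ioL : {rmorphism K -> L} := phi \o io2 K.
Hypothesis phi0 : forall F, phi F = 0 <-> exists F', F = G * F'.

Local Notation dim_le S n :=
  (exists2 k, (k <= n)%N & hasdim (ioL) (imageof phi S) k).

Definition osculates (z : nat -> K * K) (mu : nat -> nat) r (F : A) :=
  forall i, (i < r)%N -> @osculating K (A2 K) (dC B C) (pt (z i)) (mu i) F.

Lemma dim_le_mono (S S' : A -> Prop) n : subspace (io2 K) S' ->
  (forall F, S' F -> S F) -> dim_le S n -> dim_le S' n.
Proof.
move=> sS' SS [k kn dk].
have [k' kk' dk'] : exists2 k', (k' <= k)%N & hasdim (ioL) (imageof phi S') k'.
  apply: hasdim_sub dk; first by apply: subspace_image sS'; apply: phi_klinear.
  by move=> _ [F SF ->]; exists F => //; apply: SS.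
by exists k' => //; apply: leq_trans kn.
Qed.

Lemma ptC z c : pt z (io2 K c) = c.
Proof. by rewrite /pt ev2C. Qed.

Lemma pt_ker z : pt z G = 0 -> forall x, phi x = 0 -> pt z x = 0.
Proof.
by move=> zG x /phi0 [x' ->]; rewrite rmorphM /= zG mul0r.
Qed.

Lemma osculates_subspace z mu r S : subspace (io2 K) S ->
  subspace (io2 K) (fun F => S F /\ osculates z mu r F).
Proof.
have Hi i := osculating_subspace (@dCM _ B C) (@dCC _ B C) (mu i) (ptC (z i)).
move=> [S0 SP]; split; first by split=> // i _; case: (Hi i).
move=> c x y [Sx ox] [Sy oy]; split; first exact: SP.
by move=> i ir; case: (Hi i) => _; apply; [apply: ox | apply: oy].
Qed.

(** One point at a time: in each of the m systems the earlier points leave a subspace with its own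
    Wronskian, and the new point avoids the zeros of all of these, of G_u, and the two rulings
    through each earlier point. All systems are treated together because every level of the tower on
    Q has to use the same points. *)
Lemma general_points m (S : 'I_m -> A -> Prop) (N : 'I_m -> nat) (mu : 'I_m -> nat -> nat) r :
  (forall k, subspace (io2 K) (S k)) -> (forall k, dim_le (S k) (N k)) ->
  exists z : nat -> K * K,
    [/\ forall i, (i < r)%N -> pt (z i) G = 0 /\ pt (z i) G^`() != 0,
        forall i j, (i < j < r)%N -> (z i).1 != (z j).1 /\ (z i).2 != (z j).2
      & forall k, dim_le (fun F => S k F /\ osculates z (mu k) r F)
                         (N k - \sum_(i < r) mu k i)%N].
Proof.
move=> sS dS; elim: r => [|r [z [z1 z2 z3]]].
  exists (fun=> (0, 0)); split=> // [i j|k]; first by rewrite ltn0 andbF.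
  rewrite big_ord0 subn0; apply: dim_le_mono (dS k) => [|F [] //].
  exact: osculates_subspace.
pose S' k F := S k F /\ osculates z (mu k) r F.
have sS' k : subspace (io2 K) (S' k) by apply: osculates_subspace.
have Hw k : exists w, phi w != 0 /\ forall z', pt z' G = 0 -> pt z' w != 0 -> forall j,
    dim_le (fun F => S' k F /\ @osculating K (A2 K) (dC B C) (pt z') j F) (N k - \sum_(i < r) mu k i - j)%N.
  have [n nN dn] := z3 k.
  have [w w0 Hw] := osculating_dim (@dCM _ B C) (@dCC _ B C) (phi_eq0_dC phi0)
    (curve_constants closedK charK nsq phi0) (sS' k) dn.
  exists w; split=> // z' z'G z'w j.
  have [n' n'N dn'] := Hw (pt z') (ptC z') (pt_ker z'G) z'w j.
  by exists n' => //; apply: leq_trans n'N _; apply: leq_sub2r.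
have {Hw} [w Hw] := choice _ Hw.
(* This factor separates the new point from the i-th one in both coordinates. *)
pose h (i : 'I_r) : A := ('X%:P - polyC2 (z i).1) * ('X - polyC2 (z i).2).
have h0 (i : 'I_r) : phi (h i) != 0.
  rewrite /h rmorphM mulf_neq0 //; apply/eqP.
    have -> : 'X%:P - polyC2 (z i).1 = ('X - (z i).1%:P)%:P + 0%:P * 'X :> A.
      by rewrite /polyC2 /= polyCB polyC0 mul0r addr0.
    by move=> /(phi_linear_eq0 phi0) [/eqP]; rewrite polyXsubC_eq0.
  have -> : 'X - polyC2 (z i).2 = (- (z i).2%:P)%:P + 1%:P * 'X :> A.
    by rewrite /polyC2 /= polyCN polyC1 mul1r addrC.
  by move=> /(phi_linear_eq0 phi0) [_ /eqP]; rewrite oner_eq0.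
have G'0 : phi G^`() != 0.
  apply/eqP; rewrite deriv_curve.
  have -> : 'X *+ 2 + B%:P = B%:P + (2%:R)%:P * 'X :> A by rewrite polyC_natr; ring.
  move=> /(phi_linear_eq0 phi0) [_ /eqP]; rewrite -polyC_natr polyC_eq0.
  by rewrite (negbTE (two_neq0 charK)).
have /(nonvanishing_point closedK charK nsq phi0) [z' [z'G]] :
    phi ((\prod_k w k) * G^`() * \prod_i h i) != 0.
  by apply/(prod3_neq0 phi w G^`() h); split=> // k; case: (Hw k).
pose pz : {rmorphism {poly {poly K}} -> K} := pt z'.
rewrite -[pt z' _]/(pz _) => /(prod3_neq0 pz w G^`() h) [z'w [z'G' z'h]].
exists (fun i => if i == r then z' else z i); split.
- by move=> i; rewrite ltnS leq_eqVlt; case: eqP => // _ /= /z1.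
- move=> i j /andP [ij]; rewrite ltnS leq_eqVlt => /orP [/eqP jr|jr].
    rewrite jr eqxx; have ir : (i < r)%N by rewrite -jr.
    rewrite (ltn_eqF ir); have := z'h (Ordinal ir).
    rewrite /h rmorphM mulf_eq0 negb_or /=.
    have -> : pt z' ('X%:P - polyC2 (z i).1) = z'.1 - (z i).1.
      by rewrite ptE /polyC2 /= !hornerE.
    have -> : pt z' ('X - polyC2 (z i).2) = z'.2 - (z i).2.
      by rewrite ptE /polyC2 /= !hornerE.
    by rewrite !subr_eq0 => /andP [n1 n2]; split; rewrite eq_sym.
  have ir : (i < r)%N by apply: ltn_trans jr.
  by rewrite (ltn_eqF ir) (ltn_eqF jr); apply: z2; rewrite ij.
- move=> k; have := (Hw k).2 z' z'G (z'w k) (mu k r).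
  rewrite big_ord_recr /= subnDA; apply: dim_le_mono; first exact: osculates_subspace.
  move=> F [SF oF]; split; last by have := oF r (leqnn _); rewrite eqxx.
  split=> // i ir; have := oF i (ltnW _); rewrite (ltn_eqF ir); apply.
  by rewrite ltnS.
Qed.

End GeneralPoints.

(** * Newton polygons: forms on P^1 x P^1 with a multiple point at infinity *)

Section Polygons.

Variable K : fieldType.
Local Notation A := {poly {poly K}}.
Implicit Types F H : A.

Local Notation bl0 := (blow (0 : K, 0 : K)).

(** The monomial s^i u^j becomes s^i u^(i+j): after [bl0] the degree in u is the total degree. *)
Lemma blow_origin_coef F k i :
  (bl0 F)`_k`_i = if (i <= k)%N then F`_(k - i)`_i else 0.
Proof.
have bC p k' i' : (bl0 p%:P)`_k'`_i' = if i' == k' then p`_i' else 0.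
  elim/poly_ind: p k' i' => [|p c IH] k' i'.
    by rewrite polyC0 rmorph0 !coef0; case: ifP.
  have -> : bl0 (p * 'X + c%:P)%:P = bl0 p%:P * 'X%:P * 'X + c%:P%:P.
    rewrite polyCD polyCM rmorphD rmorphM /=; congr (_ + _).
      by rewrite -mulrA; congr (_ * _); rewrite /blow ev2s /polyC2 /= !polyC0 add0r.
    by rewrite /blow ev2C.
  rewrite coefD coefMX coefC coefD.
  case: k' => [|k'] /=; first by rewrite coef0 add0r coefC coefD coefMX coefC; case: i' => //=; rewrite add0r.
  rewrite coefMC coefMX coef0 addr0 coefD coefMX coefC.
  by case: i' => [|i'] //=; rewrite addr0 IH eqSS.
elim/poly_ind: F k i => [|F p IH] k i.
  by rewrite rmorph0 !coef0; case: ifP.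
have -> : bl0 (F * 'X + p%:P) = bl0 F * 'X + bl0 p%:P.
  rewrite rmorphD rmorphM /=; congr (_ * _ + _).
  by rewrite {1}/blow ev2u /polyC2 /= !polyC0 add0r.
have IH' : (bl0 F * 'X)`_k`_i = if (i < k)%N then F`_(k - i).-1`_i else 0.
  rewrite coefMX; case: k => [|k] /=; first by rewrite coef0.
  by rewrite IH ltnS; case: leqP => // ik; rewrite subSn.
rewrite coefD coefD IH' bC.
have [ik|ik|->] := ltngtP i k; rewrite ?addr0 //.
  by rewrite coefD coefMX coefC subn_eq0 leqNgt ik /= coefD coef0 addr0.
by rewrite subnn coefD coefMX coefC /= coefD coef0 !add0r.
Qed.

(** Sections of bidegree (e, e) with multiplicity at least [mu] at (infinity, infinity): in the
    coordinates 1/s, 1/u the monomial s^i u^j has order (e - i) + (e - j) there. *)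
Definition polygon e mu F :=
  forall i j, F`_j`_i != 0 -> [/\ (i <= e)%N, (j <= e)%N & (i + j + mu <= 2 * e)%N].

(** The degrees in u, in s and in total are additive on products, so in this form polygons can be
    multiplied and divided. *)
Lemma polygonP e mu F : polygon e mu F <->
  [/\ (size F <= e.+1)%N, (size (swapXY F) <= e.+1)%N
    & (size (bl0 F) <= (2 * e).+1 - mu)%N].
Proof.
split=> [HF|[s1 s2 s3] i j Fij].
  split; apply/leq_sizeP => k ek; apply/polyP => i; rewrite coef0; apply/eqP.
  - by apply: contraTT ek => /HF [_ jk _]; rewrite -ltnNge ltnS.
  - by rewrite coef_swapXY; apply: contraTT ek => /HF [jk _ _]; rewrite -ltnNge ltnS.
  - rewrite blow_origin_coef; case: leqP => // ik; apply: contraTT ek => /HF [_ _ H].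
    by rewrite -ltnNge; lia.
split.
- rewrite -ltnS; apply: leq_trans s2; rewrite ltnNge; apply: contraNN Fij.
  by move=> /leq_sizeP /(_ i (leqnn i)) E; rewrite -coef_swapXY E coef0.
- rewrite -ltnS; apply: leq_trans s1; rewrite ltnNge; apply: contraNN Fij.
  by move=> /leq_sizeP /(_ j (leqnn j)) E; rewrite E coef0.
- suff : (i + j < size (bl0 F))%N by move: s3; set s := size _; lia.
  rewrite ltnNge; apply: contraNN Fij => /leq_sizeP /(_ (i + j)%N (leqnn _)) E.
  have := blow_origin_coef F (i + j) i.
  by rewrite E coef0 leq_addr addKn => <-.
Qed.

Lemma polygon0 e F : (size F <= e.+1)%N -> (size (swapXY F) <= e.+1)%N -> polygon e 0 F.
Proof.
move=> s1 s2 i j Fij.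
have ie : (i <= e)%N.
  rewrite -ltnS; apply: leq_trans s2; rewrite ltnNge; apply: contraNN Fij.
  by move=> /leq_sizeP /(_ i (leqnn i)) E; rewrite -coef_swapXY E coef0.
have je : (j <= e)%N.
  rewrite -ltnS; apply: leq_trans s1; rewrite ltnNge; apply: contraNN Fij.
  by move=> /leq_sizeP /(_ j (leqnn j)) E; rewrite E coef0.
by split=> //; lia.
Qed.

Lemma polygon_subspace e mu : subspace (io2 K) (polygon e mu).
Proof.
split=> [i j|c F H PF PH i j]; first by rewrite !coef0 eqxx.
rewrite /io2 /= /polyC2 /= coefD coefCM coefD coefCM.
have [->|/PF //] := eqVneq (F`_j`_i) 0.
by rewrite mulr0 add0r => /PH.
Qed.

Lemma bl0_eq0 F : bl0 F = 0 -> F = 0.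
Proof.
move=> E; apply/polyP => j; apply/polyP => i.
have := blow_origin_coef F (i + j) i.
by rewrite E !coef0 leq_addr addKn.
Qed.

Lemma polygon_div H a b e mu e' mu' F :
  size H = a.+1 -> size (swapXY H) = a.+1 -> size (bl0 H) = b.+1 ->
  (e <= e' + a)%N -> ((0 < mu') ==> ((2 * e).+1 - mu <= (2 * e').+1 - mu' + b))%N ->
  polygon e mu (H * F) -> polygon e' mu' F.
Proof.
move=> H1 H2 H3 E1 E2 /polygonP [s1 s2 s3].
have [->|F0] := eqVneq F 0; first by case: (polygon_subspace e' mu').
have H0 : H != 0 by rewrite -size_poly_eq0 H1.
have sH0 : swapXY H != 0 by rewrite -size_poly_eq0 H2.
have bH0 : bl0 H != 0 by rewrite -size_poly_eq0 H3.
have sF0 : swapXY F != 0 by rewrite swapXY_eq0.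
have bF0 : bl0 F != 0 by apply: contra_neq F0; apply: bl0_eq0.
have := s1; rewrite size_mul // H1; have := s2; rewrite rmorphM size_mul // H2.
have := s3; rewrite rmorphM /= size_mul // H3.
set n1 := size F; set n2 := size _; set n3 := size _.
move: E2; case: posnP => [-> _|_ /= E2] ? ? ?; first by apply: polygon0; rewrite -/n1 -/n2 -/n3; lia.
by apply/polygonP; split; rewrite -/n1 -/n2 -/n3; lia.
Qed.

(** For mu = e the polygon is the triangle i + j <= e, on which the total degree bounds both
    exponents. *)
Lemma polygon_tri e F : (size (bl0 F) <= e.+1)%N -> polygon e e F.
Proof.
move=> s3 i j Fij.
suff : (i + j < size (bl0 F))%N by move: s3; set s := size _; move=> *; split; lia.
rewrite ltnNge; apply: contraNN Fij => /leq_sizeP /(_ (i + j)%N (leqnn _)) E.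
have := blow_origin_coef F (i + j) i.
by rewrite E coef0 leq_addr addKn => <-.
Qed.

Lemma polygon_div_tri H b e mu e' F : size (bl0 H) = b.+1 ->
  ((2 * e).+1 - mu <= e'.+1 + b)%N -> polygon e mu (H * F) -> polygon e' e' F.
Proof.
move=> H3 E2 /polygonP [_ _].
have [->|F0] := eqVneq F 0; first by case: (polygon_subspace e' e').
have bH0 : bl0 H != 0 by rewrite -size_poly_eq0 H3.
have bF0 : bl0 F != 0 by apply: contra_neq F0; apply: bl0_eq0.
rewrite rmorphM /= size_mul // H3 => s3; apply: polygon_tri.
by move: s3; set s := size _; lia.
Qed.

Lemma polygon_mul H a b e mu e' mu' F :
  (size H <= a.+1)%N -> (size (swapXY H) <= a.+1)%N -> (size (bl0 H) <= b.+1)%N ->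
  (e' + a <= e)%N -> ((2 * e').+1 - mu' + b <= (2 * e).+1 - mu)%N ->
  polygon e' mu' F -> polygon e mu (H * F).
Proof.
move=> H1 H2 H3 E1 E2 /polygonP [s1 s2 s3]; apply/polygonP.
have [->|F0] := eqVneq F 0; first by rewrite mulr0 !rmorph0 size_poly0.
have bF0 : bl0 F != 0 by apply: contra_neq F0; apply: bl0_eq0.
have : (0 < size (bl0 F))%N by rewrite size_poly_gt0.
have := size_polyMleq H F; rewrite rmorphM; have := size_polyMleq (swapXY H) (swapXY F).
rewrite rmorphM /=; have := size_polyMleq (bl0 H) (bl0 F).
move: s1 s2 s3 H1 H2 H3.
set n1 := size F; set n2 := size (swapXY F); set n3 := size (bl0 F).
set p1 := size H; set p2 := size (swapXY H); set p3 := size (bl0 H).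
set q1 := size (H * F); set q2 := size (swapXY H * _); set q3 := size (_ * bl0 F).
by move=> *; split; lia.
Qed.

Lemma coef_scale F (c : K) i j : (io2 K c * F)`_j`_i = c * F`_j`_i.
Proof. by rewrite /io2 /= /polyC2 /= !coefCM. Qed.

Lemma support_hasdim a b (X : {set 'I_a * 'I_b}) :
  hasdim (io2 K) (fun F => forall i j, F`_j`_i != 0 ->
    exists2 p, p \in X & (p.1 : nat) = i /\ (p.2 : nat) = j) #|X|.
Proof.
pose ev (k : 'I_#|X|) : 'I_a * 'I_b := enum_val k.
pose x (k : 'I_#|X|) : A2 K := ('X^((ev k).1))%:P * 'X^((ev k).2).
have xc (k : 'I_#|X|) i j : (x k)`_j`_i = ((i == (ev k).1) && (j == (ev k).2))%:R.
  rewrite /x coefCM coefXn; case: eqP => _; rewrite ?mulr0 ?coef0 ?andbF //.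
  by rewrite mulr1 coefXn andbT.
have lc (c : 'rV[K]_#|X|) (k : 'I_#|X|) :
    (lincomb (io2 K) x c : A)`_((ev k).2)`_((ev k).1) = c 0 k.
  rewrite /lincomb coef_sum coef_sum (bigD1 k) //= big1 => [|l lk].
    by rewrite addr0 coef_scale xc !eqxx mulr1.
  rewrite coef_scale xc.
  have -> : (((ev k).1 : nat) == (ev l).1) && (((ev k).2 : nat) == (ev l).2) = false.
    apply/negP => /andP [/eqP/val_inj E1 /eqP/val_inj E2].
    by move/eqP: lk; apply; apply: enum_val_inj; apply/esym/eqP; rewrite -pair_eqE /pair_eq E1 E2 !eqxx.
  by rewrite mulr0.
exists x; split.
- move=> k i j; rewrite xc; case: andP => [[/eqP -> /eqP ->] _|]; last by rewrite eqxx.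
  by exists (ev k) => //; apply: enum_valP.
- move=> c c0; apply/rowP => k; rewrite mxE -lc c0.
  by rewrite [(0 : A)`_ _]coef0 coef0.
- move=> F HF; pose c : 'rV[K]_#|X| := \row_k F`_((ev k).2)`_((ev k).1).
  exists c; apply/polyP => j; apply/polyP => i.
  have [E0|/HF [p pX [<- <-]]] := eqVneq (F`_j`_i) 0; last first.
    have := lc c (enum_rank_in pX p).
    by rewrite mxE /ev enum_rankK_in // => ->.
  rewrite E0 /lincomb coef_sum coef_sum big1 // => k _.
  rewrite coef_scale xc; case: andP => [[/eqP Ei /eqP Ej]|]; last by rewrite mulr0.
  by rewrite mxE -Ei -Ej E0 mul0r.
Qed.

Lemma sum_subn_triangle n m : (m <= n)%N -> (\sum_(i < n) (m - i) = 'C(m.+1, 2))%N.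
Proof.
move=> /subnKC <-; elim: m (n - m)%N => [|m IH] k.
  by rewrite big1.
rewrite addSn big_ord_recl /= subn0 binS bin1 addnC; congr (_ + _)%N.
by rewrite -(IH k); apply: eq_bigr => i _; rewrite /bump /= subSS.
Qed.

(** Because mu <= e, the corner cut off the square of side e + 1 is a full triangle with 1 + ... +
    mu lattice points. *)
Lemma polygon_hasdim e mu : (mu <= e)%N ->
  exists2 n, (n + 'C(mu.+1, 2) = e.+1 ^ 2)%N & hasdim (io2 K) (polygon e mu) n.
Proof.
move=> mue; pose X := [set p : 'I_e.+1 * 'I_e.+1 | (p.1 + p.2 + mu <= 2 * e)%N].
exists #|X|; last first.
  apply: hasdim_eq (support_hasdim X) => F; split=> H i j /H.
    case=> ie je ije; exists (inord i, inord j); rewrite ?inE !inordK //.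
  by case=> [[p1 p2]]; rewrite inE /= => Hp [<- <-]; split; rewrite // -ltnS.
have -> : (#|X| = \sum_(i < e.+1) (e.+1 - (mu - i)))%N.
  rewrite (reindex_inj rev_ord_inj) -sum1_card.
  rewrite (eq_bigl (fun p : 'I_e.+1 * 'I_e.+1 => true && (p.1 + p.2 + mu <= 2 * e)%N)); last by move=> p; rewrite inE.
  rewrite -(pair_big_dep xpredT (fun i j : 'I_e.+1 => (i + j + mu <= 2 * e)%N) (fun _ _ => 1%N)) /=.
  apply: eq_bigr => i _; have ie := ltn_ord i.
  rewrite sum1_card.
  have le : (e.+1 - (mu - (e.+1 - i.+1)) <= e.+1)%N by rewrite leq_subr.
  have winj : injective (widen_ord le) by move=> x y /(congr1 val) /= /val_inj.
  rewrite -[RHS]card_ord -(card_image winj).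
  apply: eq_card => j; rewrite unfold_in /=; have je := ltn_ord j.
  apply/idP/imageP => [H|[k _ ->]]; last first.
    by have := ltn_ord k; rewrite /= ; lia.
  have jl : (j < e.+1 - (mu - (e.+1 - i.+1)))%N by lia.
  by exists (Ordinal jl) => //; apply: val_inj.
rewrite -(@sum_subn_triangle e.+1 mu) ?leqW // -big_split /=.
under eq_bigr => i _ do rewrite subnK ?(leq_trans (leq_subr _ _)) ?leqW //.
by rewrite sum_nat_const card_ord.
Qed.

End Polygons.

(** * Three multiple points on P^1 x P^1 *)

Section Towers.

Variable K : fieldType.
Local Notation A := {poly {poly K}}.
Implicit Types F H : A.

Definition dimle (P : A2 K -> Prop) n := exists2 k, (k <= n)%N & hasdim (io2 K) P k.

Definition A1 : comNzRingType := {poly K}.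
Definition io1 : {rmorphism K -> A1} := @polyC K.

Lemma size_hasdim n : hasdim io1 (fun p : {poly K} => (size p <= n)%N) n.
Proof.
pose x (i : 'I_n) : A1 := 'X^i.
have lc (c : 'rV[K]_n) (k : 'I_n) : (lincomb io1 x c : {poly K})`_k = c 0 k.
  rewrite /lincomb coef_sum (bigD1 k) //= big1 => [|l lk].
    by rewrite addr0 coefCM coefXn eqxx mulr1.
  rewrite coefCM coefXn; case: eqP => [/val_inj E|]; rewrite ?mulr0 //.
  by rewrite E eqxx in lk.
exists x; split.
- by move=> i; rewrite size_polyXn ltn_ord.
- by move=> c c0; apply/rowP => k; rewrite mxE -lc c0 coef0.
- move=> p sp; pose c : 'rV[K]_n := \row_k p`_k; exists c; apply/polyP => i.
  have [ni|ni] := leqP n i; last first.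
    by have := lc c (Ordinal ni); rewrite /= => ->; rewrite mxE.
  rewrite nth_default ?(leq_trans sp) // /lincomb coef_sum big1 // => k _.
  by rewrite coefCM coefXn gtn_eqF ?mulr0 // (leq_trans (ltn_ord k)).
Qed.

Lemma mull_klinear (R : comNzRingType) (io : {rmorphism K -> R}) (d : R) :
  klinear io io (fun x => d * x).
Proof. by move=> c x y; rewrite mulrDr mulrCA. Qed.

Lemma dvdp_dim n (d : {poly K}) (P : {poly K} -> Prop) : d != 0 -> subspace io1 P ->
  (forall p, P p -> (size p <= n)%N /\ d %| p) ->
  exists2 k, (k <= n.+1 - size d)%N & hasdim io1 P k.
Proof.
move=> d0 sP HP.
have sS : subspace io1 (fun p : {poly K} => (size p <= n.+1 - size d)%N).
  split=> [|c x y Hx Hy]; first by rewrite size_poly0.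
  rewrite (leq_trans (size_polyD _ _)) // geq_max Hy andbT.
  by rewrite (leq_trans (size_polyMleq _ _)) // size_polyC; case: eqP => //= _; rewrite ?(leq_trans _ Hx) // leq_pred.
have : hasdim io1 (imageof (fun x : {poly K} => d * x) (fun p : {poly K} => (size p <= n.+1 - size d)%N)) (n.+1 - size d).
  apply: hasdim_image_inj (size_hasdim _) => //; first exact: mull_klinear.
  by move=> v _ /eqP; rewrite mulf_eq0 (negbTE d0) /= => /eqP.
apply: hasdim_sub => // p /HP [sp /dvdpP [q Eq]]; exists q; last by rewrite mulrC.
have [->|q0] := eqVneq q 0; first by rewrite size_poly0.
move: sp; rewrite Eq size_mul //; have : (0 < size q)%N by rewrite size_poly_gt0.
have : (0 < size d)%N by rewrite size_poly_gt0.
by move: (size d) (size q) => x y; lia.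
Qed.

Section Line.

Variables (z1 z2 : K * K).
Hypotheses (s12 : z1.1 != z2.1) (u12 : z1.2 != z2.2).

Definition slope := (z2.2 - z1.2) / (z2.1 - z1.1).
(** The graph u = line(s) is the curve of bidegree (1, 1) through z1, z2 and (infinity, infinity),
    irreducible because its slope is nonzero; [Gam] below is its equation. *)
Definition line : {poly K} := slope%:P * ('X - z1.1%:P) + z1.2%:P.

Lemma slope_neq0 : slope != 0.
Proof. by rewrite mulf_neq0 ?invr_eq0 // subr_eq0 eq_sym. Qed.

Lemma line2 : line = slope%:P * ('X - z2.1%:P) + z2.2%:P.
Proof.
rewrite /line; have E : slope * (z2.1 - z1.1) = z2.2 - z1.2.
  by rewrite /slope divfK // subr_eq0 eq_sym.
have -> : z2.2%:P = z1.2%:P + (slope%:P * (z2.1%:P - z1.1%:P)) :> {poly K}.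
  by rewrite -polyCB -polyCM E polyCB addrC subrK.
by ring.
Qed.

Lemma mult2_line m z F : line = slope%:P * ('X - z.1%:P) + z.2%:P ->
  mult2 m z F -> ('X - z.1%:P) ^+ m %| F.[line].
Proof.
move=> El [h Eh].
pose t : {poly K} := slope%:P * ('X - z.1%:P).
pose th : {rmorphism A -> {poly K}} := ev2 (@polyC K) (slope^-1)%:P t.
have thC (c : K) : th (polyC2 c) = c%:P by rewrite /th /= /polyC2 /= ev2C.
have ths : th 'X%:P = (slope^-1)%:P by rewrite /th /= ev2s.
have thu : th 'X = t by rewrite /th /= ev2u.
have E : th (blow z F) = F.[line].
  have -> : F.[line] = ev2 (@polyC K) 'X line F.
    pose f : {rmorphism A -> {poly K}} := horner_eval line.
    rewrite -[LHS]/(f F); apply: (@rmorph_poly2_ext _ _ f (ev2 (@polyC K) 'X line)) => [c||].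
    - by rewrite /f /= ev2C horner_evalE hornerC.
    - by rewrite /f /= ev2s horner_evalE hornerC.
    - by rewrite /f /= ev2u horner_evalE hornerX.
  rewrite /blow (@ev2_comp _ _ _ _ (@polyC K) _ _ th) //.
  congr (ev2 _ _ _ F).
    rewrite rmorphD rmorphM thC ths thu /t mulrA -polyCM mulVf ?slope_neq0 // mul1r.
    by rewrite addrC subrK.
  by rewrite rmorphD thC thu El addrC.
rewrite -E Eh rmorphM rmorphXn thu /t exprMn mulrCA mulrA dvdp_mull //.
Qed.

Lemma size_horner_line n F : (size (blow (0%R : K, 0%R : K) F) <= n)%N -> (size F.[line] <= n)%N.
Proof.
move=> sF; rewrite horner_coef.
apply: (leq_trans (size_sum _ _ _)); apply/bigmax_leqP => j _.
have [->|Fj] := eqVneq F`_j 0; first by rewrite mul0r size_poly0.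
have : (size (F`_j)%R + j <= n)%N.
  have : (blow (0%R : K, 0%R : K) F)`_((size (F`_j)%R).-1 + j) != 0.
    apply/eqP => /(congr1 (fun p : {poly K} => p`_(size (F`_j)%R).-1)).
    by rewrite blow_origin_coef leq_addr addKn coef0 => /eqP; rewrite -lead_coefE lead_coef_eq0 (negbTE Fj).
  have : (0 < size (F`_j)%R)%N by rewrite size_poly_gt0.
  move: (size (F`_j)%R) => x x0; apply: contraR; rewrite -ltnNge => H; apply/eqP/nth_default.
  by apply: (leq_trans sF); lia.
apply: leq_trans; rewrite (leq_trans (size_polyMleq _ _)) //.
have : (size (line ^+ j) <= j.+1)%N.
  rewrite (leq_trans (size_poly_exp_leq _ _)) // ltnS.
  rewrite -[X in (_ <= X)%N]mul1n leq_mul2r; apply/orP; right.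
  have : (size line <= 2)%N; last by case: (size line) => [|[|[]]].
  rewrite /line (leq_trans (size_polyD _ _)) // geq_max (leq_trans (size_polyMleq _ _)).
    by rewrite size_polyC; case: eqP.
  by rewrite size_XsubC size_polyC; case: eqP.
by move: (size (F`_j)%R) (size (line ^+ j)%R) => x y; lia.
Qed.

Definition Gam : A := 'X - line%:P.

Lemma size_line : size line = 2%N.
Proof.
rewrite /line size_polyDl size_Cmul ?slope_neq0 ?size_XsubC // size_polyC.
by case: eqP.
Qed.

Lemma Gam_coef j i : Gam`_j`_i = if j is 0 then - line`_i else ((j == 1) && (i == 0))%:R.
Proof.
rewrite /Gam coefB coefX coefC; case: j => [|[|j]] /=.
- by rewrite sub0r coefN.
- by rewrite subr0 coef1; case: eqP.
- by rewrite subr0 coef0.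
Qed.

Lemma Gam_sizes : [/\ size Gam = 2%N, size (swapXY Gam) = 2%N & size (blow (0%R : K, 0%R : K) Gam) = 2%N].
Proof.
have l1 : line`_1 != 0 by have := lead_coef_eq0 line; rewrite lead_coefE size_line /= => ->; rewrite -size_poly_eq0 size_line.
have lk k : (1 < k)%N -> line`_k = 0 by move=> k1; rewrite nth_default // size_line.
split; first by rewrite size_XsubC.
- apply/eqP; rewrite eqn_leq; apply/andP; split.
    apply/leq_sizeP => k k2; apply/polyP => i; rewrite coef_swapXY Gam_coef coef0.
    by case: i => [|i]; rewrite ?lk ?oppr0 // (gtn_eqF (ltnW k2)) andbF.
  rewrite ltnNge; apply/negP => /leq_sizeP/(_ 1%N isT).
  by move=> /(congr1 (fun p : {poly K} => p`_0)); rewrite coef_swapXY Gam_coef coef0 => /eqP; rewrite oppr_eq0 (negbTE l1).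
- apply/eqP; rewrite eqn_leq; apply/andP; split.
    apply/leq_sizeP => k k2; apply/polyP => i; rewrite blow_origin_coef Gam_coef coef0.
    case: leqP => // ik; case E: (k - i)%N => [|n]; first by rewrite lk ?oppr0 //; lia.
    by case: andP => // -[/eqP E1 /eqP E2]; lia.
  rewrite ltnNge; apply/negP => /leq_sizeP/(_ 1%N isT).
  move=> /(congr1 (fun p : {poly K} => p`_1)); rewrite blow_origin_coef Gam_coef coef0 => /eqP.
  by rewrite oppr_eq0 (negbTE l1).
Qed.

Definition Z3 e m0 m1 m2 F := [/\ polygon e m0 F, mult2 m1 z1 F & mult2 m2 z2 F].

Lemma Z3_subspace e m0 m1 m2 : subspace (io2 K) (Z3 e m0 m1 m2).
Proof.
have [p0 pP] := @polygon_subspace K e m0.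
have [a0 aP] := mult2_subspace m1 z1; have [b0 bP] := mult2_subspace m2 z2.
by split=> [|c x y [? ? ?] [? ? ?]]; split => //; [apply: pP | apply: aP | apply: bP].
Qed.

(** Restriction to the rational curve of bidegree (1, 1) through the three points has degree 2e - m0
    - m1 - m2 >= 0, and its kernel is [Gam] times the system with e and all multiplicities lowered
    by one. This gives the expected dimension as an upper bound, by induction on e. *)
Lemma Z3_dim e m0 m1 m2 : (m0 <= e)%N -> (m1 <= e)%N -> (m2 <= e)%N ->
    (m0 + m1 + m2 <= 2 * e)%N ->
  exists2 k, (k + 'C(m0.+1, 2) + 'C(m1.+1, 2) + 'C(m2.+1, 2) <= e.+1 ^ 2)%N &
    hasdim (io2 K) (Z3 e m0 m1 m2) k.
Proof.
elim: e m0 m1 m2 => [|e IH] m0 m1 m2 le0 le1 le2 le3.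
  have -> : m0 = 0%N by lia. have -> : m1 = 0%N by lia. have -> : m2 = 0%N by lia.
  have [n En dn] := @polygon_hasdim K 0 0 isT.
  have [||k kn dk] := hasdim_sub _ _ dn (P' := Z3 0 0 0 0).
  - exact: Z3_subspace.
  - by move=> v [].
  by exists k => //; rewrite -En !bin_small // !addn0.
have [||||k' Ek' dk'] := IH m0.-1 m1.-1 m2.-1; try lia.
have lf : klinear (io2 K) io1 (fun F : A => F.[line]).
  by move=> c x y; rewrite hornerD hornerM /io2 /= /polyC2 /= hornerC.
have [n0 dn0] : exists n0, hasdim (io2 K) (Z3 e.+1 m0 m1 m2) n0.
  have [n En dn] := polygon_hasdim K le0.
  have [||k kn dk] := hasdim_sub _ _ dn (P' := Z3 e.+1 m0 m1 m2).
  - exact: Z3_subspace.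
  - by move=> v [].
  by exists k.
exists n0 => //.
have [a [b [Eab da db]]] := rank_nullity lf (Z3_subspace _ _ _ _) dn0.
(* Restrictions are polynomials in s of degree at most 2(e+1) - m0, divisible by the powers of s -
   z1.1 and s - z2.1. *)
have [a' Ha' da'] : exists2 k, (k <= ((2 * e.+1).+1 - m0).+1 - (m1 + m2).+1)%N &
    hasdim io1 (imageof (fun F : A => F.[line]) (Z3 e.+1 m0 m1 m2)) k.
  have -> : (m1 + m2).+1 = size (('X - z1.1%:P) ^+ m1 * ('X - z2.1%:P) ^+ m2 : {poly K}).
    rewrite size_mul ?expf_neq0 ?polyXsubC_eq0 // !size_exp_XsubC.
    by rewrite addnS /=.
  apply: dvdp_dim.
  - by rewrite mulf_neq0 ?expf_neq0 ?polyXsubC_eq0.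
  - by apply: subspace_image (Z3_subspace _ _ _ _).
  - move=> _ [F [/polygonP [_ _ H3] H1 H2] ->]; split; first exact: size_horner_line.
    rewrite Gauss_dvdp; first by rewrite !mult2_line // line2.
    rewrite coprimep_expl // coprimep_expr // coprimep_XsubC.
    by rewrite root_XsubC eq_sym.
have Ea := hasdim_uniq da da'.
have Hb : (b <= k')%N.
  have [G1 G2 G3] := Gam_sizes.
  have dG : hasdim (io2 K) (imageof (fun F => Gam * F) (Z3 e m0.-1 m1.-1 m2.-1)) k'.
    apply: hasdim_image_inj dk' => //; first exact: mull_klinear.
      move=> v _ /eqP; rewrite mulf_eq0 -size_poly_eq0 G1 /= => /eqP; exact.
    exact: Z3_subspace.
  apply: hasdim_leq dG db => F [[H0 H1 H2] F0].
  have : root F line by apply/eqP.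
  case/factor_theorem => Q EQ; exists Q; last by rewrite EQ mulrC.
  have Gz z : line = slope%:P * ('X - z.1%:P) + z.2%:P -> pt z Gam = 0.
    by move=> El; rewrite ptE /Gam El !(hornerD, hornerN, hornerM, hornerX, hornerC) subrr mulr0 add0r subrr.
  have G' z : pt z Gam^`() != 0.
    by rewrite /Gam derivB derivX derivC subr0 rmorph1 oner_neq0.
  rewrite EQ mulrC -/Gam in H0 H1 H2; split.
  - by apply: polygon_div G1 G2 G3 _ _ H0; lia.
  - case: (m1) H1 => [|m] H1; first exact: mult2_0.
    exact: mult2_div (Gz _ _) (G' _) H1.
  - case: (m2) H2 => [|m] H2; first exact: mult2_0.
    by apply: mult2_div (Gz _ line2) (G' _) H2.
have binE m : ('C(m.+1, 2) = m + 'C(m.-1.+1, 2))%N by case: m => // m; rewrite binS bin1 addnC.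
rewrite (binE m0) (binE m1) (binE m2); move: Ek' Ha' Hb Eab; rewrite -Ea.
move: ('C(_, _)) ('C(_, _)) ('C(_, _)) => x y z.
rewrite -!mulnn; nia.
Qed.

End Line.

End Towers.

(** * Restriction from the quadric to the elliptic curve *)

Section CurveTower.

Variable K : fieldType.
Hypothesis closedK : forall p : {poly K}, size p != 1%N -> exists x, root p x.
Hypothesis charK : [pchar K] =i pred0.
Variables B C : {poly K}.
Hypothesis nsq : forall e, B ^+ 2 - 4%:R * C <> e ^+ 2.
Hypothesis sB : size B = 3%N.
Hypothesis sC : (size C <= 3)%N.

Local Notation A := {poly {poly K}}.
Local Notation G := (curve B C).
Local Notation bl0 := (blow (0%R : K, 0%R : K)).

Variables (L : fieldType) (phi : {rmorphism A -> L}).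
Hypothesis phi0 : forall F, phi F = 0 <-> exists F', F = G * F'.

Local Notation dim_le S n :=
  (exists2 k, (k <= n)%N & hasdim (ioL phi) (imageof phi S) k).

Lemma curve_coef j i : G`_j`_i =
  if j is 0 then C`_i else if j is 1 then B`_i else ((j == 2) && (i == 0))%:R.
Proof.
rewrite /curve !coefD coefXn coefCM coefX coefC.
by case: j => [|[|[|j]]] /=; rewrite ?mulr0 ?mulr1 ?coef0 ?coef1 ?addr0 ?add0r.
Qed.

(** Bidegree (2, 2) but total degree 3, with s^2 u as the only monomial of that degree: the curve
    passes simply through (infinity, infinity), tangent there to the ruling u = infinity. *)
Lemma curve_sizes : [/\ size G = 3%N, size (swapXY G) = 3%N & size (bl0 G) = 4%N].
Proof.
have [s1 s2 s3] : [/\ (size G <= 3)%N, (size (swapXY G) <= 3)%N & (size (bl0 G) <= 4)%N].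
  apply/(polygonP 2 1) => i j; rewrite curve_coef.
  have H (p : {poly K}) : (size p <= 3)%N -> p`_i != 0 -> (i <= 2)%N.
    by move=> sp; apply: contraR; rewrite -ltnNge => i2; apply/eqP/nth_default; apply: leq_trans sp i2.
  case: j => [/(H _ sC)|[/H|[|j]]] /=; rewrite ?sB.
  - by split=> //; lia.
  - by move=> /(_ isT); split=> //; lia.
  - by case: i {H} => [|i] /=; rewrite ?eqxx.
  - by rewrite eqxx.
have B2 : B`_2 != 0 by have := lead_coef_eq0 B; rewrite lead_coefE sB /= => ->; rewrite -size_poly_eq0 sB.
have c12 : G`_1`_2 = B`_2 by rewrite curve_coef.
split; first exact: size_curve.
- apply/eqP; rewrite eqn_leq s2 /= ltnNge; apply/negP => /leq_sizeP/(_ 2%N isT).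
  by move=> /(congr1 (fun p : {poly K} => p`_1)); rewrite coef_swapXY c12 coef0 => /eqP; rewrite (negbTE B2).
- apply/eqP; rewrite eqn_leq s3 /= ltnNge; apply/negP => /leq_sizeP/(_ 3%N isT).
  by move=> /(congr1 (fun p : {poly K} => p`_2)); rewrite blow_origin_coef /= c12 coef0 => /eqP; rewrite (negbTE B2).
Qed.

(** On an elliptic curve a line bundle of positive degree 4e - mu has that many sections. The bound
    is reached by pure counting: the dimension of the polygon minus that of the multiples of G which
    it visibly contains. *)
Lemma phi_polygon e mu : (0 < mu <= e)%N -> dim_le (polygon e mu) (4 * e - mu)%N.
Proof.
move=> /andP [mu0 mue]; have [n En dn] := @polygon_hasdim K e mu mue.
have [a [b [Eab da db]]] := rank_nullity (@phi_klinear K L _ (io2 K) phi) (@polygon_subspace K e mu) dn.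
exists a => //.
have [g1 g2 g3] := curve_sizes.
have Hb e' mu' n' : (e' + 2 <= e)%N -> ((2 * e').+1 - mu' + 3 <= (2 * e).+1 - mu)%N ->
    hasdim (io2 K) (polygon e' mu') n' -> (n' <= b)%N.
  move=> E1 E2 dn'.
  have dG : hasdim (io2 K) (imageof (fun F => G * F) (polygon e' mu')) n'.
    apply: hasdim_image_inj dn' => //; first exact: mull_klinear.
      by move=> v _ /eqP; rewrite mulf_eq0 -size_poly_eq0 g1 /= => /eqP.
    exact: polygon_subspace.
  apply: hasdim_leq db dG => _ [F HF ->]; split; last by apply/phi0; exists F.
  by apply: (@polygon_mul K G 2 3) HF; rewrite ?g1 ?g2 ?g3 //; lia.
have binS2 x : ('C(x.+1, 2) = 'C(x, 2) + x)%N by rewrite binS bin1 addnC.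
clear dn da db; have [emu|emu] := ltnP mu e.
  (* For mu < e the multiples of G are G times the polygon with parameters e - 2, mu - 1. *)
  case: mu mu0 mue En emu Hb => // mu _ mue En emu Hb.
  case: e mue En emu Hb => [|[|e]] // mue En emu Hb.
  have me : (mu <= e)%N by lia.
  have [n' En' dn'] := @polygon_hasdim K e mu me.
  have := Hb _ _ _ _ _ dn'; move: En En'; rewrite -!mulnn (binS2 mu.+1).
  move: ('C(_, _)) => x ? ? H; have {H} := H ltac:(lia) ltac:(lia); nia.
have {emu mue} Ee : e = mu by apply/eqP; rewrite eqn_leq emu mue.
subst mu; case: e mu0 En Hb => [|[|[|e]]] // _ En Hb.
- by move: En; rewrite -!mulnn /= (_ : 'C(2, 2) = 1)%N //; lia.
- by move: En; rewrite -!mulnn /= (_ : 'C(3, 2) = 3)%N //; lia.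
(* For mu = e both polygons are triangles, and G, of total degree 3, leaves the one of side e - 3.
   For e = 1, 2 the whole triangle already has dimension 3e. *)
- have [n' En' dn'] := @polygon_hasdim K e e (leqnn e).
  have := Hb _ _ _ _ _ dn'; move: En En'; rewrite -!mulnn (binS2 e.+3) (binS2 e.+2) (binS2 e.+1).
  move: ('C(_, _)) => x ? ? H; have {H} := H ltac:(lia) ltac:(lia); nia.
Qed.

(** [dC] is a combination of the two partial derivatives, each of which lowers the multiplicity at
    [z] by at most one. *)
Lemma mult2_osculating m z F : mult2 m z F -> @osculating K (A2 K) (dC B C) (pt z) m F.
Proof.
have md k H : mult2 k.+1 z H -> mult2 k z (dC B C H).
  move=> mH; rewrite /dC; apply: mult2B; rewrite -[k]add0n; apply: mult2M.
  - exact: mult2_0.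
  - exact: mult2_dS.
  - exact: mult2_0.
  - exact: mult2_dU.
move=> mF j; elim: j m F mF => [|j IH] [|m] F mF // jm; first exact: mult2_pt mF.
by rewrite iterSr; apply: (IH m) => //; apply: md.
Qed.

Variables (r : nat) (z : nat -> K * K).
Hypothesis zG : forall i, (0 < i < r)%N -> pt (z i) G = 0 /\ pt (z i) G^`() != 0.

Definition Zsys e mu0 (mu : nat -> nat) F :=
  polygon e mu0 F /\ forall i, (0 < i < r)%N -> mult2 (mu i) (z i) F.

Lemma Zsys_subspace e mu0 mu : subspace (io2 K) (Zsys e mu0 mu).
Proof.
have [p0 pP] := @polygon_subspace K e mu0; split.
  by split=> // i _; case: (mult2_subspace (mu i) (z i)).
move=> c x y [px mx] [py my]; split=> [|i ir]; first exact: pP.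
by case: (mult2_subspace (mu i) (z i)) => _; apply; [apply: mx | apply: my].
Qed.

(** Rank and nullity for the restriction to the curve: b bounds the image, and the kernel is G times
    the system with every multiplicity lowered by one. The point of index 0 is at infinity and
    enters through the polygon, hence its zero in the osculation conditions. *)
Lemma Zsys_step e mu0 e' mu0' mu b n' :
    (forall F, polygon e mu0 (G * F) -> polygon e' mu0' F) ->
    dim_le (fun F => polygon e mu0 F /\
      osculates B C z (fun i => if i == 0%N then 0%N else mu i) r F) b ->
    dimle (Zsys e' mu0' (fun i => (mu i).-1)) n' ->
  forall n, hasdim (io2 K) (Zsys e mu0 mu) n -> (n <= b + n')%N.
Proof.
move=> Hdiv [b' b'b db] [k kn' dk] n dn.
have [a [c [-> da dc]]] := rank_nullity (@phi_klinear K L _ (io2 K) phi) (Zsys_subspace e mu0 mu) dn.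
apply: leq_add.
  apply: leq_trans b'b; apply: hasdim_leq db da => _ [F [pF mF] ->]; exists F => //; split=> // i ir.
  case: eqP => [_ j //|/eqP i0]; apply: mult2_osculating; apply: mF.
  by rewrite lt0n i0.
apply: leq_trans kn'.
have [g1 g2 g3] := curve_sizes.
have dG : hasdim (io2 K) (imageof (fun F => G * F) (Zsys e' mu0' (fun i => (mu i).-1))) k.
  apply: hasdim_image_inj dk => //; first exact: mull_klinear.
    by move=> v _ /eqP; rewrite mulf_eq0 -size_poly_eq0 g1 /= => /eqP.
  exact: Zsys_subspace.
apply: hasdim_leq dG dc => F [[pF mF] /phi0 [F' EF]]; exists F' => //; split.
  by apply: Hdiv; rewrite -EF.
move=> i ir; have := mF i ir; have [zi0 zi1] := zG ir; rewrite EF.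
by case: (mu i) => [|m] /=; [move=> _; apply: mult2_0 | apply: mult2_div].
Qed.

End CurveTower.

(** * The tower of linear systems on the quadric *)

Section QuadricBound.

Variable K : fieldType.
Variables B C : {poly K}.
Hypothesis sB : size B = 3%N.
Hypothesis sC : (size C <= 3)%N.

Local Notation A := {poly {poly K}}.
Local Notation G := (curve B C).

Variables (L : fieldType) (phi : {rmorphism A -> L}).
Hypothesis phi0 : forall F, phi F = 0 <-> exists F', F = G * F'.

Variables (d r : nat) (M : nat -> nat).
Hypothesis Mle : forall i j, (i <= j)%N -> (M j <= M i)%N.
Hypothesis r3 : (3 < r)%N.
Hypothesis std : (M 0 + M 1 + M 2 + M 3 <= 2 * d)%N.
Hypothesis M0d : (M 0 <= d)%N.

(** Up to k = d - M 0 these are the degree d - 2k and multiplicity M 0 - k. At k = d - M 0 the two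
    coincide and the polygon is a triangle; from there on, division by G of total degree 3 shrinks
    the side by 3 at each level. Geometrically the two rulings through p_1 have become fixed
    components. *)
Definition edeg k := if (k <= d - M 0)%N then (d - 2 * k)%N else (2 * d - M 0 - 3 * k)%N.
Definition ddeg k := if (k <= d - M 0)%N then (M 0 - k)%N else (2 * d - M 0 - 3 * k)%N.

Lemma M31 : (M 3 <= M 2 <= M 1)%N. Proof. by rewrite !Mle. Qed.
Lemma M10 : (M 1 <= M 0)%N. Proof. by rewrite Mle. Qed.

Lemma ddeg_edeg k : (k <= M 3)%N -> (ddeg k <= edeg k)%N.
Proof. by have := M31; have := M10; rewrite /ddeg /edeg; case: ifP; lia. Qed.

Lemma ddeg_gt0 k : (k < M 3)%N -> (0 < ddeg k)%N.
Proof. by have := M31; have := M10; rewrite /ddeg; case: ifP; lia. Qed.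

(** The expected dimension on Q falls from one level to the next by the degree on B before the
    points other than p_1 are imposed, in both ranges of k. *)
Lemma edeg_square k : (k < M 3)%N ->
  ((edeg k).+1 ^ 2 + 'C((ddeg k.+1).+1, 2) =
   (edeg k.+1).+1 ^ 2 + 'C((ddeg k).+1, 2) + (4 * edeg k - ddeg k))%N.
Proof.
have binS2 x : ('C(x.+1, 2) = 'C(x, 2) + x)%N by rewrite binS bin1 addnC.
move=> k3; have := M31; have := M10; rewrite /edeg /ddeg.
have [k1|k1] := leqP k.+1 (d - M 0).
  rewrite (ltnW k1) => m1 m2; have -> : (M 0 - k = (M 0 - k.+1).+1)%N by lia.
  have -> : (d - 2 * k = (d - 2 * k.+1).+2)%N by lia.
  rewrite (binS2 (_ - _).+1) -!mulnn.
  have : (M 0 - k.+1 <= d - 2 * k.+1)%N by lia.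
  move: (M 0 - k.+1)%N (d - 2 * k.+1)%N ('C(_, _)) => y w x; nia.
move=> m1 m2.
(* At the boundary k = d - M 0 both branches give 2d - M 0 - 3k, so the second range may start
   there. *)
have -> : (if (k <= d - M 0)%N then (d - 2 * k)%N else (2 * d - M 0 - 3 * k)%N) =
  (2 * d - M 0 - 3 * k.+1).+3%N by case: ifP; lia.
have -> : (if (k <= d - M 0)%N then (M 0 - k)%N else (2 * d - M 0 - 3 * k)%N) =
  (2 * d - M 0 - 3 * k.+1).+3%N by case: ifP; lia.
move: (2 * d - M 0 - 3 * k.+1)%N => y.
by rewrite (binS2 y.+3) (binS2 y.+2) (binS2 y.+1) -!mulnn; nia.
Qed.

Variable z : nat -> K * K.
Hypothesis zG : forall i, (i < r)%N -> pt (z i) G = 0 /\ pt (z i) G^`() != 0.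
Hypothesis zz : forall i j, (i < j < r)%N -> (z i).1 != (z j).1 /\ (z i).2 != (z j).2.
Hypothesis zgen : forall k, (k < M 3)%N ->
  exists2 n, (n <= 4 * edeg k - ddeg k - \sum_(1 <= i < r) (M i - k))%N &
    hasdim (ioL phi) (imageof phi (fun F => polygon (edeg k) (ddeg k) F /\
      osculates B C z (fun i => if i == 0%N then 0%N else M i - k)%N r F)) n.

Definition Zk k := Zsys r z (edeg k) (ddeg k) (fun i => M i - k)%N.

Lemma Zk_finite k : (k <= M 3)%N -> exists n, hasdim (io2 K) (Zk k) n.
Proof.
move=> /ddeg_edeg /(@polygon_hasdim K) [n _ dn].
have [||m _ dm] := hasdim_sub _ _ dn (P' := Zk k); first exact: Zsys_subspace.
  by move=> F [].
by exists m.
Qed.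

Lemma Zk_step k n n' : (k < M 3)%N -> hasdim (io2 K) (Zk k) n ->
  hasdim (io2 K) (Zk k.+1) n' ->
  (n <= 4 * edeg k - ddeg k - \sum_(1 <= i < r) (M i - k) + n')%N.
Proof.
move=> k3 dn dn'.
have zG' i : (0 < i < r)%N -> pt (z i) G = 0 /\ pt (z i) G^`() != 0 by case/andP => _ /zG.
apply: (fun H1 H2 => @Zsys_step _ _ _ sB sC _ _ phi0 _ _ zG' _ _ (edeg k.+1) (ddeg k.+1) _ _ _ H1 (zgen k3) H2 _ dn); last first.
  exists n' => //; apply: hasdim_eq dn' => F.
  by split=> -[pF mF]; split=> // i ir; have := mF i ir; rewrite /= subnS.
have [g1 g2 g3] := curve_sizes sB sC.
have := M31; have := M10 => m1 m2.
rewrite /edeg /ddeg; have [k1|k1] := leqP k.+1 (d - M 0) => F pF.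
  rewrite (ltnW k1) in pF.
  apply: polygon_div g1 g2 g3 _ _ pF; first by lia.
  by apply/implyP; lia.
(* From here on the polygons are triangles, and only the total degree of the quotient is
   controlled. *)
apply: polygon_div_tri g3 _ pF; case: ifP; lia.
Qed.

(** With nonnegative degrees on B the truncated difference in [Zk_step] is a true one, so by
    [edeg_square] the bound passes from level k + 1 to level k. At level M 3 only three points are
    left and [Z3_dim] applies. *)
Lemma Zk_bound k : (k <= M 3)%N ->
    (forall j, (k <= j < M 3)%N -> (\sum_(1 <= i < r) (M i - j) <= 4 * edeg j - ddeg j)%N) ->
  exists2 n, hasdim (io2 K) (Zk k) n &
    (n + 'C((ddeg k).+1, 2) + \sum_(1 <= i < r) 'C((M i - k).+1, 2) <= (edeg k).+1 ^ 2)%N.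
Proof.
move: {2}(M 3 - k)%N (leqnn (M 3 - k)) => l; elim: l k => [|l IH] k lk k3 Hpos.
  have Ek : k = M 3 by lia.
  have [n dn] := Zk_finite k3; exists n => //.
  have [s12 u12] : (z 1).1 != (z 2).1 /\ (z 1).2 != (z 2).2 by apply: zz; lia.
  have [m Em dm] : exists2 m, (m + 'C((ddeg k).+1, 2) + 'C((M 1 - k).+1, 2) + 'C((M 2 - k).+1, 2) <= (edeg k).+1 ^ 2)%N &
      hasdim (io2 K) (Z3 (z 1) (z 2) (edeg k) (ddeg k) (M 1 - k) (M 2 - k)) m.
    have := M31; have := M10 => m1 m2.
    apply: Z3_dim => //; first exact: ddeg_edeg.
    - by rewrite /edeg; case: ifP; lia.
    - by rewrite /edeg; case: ifP; lia.
    - by rewrite /edeg /ddeg; case: ifP; lia.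
  apply: leq_trans Em.
  rewrite big_ltn ?(ltn_trans _ r3) // big_ltn ?(ltn_trans _ r3) // big_nat big1; last first.
    move=> i /andP [i3 _]; have : (M i <= M 3)%N by apply: Mle.
    by rewrite Ek => H; have -> : (M i - M 3 = 0)%N by lia.
  rewrite addn0 !addnA !leq_add2r.
  apply: hasdim_leq dm dn => F [pF mF]; split=> //; apply: mF; lia.
have [k3'|] := ltnP k (M 3); last by move=> H; apply: (IH k); lia.
have [|||n' dn' En'] := IH k.+1; try lia.
  by move=> j Hj; apply: Hpos; lia.
have [n dn] := Zk_finite k3; exists n => //.
have H1 := Zk_step k3' dn dn'.
have H2 := Hpos k ltac:(lia).
have H3 := edeg_square k3'.
have H4 : (\sum_(1 <= i < r) 'C((M i - k).+1, 2) =
    \sum_(1 <= i < r) 'C((M i - k.+1).+1, 2) + \sum_(1 <= i < r) (M i - k))%N.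
  have E y : ('C(y.+1, 2) = 'C(y.-1.+1, 2) + y)%N by case: y => // y; rewrite binS bin1 addnC.
  by rewrite -big_split; apply: eq_bigr => i _; rewrite subnS; apply: E.
move: H1 H2 H3 En'; rewrite H4.
move: (\sum_(1 <= i < r) (M i - k))%N (\sum_(1 <= i < r) 'C(_, _))%N => s1 s2.
by move: ('C((ddeg k).+1, 2)) ('C((ddeg k.+1).+1, 2)) ((edeg k).+1 ^ 2)%N ((edeg k.+1).+1 ^ 2)%N => x1 x2 x3 x4; lia.
Qed.

(** Where the degree on B is nonpositive, the image on B is zero, so the system is at most G times
    the next one. *)
Lemma Zk_leq k t n n' : (k <= t <= M 3)%N ->
    (forall j, (j < t)%N -> (4 * edeg j - ddeg j <= \sum_(1 <= i < r) (M i - j))%N) ->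
  hasdim (io2 K) (Zk k) n -> hasdim (io2 K) (Zk t) n' -> (n <= n')%N.
Proof.
move=> /andP [kt t3] Hneg; move: {2}(t - k)%N (leqnn (t - k)) => l.
elim: l k kt n => [|l IH] k kt n lk dn dn'.
  have Ek : k = t by lia.
  by rewrite Ek in dn; rewrite (hasdim_uniq dn dn').
have [kt'|tk] := ltnP k t; last by apply: (IH k) dn dn' => //; lia.
have [|m dm] := @Zk_finite k.+1; first by lia.
have := Zk_step _ dn dm; have := Hneg k kt'; have := IH k.+1 kt' m _ dm dn'.
move: (\sum_(1 <= i < r) _)%N => s H1 H2 H3.
by have := H1 ltac:(lia); have := H3 ltac:(lia); lia.
Qed.

End QuadricBound.

(** * Linear changes of coordinates and multiplicity at coordinate points *)

Section Coordinates.

Variable K : fieldType.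
Local Notation M4 := {mpoly K[4]}.
Implicit Types (f g : M4) (N : 'M[K]_4) (v w : 'rV[K]_4) (a : 'X_{1..4}).

Definition linear_form N i : AM K 4 := \sum_k (N k i)%:MP * 'X_k.

Definition lsub N : M4 -> M4 := mev (ioM K 4) (linear_form N).
HB.instance Definition _ N := GRing.RMorphism.on (lsub N).

Lemma lsubC N c : lsub N c%:MP = c%:MP. Proof. exact: mevC. Qed.
Lemma lsubX N i : lsub N 'X_i = linear_form N i. Proof. exact: mevX. Qed.

Lemma lsub_klinear N : klinear (ioM K 4) (ioM K 4) (lsub N).
Proof. by move=> c x y; rewrite rmorphD rmorphM /= lsubC. Qed.

Lemma lsub_eval N f (c : 'rV[K]_4) : (lsub N f).@[c 0] = f.@[(c *m N) 0].
Proof.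
apply: (@rmorph_mpoly_ext K 4 K (meval (c 0) \o lsub N) (meval ((c *m N) 0))) => [k|i] /=.
  by rewrite lsubC !mevalC.
rewrite lsubX mevalXU mxE raddf_sum; apply: eq_bigr => k _.
by rewrite /= mevalM mevalC mevalXU mulrC.
Qed.

Lemma lsub_comp N N' f : lsub N (lsub N' f) = lsub (N *m N') f.
Proof.
apply: (@rmorph_mpoly_ext K 4 _ (lsub N \o lsub N') (lsub (N *m N'))) => [k|i] /=.
  by rewrite !lsubC.
rewrite !lsubX /linear_form raddf_sum /=.
under eq_bigr do rewrite rmorphM /= lsubC lsubX /linear_form mulr_sumr.
rewrite exchange_big; apply: eq_bigr => k _ /=.
rewrite mxE rmorph_sum mulr_suml; apply: eq_bigr => j _ /=.
by rewrite mulrA -mpolyCM mulrC [N' _ _ * _]mulrC mulrC.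
Qed.

Lemma lsub1 f : lsub 1%:M f = f.
Proof.
apply: (@rmorph_mpoly_ext K 4 _ (lsub 1%:M) idfun) => [k|i] /=; first by rewrite lsubC.
rewrite lsubX /linear_form (bigD1 i) //= mxE eqxx mul1r big1 ?addr0 // => j ji.
by rewrite mxE (negbTE ji) mul0r.
Qed.

Lemma lsubK N f : N \in unitmx -> lsub N (lsub (invmx N) f) = f.
Proof. by move=> uN; rewrite lsub_comp mulmxV // lsub1. Qed.

Lemma lsubVK N f : N \in unitmx -> lsub (invmx N) (lsub N f) = f.
Proof. by move=> uN; rewrite lsub_comp mulVmx // lsub1. Qed.

Lemma lsub_homog N d f : f \is d.-homog -> lsub N f \is d.-homog.
Proof.
move=> fd; have L1 i : (linear_form N i : M4) \is 1.-homog.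
  by apply: rpred_sum => k _; rewrite mul_mpolyC dhomogZ // dhomogX /= mdeg1.
rewrite (mpolyE f) raddf_sum /= big_seq; apply: rpred_sum => a af.
rewrite -mul_mpolyC rmorphM /= lsubC mul_mpolyC dhomogZ // mpolyXE_id rmorph_prod.
have <- : mdeg a = d by apply: (dhomog_mf fd).
rewrite mdegE; elim: (index_enum _) => [|i s IH]; first by rewrite !big_nil dhomog1.
rewrite !big_cons dhomogM // rmorphXn /= lsubX.
by have := dhomogMn (a i) (L1 i); rewrite mul1n.
Qed.

Lemma lsub_mult N m w f : mult m (w *m N) f -> mult m w (lsub N f).
Proof.
move=> mf; have [h Eh] := mult_evalT 'X (fun i => (linear_form N i)%:P) mf.
exists h; rewrite -Eh.
pose th : {rmorphism M4 -> {poly M4}} := germ w.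
rewrite -[LHS]/((th \o lsub N) f).
apply: (@rmorph_mpoly_ext K 4 _ (th \o lsub N) (mevT _)) => [k|i] /=.
  by rewrite lsubC germC mevTC.
rewrite lsubX mevTX.
transitivity (\sum_k germ w ((N k i)%:MP * 'X_k)); first exact: raddf_sum.
transitivity (\sum_k (((w 0 k * N k i)%:MP)%:P + ((N k i)%:MP * 'X_k)%:P * 'X) : {poly M4}).
  apply: eq_bigr => k _; have -> : germ w ((N k i)%:MP * 'X_k) = germ w (N k i)%:MP * germ w 'X_k.
    exact: rmorphM.
  by rewrite germC germX mulrDr /mpC2 /= -polyCM -mpolyCM mulrA -polyCM [N k i * _]mulrC.
rewrite big_split /= -mulr_suml; congr (_ + _ * _); last by rewrite /linear_form rmorph_sum.
by rewrite /mpC2 /= mxE !rmorph_sum.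
Qed.

Definition coordv (k : 'I_4) : 'rV[K]_4 := delta_mx 0 k.

Lemma coordv_mul k N : coordv k *m N = row k N.
Proof. by rewrite rowE. Qed.

Definition drop_coord (k : 'I_4) a : 'X_{1..4} := [multinom if i == k then 0%N else a i | i < 4].

Lemma mdeg_drop_coord k a : (mdeg (drop_coord k a) + a k = mdeg a)%N.
Proof.
rewrite !mdegE (bigD1 k) //= mnmE eqxx add0n [RHS](bigD1 k) //= addnC; congr (_ + _)%N.
by apply: eq_bigr => i ik; rewrite mnmE (negbTE ik).
Qed.

(** In the chart x_k = 1 the monomial x^a of degree d has order d - a_k. *)
Lemma mult_coord_coef k m d f : f \is d.-homog -> mult m (coordv k) f ->
  forall a, f@_a != 0 -> (a k + m <= d)%N.
Proof.
move=> fd mf a fa.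
have da b : f@_b != 0 -> mdeg b = d.
  by rewrite -mcoeff_msupp; apply: (dhomog_mf fd).
have [h Eh] := mult_evalT 'X (fun i => if i == k then 0 else ('X_i)%:P) mf.
(* Setting x_k = 1 and scaling the other variables by T keeps monomials of the same degree d
   distinct, so no coefficients can cancel. *)
pose s : {rmorphism M4 -> {poly M4}} :=
  mevT (fun i => mpC2 4 (coordv k 0 i) + (if i == k then 0 else ('X_i)%:P) * 'X).
have sX b : s (@mpolyX 4 K b) = (@mpolyX 4 K (drop_coord k b))%:P * 'X^(mdeg (drop_coord k b)).
  rewrite mpolyXE_id rmorph_prod mdegE (mpolyXE_id K (drop_coord k b)) rmorph_prod /=.
  rewrite -prodrXr -big_split; apply: eq_bigr => i _ /=.
  rewrite rmorphXn /= /s /= mevTX mnmE /coordv mxE eqxx /=.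
  case: (eqVneq i k) => [->|ik].
    by rewrite mul0r addr0 /mpC2 /= mpolyC1 polyC1 expr1n !expr0 mulr1.
  by rewrite /mpC2 /= mpolyC0 polyC0 add0r exprMn rmorphXn.
have sc : ((s f)`_(mdeg (drop_coord k a)))@_(drop_coord k a) = f@_a.
  rewrite {1}(mpolyE f) raddf_sum coef_sum raddf_sum (bigD1_seq a) ?msupp_uniq ?mcoeff_msupp //=.
  have sZ b : s (f@_b *: @mpolyX 4 K b) = ((f@_b)%:MP * @mpolyX 4 K (drop_coord k b))%:P * 'X^(mdeg (drop_coord k b)).
    by rewrite -mul_mpolyC rmorphM sX /s /= mevTC mulrA polyCM.
  rewrite sZ coefCM coefXn eqxx mulr1 mul_mpolyC mcoeffZ mcoeffX eqxx mulr1.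
  rewrite big_seq_cond big1 ?addr0 // => b /andP [bf ba]; rewrite sZ coefCM coefXn.
  case: eqP => Ed; last by rewrite mulr0 mcoeff0.
  rewrite mulr1 mul_mpolyC mcoeffZ mcoeffX; case: eqP => Eb; last by rewrite mulr0.
  case/eqP: ba; apply/mnmP => i.
  have /(congr1 (fun x : 'X_{1..4} => x i)) := Eb; rewrite !mnmE.
  case: (eqVneq i k) => [->|//] _.
  have := mdeg_drop_coord k a; have := mdeg_drop_coord k b.
  rewrite (da a fa) (da b) -?mcoeff_msupp //; lia.
have := mdeg_drop_coord k a; rewrite (da a fa) => Ed.
rewrite leqNgt; apply: contraNN fa => H; rewrite -sc.
have -> : s f = h * 'X^m by rewrite -Eh.
by rewrite coefMXn ifT ?mcoeff0 //; lia.
Qed.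

Lemma mult_coord k m d f : f \is d.-homog ->
  (forall a, f@_a != 0 -> (a k + m <= d)%N) -> mult m (coordv k) f.
Proof.
move=> fd H; rewrite (mpolyE f).
have [m0 mP] := mult_subspace m (coordv k).
rewrite big_seq; elim/big_rec: _ => [|a g af mg]; first exact: m0.
rewrite -mul_mpolyC; apply: mP => //.
have ad : mdeg a = d by apply: (dhomog_mf fd).
have am : (m <= mdeg (drop_coord k a))%N.
  by have := mdeg_drop_coord k a; have := H a; rewrite -mcoeff_msupp af => /(_ isT); lia.
apply: mult_leq am _.
rewrite mpolyXE_id mdegE; elim: (index_enum _) => [|i s IH]; first by rewrite !big_nil; apply: mult0.
rewrite !big_cons; apply: multM IH; rewrite mnmE.
case: (eqVneq i k) => [->|ik]; first exact: mult0.
have X1 : mult 1 (coordv k) 'X_i.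
  by apply/mult1; rewrite mevalXU /coordv mxE eqxx (negbTE ik).
elim: (a i) => [|n IHn]; first exact: mult0.
by rewrite exprS; apply: (@multM _ _ 1 n).
Qed.

End Coordinates.

(** * Counting monomials: three points exactly, further points from below *)

Section Monomials.

Variable K : fieldType.
Local Notation M4 := {mpoly K[4]}.
Implicit Types (f g : M4) (a b : 'X_{1..4}).

Definition monomials d : seq 'X_{1..4} :=
  [seq s2m t | t : d.-tuple 'I_4 <- enum (basis 4 d)].

Lemma mem_monomials d a : (a \in monomials d) = (mdeg a == d).
Proof. by rewrite basis_cover. Qed.

Lemma monomials_uniq d : uniq (monomials d). Proof. exact: uniq_basis. Qed.

Lemma size_monomials d : size (monomials d) = 'C(d + 3, 3).
Proof. by rewrite size_basis -[RHS]bin_sub ?leq_addl // addnK. Qed.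

Lemma span_subspace (P : 'X_{1..4} -> Prop) :
  subspace (ioM K 4) (fun f => forall a, f@_a != 0 -> P a).
Proof.
split=> [a|c x y Hx Hy a]; first by rewrite mcoeff0 eqxx.
rewrite /ioM /= mcoeffD mcoeffCM; have [->|/Hx //] := eqVneq x@_a 0.
by rewrite mulr0 add0r => /Hy.
Qed.

Lemma span_hasdim (s : seq 'X_{1..4}) : uniq s ->
  hasdim (ioM K 4) (fun f => forall a, f@_a != 0 -> a \in s) (size s).
Proof.
move=> us; pose x (k : 'I_(size s)) : AM K 4 := 'X_[nth 0%MM s k].
have lc (c : 'rV[K]_(size s)) a :
    (lincomb (ioM K 4) x c : M4)@_a = \sum_k c 0 k * (nth 0%MM s k == a)%:R.
  rewrite /lincomb raddf_sum; apply: eq_bigr => k _.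
  by rewrite /= mcoeffCM mcoeffX.
have lck (c : 'rV[K]_(size s)) (k : 'I_(size s)) :
    (lincomb (ioM K 4) x c : M4)@_(nth 0%MM s k) = c 0 k.
  rewrite lc (bigD1 k) //= eqxx mulr1 big1 ?addr0 // => l lk.
  by rewrite nth_uniq //; move: lk; rewrite -val_eqE => /negbTE /= ->; rewrite mulr0.
exists x; split.
- move=> k a; rewrite mcoeffX; have [<- _|_] := eqVneq (nth 0%MM s k) a; first exact: mem_nth.
  by rewrite eqxx.
- by move=> c c0; apply/rowP => k; rewrite mxE -lck c0 mcoeff0.
- move=> f Hf; exists (\row_k f@_(nth 0%MM s k)); apply/mpolyP => a.
  have [ins|nins] := boolP (a \in s).
    have ia : (index a s < size s)%N by rewrite index_mem.
    by have := lck (\row_k f@_(nth 0%MM s k)) (Ordinal ia); rewrite /= nth_index // mxE /= nth_index // => ->.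
  have -> : f@_a = 0 by apply/eqP; apply: contraNT nins; apply: Hf.
  rewrite lc big1 // => k _; case: eqP => [E|]; last by rewrite mulr0.
  by rewrite -E mem_nth in nins.
Qed.

Lemma cut_dim (P : AM K 4 -> Prop) n N (s : seq 'X_{1..4}) : uniq s ->
  subspace (ioM K 4) P -> hasdim (ioM K 4) P n ->
  exists2 k, (n <= k + size s)%N &
    hasdim (ioM K 4) (fun f => P f /\ forall a, a \in s -> (lsub N f)@_a = 0) k.
Proof.
move=> us sP dP; pose h (f : AM K 4) : AM K 4 := \sum_(a <- s) (lsub N f)@_a *: 'X_[a].
have hc f a : (h f : M4)@_a = if a \in s then (lsub N f)@_a else 0.
  rewrite /h raddf_sum /=.
  under eq_bigr do rewrite mcoeffZ mcoeffX.
  have [ins|nins] := boolP (a \in s).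
    rewrite (bigD1_seq a) //= eqxx mulr1 big1 ?addr0 // => b /negbTE ->.
    by rewrite mulr0.
  rewrite big_seq big1 // => b bs; case: eqP => [E|]; last by rewrite mulr0.
  by rewrite -E bs in nins.
have lh : klinear (ioM K 4) (ioM K 4) h.
  move=> c x y; apply/mpolyP => a; rewrite /ioM /= mcoeffD mcoeffCM !hc.
  by rewrite lsub_klinear /ioM /= mcoeffD mcoeffCM; case: ifP => // _; rewrite mulr0 addr0.
have [a [b [-> da db]]] := rank_nullity lh sP dP.
exists b.
  rewrite addnC leq_add2l; apply: hasdim_leq (span_hasdim us) da => _ [f _ ->] c.
  by rewrite hc; case: ifP => //; rewrite eqxx.
apply: hasdim_eq db => f; split=> -[Pf Hf]; split=> //.
  by apply/mpolyP => c; rewrite hc mcoeff0; case: ifP => // /Hf.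
by move=> c cs; have := hc f c; rewrite cs Hf mcoeff0.
Qed.

(** The monomials that multiplicity [m] at the k-th coordinate point forbids in degree [d]. *)
Definition viol d k m : pred 'X_{1..4} := fun a => (d < a k + m)%N.

Lemma count_shift d k l x y : k != l ->
  count (fun a => (x <= a k) && (y <= a l))%N (monomials d) =
  (if (x + y <= d)%N then 'C(d - x - y + 3, 3) else 0%N).
Proof.
move=> kl; case: leqP => xy; last first.
  apply/eqP; rewrite -leqn0 leqNgt -has_count; apply/hasPn => a.
  rewrite mem_monomials mdegE => /eqP ad; apply/negP => /andP [xa ya].
  suff : (a k + a l <= d)%N by lia.
  by rewrite -ad (bigD1 k) //= leq_add2l (bigD1 l) 1?eq_sym //= leq_addr.
rewrite -size_monomials -size_filter.
pose sh b : 'X_{1..4} := (b + (U_(k) *+ x + U_(l) *+ y))%MM.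
have shE b i : (sh b i = b i + ((k == i) * x + (l == i) * y))%N.
  by rewrite /sh !mnmDE !mulmnE !mnm1E.
rewrite -[RHS](size_map sh); apply: perm_size; apply: uniq_perm.
- by rewrite filter_uniq // monomials_uniq.
- by rewrite map_inj_uniq ?monomials_uniq //; apply: addIm.
move=> a; rewrite mem_filter mem_monomials; apply/idP/mapP.
  move=> /andP [/andP [xa ya] /eqP ad].
  have le : (U_(k) *+ x + U_(l) *+ y <= a)%MM.
    apply/mnm_lepP => i; rewrite mnmDE !mulmnE !mnm1E.
    case: (eqVneq k i) => [<-|ki]; first by rewrite eq_sym (negbTE kl) mul1n mul0n addn0.
    by case: (eqVneq l i) => [<-|li]; rewrite ?mul0n ?mul1n.
  exists (a - (U_(k) *+ x + U_(l) *+ y))%MM; last by rewrite /sh submK.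
  rewrite mem_monomials; have := congr1 (@mdeg 4) (submK le).
  by rewrite mdegD ad mdegD !mdegMn !mdeg1; lia.
move=> [b]; rewrite mem_monomials => /eqP bd ->; apply/andP; split.
  rewrite !shE !eqxx (negbTE kl) eq_sym (negbTE kl); lia.
by rewrite /sh !mdegD bd !mdegMn !mdeg1; apply/eqP; lia.
Qed.

Lemma count_viol d k m : (m <= d.+1)%N -> count (viol d k m) (monomials d) = 'C(m + 2, 3).
Proof.
move=> md; have [l kl] : exists l : 'I_4, k != l.
  by case: (eqVneq k ord0) => [->|k0]; [exists ord_max | exists ord0].
have := @count_shift d k l (d.+1 - m) 0 kl.
rewrite addn0 subn0 (eq_count (a2 := viol d k m)) => [->|a]; last first.
  by rewrite /viol andbT; lia.
case: m md => [|m] md; first by rewrite subn0 ltnn.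
by rewrite subSS leq_subr subKn // addSn addnS.
Qed.

(** Forbidden at both ends of a line: these are conditions counted twice. With t = m + m' - d their
    number is the correction C(t+1, 3) of the dimension formula. *)
Lemma count_viol2 d k l m m' : k != l -> (m <= d.+1)%N -> (m' <= d.+1)%N ->
  count (predI (viol d k m) (viol d l m')) (monomials d) = 'C(m + m' - d + 1, 3).
Proof.
move=> kl md md'; have := @count_shift d k l (d.+1 - m) (d.+1 - m') kl.
rewrite (eq_count (a2 := predI (viol d k m) (viol d l m'))) => [->|a]; last first.
  by rewrite /= /viol; lia.
case: leqP => H; last by rewrite bin_small //; lia.
by congr 'C(_, 3); lia.
Qed.

Definition Vsys d n (p : nat -> 'rV[K]_4) (mu : nat -> nat) (f : AM K 4) :=
  (f : M4) \is d.-homog /\ forall i, (i < n)%N -> mult (mu i) (p i) f.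

Lemma Vsys_subspace d n p mu : subspace (ioM K 4) (Vsys d n p mu).
Proof.
split; first by split=> [|i _]; [apply: dhomog0 | case: (mult_subspace (mu i) (p i))].
move=> c x y [hx mx] [hy my]; split=> [|i ir].
  by rewrite /ioM /= mul_mpolyC rpredD // rpredZ.
by case: (mult_subspace (mu i) (p i)) => _; apply; [apply: mx | apply: my].
Qed.

Lemma lsub_inj N (f : M4) : N \in unitmx -> lsub N f = 0 -> f = 0.
Proof. by move=> uN f0; rewrite -(lsubVK f uN) f0 rmorph0. Qed.

Lemma Vsys_finite d n p mu : exists k, hasdim (ioM K 4) (Vsys d n p mu) k.
Proof.
have [||k _ dk] := hasdim_sub _ _ (span_hasdim (monomials_uniq d)) (P' := Vsys d n p mu).
- exact: Vsys_subspace.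
- move=> f [/dhomogP fd _] a; rewrite -mcoeff_msupp mem_monomials => /fd.
  by move=> /= ->.
by exists k.
Qed.

(** Once the points are coordinate points the system is spanned by monomials, and its dimension is
    an inclusion-exclusion over the three sets of forbidden monomials. *)
Lemma Vsys3_dim d (p : nat -> 'rV[K]_4) (mu : nat -> nat) (N : 'M[K]_4) : N \in unitmx ->
    (forall i : 'I_4, (i < 3)%N -> row i N = p i) ->
    (forall i, (i < 3)%N -> (mu i <= d.+1)%N) -> (mu 0 + mu 1 + mu 2 <= 2 * d + 2)%N ->
  exists2 k, hasdim (ioM K 4) (Vsys d 3 p mu) k &
    (k + 'C(mu 0 + 2, 3) + 'C(mu 1 + 2, 3) + 'C(mu 2 + 2, 3) =
     'C(d + 3, 3) + 'C(mu 0 + mu 1 - d + 1, 3) + 'C(mu 0 + mu 2 - d + 1, 3)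
       + 'C(mu 1 + mu 2 - d + 1, 3))%N.
Proof.
move=> uN rN mud sum.
pose i0 : 'I_4 := ord0; pose i1 : 'I_4 := inord 1; pose i2 : 'I_4 := inord 2.
have v1 : (i1 : nat) = 1%N by rewrite inordK.
have v2 : (i2 : nat) = 2%N by rewrite inordK.
pose V0 := viol d i0 (mu 0); pose V1 := viol d i1 (mu 1); pose V2 := viol d i2 (mu 2).
pose bad := predU V0 (predU V1 V2).
pose s := filter (predC bad) (monomials d).
have us : uniq s by rewrite filter_uniq ?monomials_uniq.
have n01 : i0 != i1 by rewrite -val_eqE /= v1.
have n02 : i0 != i2 by rewrite -val_eqE /= v2.
have n12 : i1 != i2 by rewrite -val_eqE /= v1 v2.
exists (size s).
  have dI : hasdim (ioM K 4) (imageof (lsub (invmx N)) (fun f => forall a, f@_a != 0 -> a \in s)) (size s).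
    apply: hasdim_image_inj (span_hasdim us); first exact: lsub_klinear.
      by move=> f _; apply: lsub_inj; rewrite unitmx_inv.
    exact: span_subspace.
  apply: hasdim_eq dI => f; split=> [[fd fm]|[g Hg ->]].
    exists (lsub N f); last by rewrite lsubVK.
    have gd := lsub_homog N fd.
    have gm (i : 'I_4) : (i < 3)%N -> mult (mu i) (coordv K i) (lsub N f).
      by move=> i3; apply: lsub_mult; rewrite coordv_mul rN //; apply: fm.
    move=> a ga; rewrite mem_filter mem_monomials (dhomog_mf gd) ?mcoeff_msupp // eqxx andbT.
    have Hc (i : 'I_4) i3 := mult_coord_coef gd (gm i i3) ga.
    have H0 := Hc i0 isT; have := Hc i1; have := Hc i2; rewrite v1 v2 => H2 H1.
    have {H1} H1 := H1 isT; have {H2} H2 := H2 isT.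
    rewrite /= /bad /= /V0 /V1 /V2 /viol !negb_or -!leqNgt.
    by rewrite H0 H1 H2.
  have gd : g \is d.-homog.
    apply/dhomogP => a; rewrite mcoeff_msupp => /Hg; rewrite mem_filter mem_monomials => /andP [_ /eqP].
    by [].
  split; first exact: lsub_homog.
  move=> i i3; have i4 : (i < 4)%N by apply: ltn_trans i3 _.
  apply: lsub_mult; rewrite -(rN (Ordinal i4)) // -coordv_mul mulmxK //.
  apply: (mult_coord gd) => a /Hg; rewrite mem_filter => /andP [] + _.
  rewrite /= /bad /= /V0 /V1 /V2 /viol !negb_or -!leqNgt => /and3P [h0 h1 h2].
  case: i i3 i4 => [|[|[|]]] // _ i4.
  - by have -> : Ordinal i4 = i0 by apply: val_inj.
  - by have -> : Ordinal i4 = i1 by apply: val_inj; rewrite /= v1.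
  - by have -> : Ordinal i4 = i2 by apply: val_inj; rewrite /= v2.
have c0 : count V0 (monomials d) = 'C(mu 0 + 2, 3) by apply: count_viol; apply: mud.
have c1 : count V1 (monomials d) = 'C(mu 1 + 2, 3) by apply: count_viol; apply: mud.
have c2 : count V2 (monomials d) = 'C(mu 2 + 2, 3) by apply: count_viol; apply: mud.
have c01 : count (predI V0 V1) (monomials d) = 'C(mu 0 + mu 1 - d + 1, 3) by apply: count_viol2 => //; apply: mud.
have c02 : count (predI V0 V2) (monomials d) = 'C(mu 0 + mu 2 - d + 1, 3) by apply: count_viol2 => //; apply: mud.
have c12 : count (predI V1 V2) (monomials d) = 'C(mu 1 + mu 2 - d + 1, 3) by apply: count_viol2 => //; apply: mud.
have e12 := count_predUI V1 V2 (monomials d).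
have e0 := count_predUI V0 (predU V1 V2) (monomials d).
have eI := count_predUI (predI V0 V1) (predI V0 V2) (monomials d).
(* A monomial forbidden at all three points would have exponents adding up to at least 3(d+1) -
   (2d+2) = d + 1. *)
have eII : count (predI (predI V0 V1) (predI V0 V2)) (monomials d) = 0%N.
  apply/eqP; rewrite -leqn0 leqNgt -has_count; apply/hasPn => a.
  rewrite mem_monomials mdegE => /eqP ad; apply/negP => /=.
  rewrite /V0 /V1 /V2 /viol => /andP [/andP [h0 h1] /andP [_ h2]].
  suff H : (a i0 + (a i1 + a i2) <= d)%N.
    by move: h0 h1 h2 H sum; clear; move: (a i0) (a i1) (a i2) (mu 0) (mu 1) (mu 2) => x0 x1 x2 y0 y1 y2; lia.
  rewrite -ad (bigD1 i0) //= leq_add2l (bigD1 i1) 1?eq_sym //= leq_add2l (bigD1 i2) ?leq_addr //=.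
  by rewrite eq_sym n02 eq_sym n12.
have eU : count (predI V0 (predU V1 V2)) (monomials d) = count (predU (predI V0 V1) (predI V0 V2)) (monomials d).
  by apply: eq_count => a /=; rewrite andb_orr.
have := count_predC bad (monomials d); rewrite size_monomials /s size_filter.
move: e0 e12 eI; rewrite eU eII c0 c1 c2 c01 c02 c12 -/bad.
clear; move: (count _ _) (count _ _) (count _ _) (count _ _) ('C(_, _)) ('C(_, _)) ('C(_, _)) ('C(_, _)) ('C(_, _)) ('C(_, _)) ('C(_, _)). lia.
Qed.

End Monomials.

Section LowerBound.

Variable K : fieldType.
Local Notation M4 := {mpoly K[4]}.

(** Start from the exact count at three points and add the others one by one. In a frame containing
    p_1 and the new point, the monomials forbidden at both vanish already, so the new point imposes
    only the difference of two binomials. *)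
Lemma Vsys_lower d n (p : nat -> 'rV[K]_4) (mu : nat -> nat) (N : 'M[K]_4) : N \in unitmx ->
    (forall i : 'I_4, (i < 3)%N -> row i N = p i) ->
    (forall i, (3 <= i < n)%N -> exists2 N' : 'M[K]_4, N' \in unitmx &
        row ord0 N' = p 0%N /\ row (inord 1) N' = p i) ->
    (forall i, (i < n)%N -> (mu i <= d.+1)%N) -> (mu 0 + mu 1 + mu 2 <= 2 * d + 2)%N -> (3 <= n)%N ->
  exists2 k, hasdim (ioM K 4) (Vsys d n p mu) k &
    ('C(d + 3, 3) + 'C(mu 1 + mu 2 - d + 1, 3) + \sum_(1 <= i < n) 'C(mu 0 + mu i - d + 1, 3)
      <= k + \sum_(0 <= i < n) 'C(mu i + 2, 3))%N.
Proof.
move=> uN rN; elim: n => // n IH rNi mud sum; rewrite ltnS leq_eqVlt => /orP [/eqP n3|n3].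
  rewrite -n3 in mud *; have [|k dk E] := Vsys3_dim uN rN _ sum.
    by move=> i i3; apply: mud.
  exists k; first exact: dk.
  rewrite -[index_iota 1 3]/[:: 1%N; 2%N] -[index_iota 0 3]/[:: 0%N; 1%N; 2%N] !big_cons !big_nil.
  move: E; clear; move: k 'C(d + 3, 3) 'C(mu 0 + 2, 3) 'C(mu 1 + 2, 3) 'C(mu 2 + 2, 3).
  by move: 'C(mu 0 + mu 1 - d + 1, 3) 'C(mu 0 + mu 2 - d + 1, 3) 'C(_, _); lia.
have [|||k dk lek] := IH _ _ sum.
- by move=> i /andP [h1 h2]; apply: rNi; rewrite h1 ltnW.
- by move=> i i3; apply: mud; rewrite ltnW.
- exact: n3.
have [N' uN' [r0 r1]] : exists2 N' : 'M[K]_4, N' \in unitmx &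
        row ord0 N' = p 0%N /\ row (inord 1) N' = p n by apply: rNi; rewrite n3 /=.
pose i0 : 'I_4 := ord0; pose i1 : 'I_4 := inord 1.
have n01 : i1 != i0 by rewrite -val_eqE /= inordK.
pose V0 := viol d i0 (mu 0); pose V1 := viol d i1 (mu n).
(* Only monomials allowed by p_1 but forbidden by the new point are new conditions. *)
pose s := filter (predI V1 (predC V0)) (monomials d).
have us : uniq s by rewrite filter_uniq ?monomials_uniq.
have mu0d : (mu 0 <= d.+1)%N by apply: mud.
have mund : (mu n <= d.+1)%N by apply: mud.
have es : (size s + 'C(mu 0 + mu n - d + 1, 3) = 'C(mu n + 2, 3))%N.
  have := count_predC V0 (filter V1 (monomials d)).
  rewrite size_filter !count_filter count_viol // count_viol2 // 1?eq_sym // => <-.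
  by rewrite addnC /s size_filter; congr (_ + _)%N; apply: eq_count => a /=; rewrite andbC.
have [l lel dl] := cut_dim N' us (Vsys_subspace d n p mu) dk.
exists l; last first.
  rewrite !big_nat_recr //=; last by rewrite (leq_trans _ n3).
  move: es lel lek; clear; set A := bigop.body _ _ _; set B := bigop.body _ _ _.
  by move: (size s) 'C(d + 3, 3) 'C(mu 1 + mu 2 - d + 1, 3) 'C(_, _) 'C(_, _); lia.
apply: hasdim_eq dl => f; split=> -[fd fm].
  have mf i : (i <= n)%N -> mult (mu i) (p i) f by move=> ?; apply: fm.
  split; first by split=> // i ?; apply: fm; rewrite ltnW.
  move=> a; rewrite mem_filter => /andP [/andP [/= a1 a0] _].
  apply/eqP; apply: contraTT a1 => a1; rewrite /V1 /viol -leqNgt.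
  apply: (mult_coord_coef (lsub_homog N' fd) _ a1).
  by apply: lsub_mult; rewrite coordv_mul r1; apply: mf.
case: fd => fd fm'; split=> // i; rewrite ltnS leq_eqVlt => /orP [/eqP ->|]; last exact: fm'.
have gd := lsub_homog N' fd.
rewrite -(lsubVK f uN'); apply: lsub_mult; rewrite -r1 -coordv_mul mulmxK //.
apply: (mult_coord gd) => a a1; rewrite leqNgt; apply/negP => aV.
have a0 : ~~ V0 a.
  rewrite /V0 /viol -leqNgt; apply: (mult_coord_coef gd _ a1).
  by apply: lsub_mult; rewrite coordv_mul r0; apply: fm'; rewrite (leq_trans _ n3).
have ad : mdeg a = d by apply: (dhomog_mf gd); rewrite mcoeff_msupp.
by case/eqP: a1; apply: fm; rewrite mem_filter /= a0 mem_monomials ad eqxx /V1 /viol aV.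
Qed.

End LowerBound.

(** * Restriction of forms from P^3 to the Segre quadric *)

Section Quadric.

Variable K : fieldType.
Local Notation M4 := {mpoly K[4]}.
Local Notation A := {poly {poly K}}.
Implicit Types (f g h : M4) (a b : 'X_{1..4}).

Local Notation i0 := (inord 0 : 'I_4).
Local Notation i1 := (inord 1 : 'I_4).
Local Notation i2 := (inord 2 : 'I_4).
Local Notation i3 := (inord 3 : 'I_4).

Definition segre (i : 'I_4) : A2 K :=
  (if (i == 1 :> nat) || (i == 3 :> nat) then 'X%:P else 1) *
  (if (2 <= i)%N then 'X else 1).

Definition rho : M4 -> A2 K := mev (io2 K) segre.
HB.instance Definition _ := GRing.RMorphism.on rho.

Lemma rhoC c : rho c%:MP = io2 K c. Proof. exact: mevC. Qed.

Lemma rho_klinear : klinear (ioM K 4) (io2 K) rho.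
Proof. by move=> c x y; rewrite rmorphD rmorphM /= rhoC. Qed.

Lemma big_ord4 (R : Type) (idx : R) (op : Monoid.law idx) (F : 'I_4 -> R) :
  \big[op/idx]_i F i = op (F i0) (op (F i1) (op (F i2) (F i3))).
Proof.
rewrite !big_ord_recl big_ord0 Monoid.mulm1.
by congr (op (F _) (op (F _) (op (F _) (F _)))); apply: val_inj; rewrite /= ?inordK.
Qed.

Lemma ord4_cases (i : 'I_4) : i = i0 \/ i = i1 \/ i = i2 \/ i = i3.
Proof.
case: i => [[|[|[|[|i]]]] ii] //; [left|right;left|right;right;left|right;right;right];
by apply: val_inj; rewrite /= inordK.
Qed.

Lemma mdeg4 a : mdeg a = (a i0 + (a i1 + (a i2 + a i3)))%N.
Proof. by rewrite mdegE big_ord4. Qed.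

Lemma rhoX a : rho 'X_[a] = ('X^(a i1 + a i3))%:P * 'X^(a i2 + a i3).
Proof.
rewrite mpolyXE_id rmorph_prod big_ord4 /= !rmorphXn /= /rho !mevX /segre !inordK //= !mul1r !mulr1.
by rewrite !expr1n !mul1r exprMn !exprD; ring.
Qed.

Lemma rho_coef f i j :
  (rho f)`_j`_i = \sum_(a <- msupp f) f@_a * ((i == a i1 + a i3) && (j == a i2 + a i3))%N%:R.
Proof.
rewrite {1}(mpolyE f) raddf_sum !coef_sum; apply: eq_bigr => a _ /=.
have -> : rho (f@_a *: 'X_[a]) = io2 K f@_a * rho 'X_[a].
  by rewrite -mul_mpolyC -rhoC; apply: rmorphM.
rewrite rhoX mulrA /io2 /= /polyC2 /= -polyCM coefCM !coefXn.
case: (j == _); rewrite ?andbF ?andbT ?mulr0 ?coef0 ?mulr1 ?mulr0 //.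
by rewrite coefCM coefXn.
Qed.

Definition quadric0 : M4 := 'X_i0 * 'X_i3 - 'X_i1 * 'X_i2.

Lemma rho_quadric0 : rho quadric0 = 0.
Proof.
rewrite rmorphB !rmorphM /= /rho !mevX /segre !inordK //=.
by ring.
Qed.

(** Replacing x0 x3 by x1 x2 changes a monomial by a multiple of the quadric and lowers the exponent
    of x0, so it stops. *)
Lemma monomial_normal_form a : exists h b,
  [/\ 'X_[a] = quadric0 * h + 'X_[b], h \is (mdeg a - 2).-homog, (mdeg a < 2)%N -> h = 0,
      mdeg b = mdeg a & (b i0 = 0 \/ b i3 = 0)%N].
Proof.
have [n] := ubnP (a i0); elim: n a => // n IH a an.
have [a0|a0] := posnP (a i0).
  by exists 0, a; split=> //; rewrite ?mulr0 ?add0r ?dhomog0 //; left.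
have [a3|a3] := posnP (a i3).
  by exists 0, a; split=> //; rewrite ?mulr0 ?add0r ?dhomog0 //; right.
have n03 : (i0 == i3) = false by rewrite -val_eqE /= !inordK.
have n10 : (i1 == i0) = false by rewrite -val_eqE /= !inordK.
have n20 : (i2 == i0) = false by rewrite -val_eqE /= !inordK.
have le : (U_(i0) + U_(i3) <= a)%MM.
  apply/mnm_lepP => i; rewrite mnmDE !mnm1E.
  by case: (eqVneq i0 i) => [<-|_]; [rewrite eq_sym n03 | case: (eqVneq i3 i) => [<-|_]].
pose c := (a - (U_(i0) + U_(i3)))%MM.
have Ea : a = (c + (U_(i0) + U_(i3)))%MM by rewrite /c submK.
have da : mdeg a = (mdeg c).+2 by rewrite Ea !mdegD !mdeg1 !addn1 addn2.
have [|h [b [Eh hh hd bd b03]]] := IH (c + (U_(i1) + U_(i2)))%MM.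
  have := congr1 (fun x : 'X_{1..4} => x i0) Ea; rewrite !mnmDE !mnm1E eqxx n10 n20 (eq_sym i3) n03.
  by move: an a0; lia.
have dc : mdeg (c + (U_(i1) + U_(i2)))%MM = mdeg a by rewrite da !mdegD !mdeg1 addn2.
exists ('X_[c] + h), b; split=> //.
- rewrite mulrDr -addrA -Eh Ea !mpolyXD /quadric0; ring.
- by rewrite rpredD // -?dc // dhomogX /= dc da subSS subSS subn0.
- by rewrite da.
- by rewrite bd.
Qed.

(** Reduced monomials of one degree, lacking x0 or x3, have distinct images s^i u^j. The clause on d
    < 2 is needed because d - 2 is then truncated to 0, where nonzero constants are homogeneous. *)
Lemma rho_kernel d g : g \is d.-homog -> rho g = 0 ->
  exists2 h, g = quadric0 * h & h \is (d - 2).-homog /\ ((d < 2)%N -> h = 0).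
Proof.
move=> gd g0.
have [h [g' [Eg hh hd Hg']]] : exists h g', [/\ g = quadric0 * h + g', h \is (d - 2).-homog,
    (d < 2)%N -> h = 0 & forall b, g'@_b != 0 -> mdeg b = d /\ (b i0 = 0 \/ b i3 = 0)%N].
  rewrite (mpolyE g) big_seq; elim/big_rec: _ => [|a f ag [h [g' [-> hh hd Hg]]]].
    by exists 0, 0; split; rewrite ?mulr0 ?addr0 ?dhomog0 // => b; rewrite mcoeff0 eqxx.
  have ad : mdeg a = d by apply: (dhomog_mf gd).
  have [k [b [Ea kk kd bd b03]]] := monomial_normal_form a; rewrite ad in kk kd bd.
  exists (g@_a *: k + h), (g@_a *: 'X_[b] + g'); split.
  - by rewrite Ea !scalerDr mulrDr scalerAr; ring.
  - by rewrite rpredD // rpredZ.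
  - by move=> d2; rewrite (kd d2) (hd d2) scaler0 addr0.
  move=> e; rewrite mcoeffD mcoeffZ mcoeffX; case: (eqVneq b e) => [<- //|_].
  by rewrite mulr0 add0r => /Hg.
exists h => //; suff g'0 : g' = 0 by rewrite Eg g'0 addr0.
have r0 : rho g' = 0.
  have E : rho (quadric0 * h + g') = rho quadric0 * rho h + rho g' by rewrite rmorphD rmorphM.
  by rewrite -g0 Eg E rho_quadric0 mul0r add0r.
apply/mpolyP => b; rewrite mcoeff0; apply/eqP; apply: contraT => gb.
have := congr1 (fun F : {poly {poly K}} => F`_(b i2 + b i3)`_(b i1 + b i3)) r0.
rewrite rho_coef !coef0 (bigD1_seq b) ?mcoeff_msupp ?msupp_uniq //= !eqxx mulr1.
rewrite big_seq_cond big1 ?addr0 => [E|c /andP [cg cb]]; first by rewrite E eqxx in gb.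
rewrite [_ && _](_ : _ = false) ?mulr0 //; apply: contraNF cb => /andP [/eqP e1 /eqP e2].
move: cg; rewrite mcoeff_msupp => /Hg' [dc c03]; have [db b03] := Hg' b gb.
have H3 : b i3 = c i3 by move: e1 e2 db dc b03 c03; rewrite !mdeg4; lia.
have H0 : b i0 = c i0 by move: e1 e2 db dc b03 c03; rewrite !mdeg4; lia.
apply/eqP/mnmP => i; have [->|[->|[->|->]]] := ord4_cases i.
- by rewrite H0.
- by move: e1; rewrite H3 => /addIn.
- by move: e2; rewrite H3 => /addIn.
- by rewrite H3.
Qed.

Lemma mderivXU (i j : 'I_4) : ('X_i : M4)^`M(j) = (i == j)%:R%:MP.
Proof.
rewrite mderivX mnm1E -mul_mpolyC; case: (eqVneq i j) => [->|_]; last by rewrite mpolyC0 mul0r.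
have -> : (U_(j) - U_(j))%MM = 0%MM by apply/mnmP => k; rewrite mnmBE subnn mnm0E.
by rewrite mpolyX0 mulr1.
Qed.

Lemma quadric0_grad (v : 'rV[K]_4) : v != 0 -> exists i, (quadric0^`M(i)).@[v 0] != 0.
Proof.
move=> v0; have [i vi] : exists i, v 0 i != 0.
  apply: NNPP => H; case/eqP: v0; apply/rowP => i; rewrite mxE.
  by case: (eqVneq (v 0 i) 0) => // vi; case: H; exists i.
have E j : (quadric0^`M(j)).@[v 0] =
   (i0 == j)%:R * v 0 i3 + v 0 i0 * (i3 == j)%:R - ((i1 == j)%:R * v 0 i2 + v 0 i1 * (i2 == j)%:R).
  by rewrite /quadric0 mderivB !mderivM !mderivXU mevalB !mevalD !mevalM !mevalC !mevalXU.
have simpE := (mul0r, mulr0, mul1r, mulr1, add0r, addr0, subr0, oppr0, sub0r).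
have [e0|[e1|[e2|e3]]] := ord4_cases i.
- by exists i3; rewrite E -!val_eqE /= !inordK //= !simpE ?oppr_eq0 -e0.
- by exists i2; rewrite E -!val_eqE /= !inordK //= !simpE ?oppr_eq0 -e1.
- by exists i1; rewrite E -!val_eqE /= !inordK //= !simpE ?oppr_eq0 -e2.
- by exists i0; rewrite E -!val_eqE /= !inordK //= !simpE ?oppr_eq0 -e3.
Qed.

Lemma quadric0_eval (v : 'rV[K]_4) : quadric0.@[v 0] = v 0 i0 * v 0 i3 - v 0 i1 * v 0 i2.
Proof. by rewrite mevalB !mevalM !mevalXU. Qed.

(** The point (0:0:0:1) is the Segre image of (infinity, infinity). Multiplicity mu there bounds a_3
    by d - mu, and the total degree of the image is d - a_0 + a_3. *)
Lemma rho_polygon d mu f : f \is d.-homog -> mult mu (coordv K i3) f -> polygon d mu (rho f).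
Proof.
move=> fd mf i j; rewrite rho_coef => fij.
have [a [fa ai aj]] : exists a, [/\ f@_a != 0, i = (a i1 + a i3)%N & j = (a i2 + a i3)%N].
  apply: NNPP => H; case/eqP: fij; rewrite big_seq big1 // => a af.
  case: (eqVneq i _) => [ai|_]; last by rewrite mulr0.
  case: (eqVneq j _) => [aj|_]; last by rewrite mulr0.
  by case: H; exists a; rewrite -mcoeff_msupp.
have := mult_coord_coef fd mf fa.
have : mdeg a = d by apply: (dhomog_mf fd); rewrite mcoeff_msupp.
by rewrite mdeg4 ai aj; move: (a i0) (a i1) (a i2) (a i3) => x0 x1 x2 x3 ? ?; split; lia.
Qed.

End Quadric.

(** * The upper bound in P^3 at a special configuration *)

Lemma binS2 x : 'C(x.+1, 2) = ('C(x, 2) + x)%N.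
Proof. by rewrite binS bin1 addnC. Qed.

Lemma binS3 x : 'C(x.+1, 3) = ('C(x, 3) + 'C(x, 2))%N.
Proof. by rewrite binS addnC. Qed.

Lemma bin_square x : ('C(x.+1, 2) + 'C(x, 2) = x ^ 2)%N.
Proof.
elim: x => // x; have := binS2 x; rewrite (binS2 x.+1) -!mulnn.
by move: (x * x)%N (mulnS x.+1 x) (mulSn x x) => *; lia.
Qed.

(** The exact sequence of the quadric: forms of degree e + 2 are forms of degree e plus sections of
    bidegree (e+2, e+2). *)
Lemma forms_step e : ('C(e.+2 + 3, 3) = 'C(e + 3, 3) + e.+3 ^ 2)%N.
Proof. by rewrite !addn3 (binS3 e.+4) (binS3 e.+3) -bin_square; lia. Qed.

Lemma bin_mono n m k : (n <= m)%N -> ('C(n, k) <= 'C(m, k))%N.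
Proof. exact: leq_bin2l. Qed.

Section SpecialPoints.

Variable K : fieldType.
Variables B C : {poly K}.
Hypothesis sB : size B = 3%N.
Hypothesis sC : (size C <= 3)%N.

Local Notation A := {poly {poly K}}.
Local Notation M4 := {mpoly K[4]}.
Local Notation G := (curve B C).
Local Notation i0 := (inord 0 : 'I_4).
Local Notation i1 := (inord 1 : 'I_4).
Local Notation i2 := (inord 2 : 'I_4).
Local Notation i3 := (inord 3 : 'I_4).

Variables (L : fieldType) (phi : {rmorphism A -> L}).
Hypothesis phi0 : forall F, phi F = 0 <-> exists F', F = G * F'.

Variables (d r : nat) (M : nat -> nat).
Hypothesis Mle : forall i j, (i <= j)%N -> (M j <= M i)%N.
Hypothesis r3 : (3 < r)%N.
Hypothesis std : (M 0 + M 1 + M 2 + M 3 <= 2 * d)%N.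
Hypothesis M0d : (M 0 <= d)%N.

Variable z : nat -> K * K.
Hypothesis zG : forall i, (i < r)%N -> pt (z i) G = 0 /\ pt (z i) G^`() != 0.
Hypothesis zz : forall i j, (i < j < r)%N -> (z i).1 != (z j).1 /\ (z i).2 != (z j).2.
Hypothesis zgen : forall k, (k < M 3)%N ->
  exists2 n, (n <= 4 * edeg d M k - ddeg d M k - \sum_(1 <= i < r) (M i - k))%N &
    hasdim (ioL phi) (imageof phi (fun F => polygon (edeg d M k) (ddeg d M k) F /\
      osculates B C z (fun i => if i == 0%N then 0%N else M i - k)%N r F)) n.

(** The first point is the ramification point (0:0:0:1) at infinity; the others lie in the affine
    chart of Q. *)
Definition special_point i : 'rV[K]_4 :=
  if i == 0%N then coordv K i3 else \row_j pt (z i) (segre K j).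

Lemma pt_segre zi : let v := \row_j pt zi (segre K j) in
  [/\ v 0 i0 = 1, v 0 i1 = zi.1, v 0 i2 = zi.2 & v 0 i3 = zi.1 * zi.2] :> Prop.
Proof.
have e1 : pt zi 'X%:P = zi.1 by rewrite /pt ev2s.
have e2 : pt zi 'X = zi.2 by rewrite /pt ev2u.
by split; rewrite mxE /segre !inordK //= rmorphM /= ?rmorph1 ?e1 ?e2 ?mul1r ?mulr1.
Qed.

Lemma special_point_neq0 i : special_point i != 0.
Proof.
rewrite /special_point; case: (i =P 0%N) => _.
  by apply/eqP => /rowP /(_ i3) /eqP; rewrite /coordv !mxE !eqxx oner_eq0.
apply/eqP => /rowP /(_ i0); have [-> _ _ _] := pt_segre (z i).
by move/eqP; rewrite mxE oner_eq0.
Qed.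

Lemma special_point_quadric i : (quadric0 K).@[special_point i 0] = 0.
Proof.
rewrite quadric0_eval /special_point; case: (i =P 0%N) => _.
  by rewrite /coordv !mxE -!val_eqE /= !inordK //= !mul0r subrr.
by have [-> -> -> ->] := pt_segre (z i); rewrite mul1r subrr.
Qed.

Lemma special_frame : exists2 N : 'M[K]_4, N \in unitmx &
  forall i : 'I_4, (i < 3)%N -> row i N = special_point i.
Proof.
(* Distinct first coordinates make z 1 and z 2 independent modulo the two coordinate vectors of
   index 2 and 3. *)
pose N : 'M[K]_4 := \matrix_i if (i < 3)%N then special_point i else coordv K i2.
exists N; last by move=> i ii; rewrite rowK ii.
rewrite -row_free_unit; apply: inj_row_free => v v0.
have [s12 _] : (z 1).1 != (z 2).1 /\ (z 1).2 != (z 2).2 by apply: zz; lia.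
have E j : v 0 i0 * (j == i3)%:R + (v 0 i1 * pt (z 1) (segre K j) + (v 0 i2 * pt (z 2) (segre K j)
     + v 0 i3 * (j == i2)%:R)) = 0.
  have := congr1 (fun w : 'rV[K]_4 => w 0 j) v0; rewrite mxE big_ord4 /= [RHS]mxE => <-.
  by rewrite !mxE !inordK //= /special_point /= !mxE ?eqxx /= ?inordK.
have [a0 a1 a2 a3] := pt_segre (z 1); have [b0 b1 b2 b3] := pt_segre (z 2).
rewrite !mxE in a0 a1 a2 a3 b0 b1 b2 b3.
have := E i0; rewrite a0 b0 -!val_eqE /= !inordK //= !mulr0 add0r !mulr1 addr0 => E0.
have := E i1; rewrite a1 b1 -!val_eqE /= !inordK //= !mulr0 add0r addr0 => E1.
have v2 : v 0 i2 = 0.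
  have : v 0 i2 * ((z 2).1 - (z 1).1) = 0.
    by rewrite mulrBr -[RHS]E1; move/eqP: E0; rewrite addr_eq0 => /eqP ->; ring.
  by move/eqP; rewrite mulf_eq0 subr_eq0 orbC eq_sym (negbTE s12) => /eqP.
have v1 : v 0 i1 = 0 by move: E0; rewrite v2 addr0.
have := E i2; rewrite v1 v2 !mul0r -!val_eqE /= !inordK //= mulr0 !add0r mulr1 => v3.
have := E i3; rewrite v1 v2 v3 !mul0r -!val_eqE /= !inordK //= !addr0 mulr1 => v00.
apply/rowP => j; rewrite mxE.
by have [->|[->|[->|->]]] := ord4_cases j.
Qed.

Definition Vk k := Vsys (d - 2 * k) r special_point (fun i => M i - k)%N.

Lemma Vk_image k f : (k <= d - M 0)%N -> Vk k f -> Zk d r M z k (rho f).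
Proof.
move=> kc [fd fm]; rewrite /Zk /edeg /ddeg kc; split.
  by apply: rho_polygon => //; apply: (fm 0%N); lia.
move=> i /andP [i0' ir]; apply: (mult2_comp _ (fm i ir)) => j.
by rewrite /special_point (gtn_eqF i0') mxE.
Qed.

Lemma Vk_kernel k f : Vk k f -> rho f = 0 ->
  exists2 h, f = quadric0 K * h & Vk k.+1 h /\ ((d - 2 * k < 2)%N -> h = 0).
Proof.
move=> [fd fm] f0; have [h Ef [hd h2]] := rho_kernel fd f0.
exists h => //; split=> //; split=> [|i ir].
  by have -> : (d - 2 * k.+1 = d - 2 * k - 2)%N by lia.
have := fm i ir; rewrite Ef subnS; case: (M i - k)%N => [|m] H; first exact: mult0.
apply: mult_div H; first exact: special_point_quadric.
exact/quadric0_grad/special_point_neq0.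
Qed.

Lemma Vk_kernel_dim k n' n : hasdim (ioM K 4) (Vk k.+1) n' ->
  hasdim (ioM K 4) (kernelof (@rho K) (Vk k)) n -> (n <= n')%N /\ ((d - 2 * k < 2)%N -> n = 0%N).
Proof.
move=> dn' dn.
have lq : klinear (ioM K 4) (ioM K 4) (fun h : AM K 4 => quadric0 K * h : AM K 4).
  by move=> c x y; rewrite mulrDr mulrCA.
have q0 : quadric0 K != 0.
  apply/eqP => q0; have [i] := quadric0_grad (special_point_neq0 0).
  by rewrite q0 mderiv0 meval0 eqxx.
split.
  have dI : hasdim (ioM K 4) (imageof (fun h : AM K 4 => quadric0 K * h : AM K 4) (Vk k.+1)) n'.
    apply: hasdim_image_inj dn' => [|h _ /eqP|]; [exact: lq| |exact: Vsys_subspace].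
    by rewrite mulf_eq0 (negbTE q0) => /eqP.
  apply: hasdim_leq dI dn => f [Vf f0].
  by have [h Ef [Vh _]] := Vk_kernel Vf f0; exists h.
move=> k2; case: n dn => // n [x [Px ix _]].
have [/Vk_kernel H /H [h Ex [_ h0]]] := Px ord0.
have x0 : x ord0 = 0 by rewrite Ex h0 // mulr0.
have := ix (delta_mx 0 ord0).
rewrite /lincomb (bigD1 ord0) //= x0 mulr0 big1 ?addr0 => [|i i0'].
  by move=> /(_ erefl) /rowP /(_ ord0) /eqP; rewrite !mxE !eqxx oner_eq0.
by rewrite mxE (negbTE i0') andbF rmorph0 mul0r.
Qed.

Lemma Vk_step k n n' m : (k <= d - M 0)%N -> hasdim (ioM K 4) (Vk k) n ->
  hasdim (ioM K 4) (Vk k.+1) n' -> hasdim (io2 K) (Zk d r M z k) m -> (n <= m + n')%N.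
Proof.
move=> kc dn dn' dm.
have [a [b [-> da db]]] := rank_nullity (@rho_klinear K) (Vsys_subspace _ _ _ _) dn.
apply: leq_add; last by have [] := Vk_kernel_dim dn' db.
by apply: hasdim_leq dm da => _ [f Vf ->]; apply: Vk_image.
Qed.

Definition cubes k := (\sum_(0 <= i < r) 'C(M i - k + 2, 3))%N.
Definition squares k := (\sum_(0 <= i < r) 'C((M i - k).+1, 2))%N.
(** The multiplicity along a line joining two points, m_i + m_j - d, is unchanged by (d, m) -> (d -
    2k, m - k): one constant serves all levels. *)
Definition lines := ('C(M 1 + M 2 - d + 1, 3) + \sum_(1 <= i < r) 'C(M 0 + M i - d + 1, 3))%N.

Lemma cubesS k : cubes k = (cubes k.+1 + squares k)%N.
Proof.
rewrite /cubes /squares -big_split; apply: eq_bigr => i _ /=.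
by rewrite subnS; case: (M i - k)%N => // x; rewrite /= addSn binS3 addn2.
Qed.

Lemma squares_split k : squares k = ('C((M 0 - k).+1, 2) + \sum_(1 <= i < r) 'C((M i - k).+1, 2))%N.
Proof. by rewrite /squares big_ltn //; lia. Qed.

(** At the level where degree and multiplicity at p_1 agree (cones with vertex p_1), the next level
    is empty and the bound must come from Q alone. With [lines] added, the count in P^3 equals the
    count on Q. *)
Lemma forms_line k : (k = d - M 0)%N -> (k <= M 3)%N ->
  ('C(d - 2 * k + 3, 3) + lines + squares k = (d - 2 * k).+1 ^ 2 + cubes k)%N.
Proof.
move=> kc k3; have m1 := M31 Mle; have m2 := M10 Mle; rewrite cubesS.
have -> : lines = \sum_(1 <= i < r) 'C(M i - k + 1, 3).
  rewrite /lines bin_small ?add0n; last by lia.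
  by apply: eq_bigr => i _; congr 'C(_, 3); lia.
have E : cubes k.+1 = ('C(M 0 - k + 1, 3) + \sum_(1 <= i < r) 'C(M i - k + 1, 3))%N.
  rewrite /cubes big_ltn; last by lia.
  congr (_ + _)%N; [|apply: eq_bigr => i _]; rewrite subnS.
    by case: (M 0 - k)%N => // x; rewrite addn1 addn2.
  by case: (M i - k)%N => // x; rewrite addn1 addn2.
rewrite E; have -> : (M 0 - k = d - 2 * k)%N by lia.
move: (\sum_(_ <= _ < _) _)%N (squares k) (d - 2 * k)%N => x y e.
by rewrite -bin_square addn3 addn1 (binS3 e.+2) (binS3 e.+1); lia.
Qed.

Section Bounds.

Variable t : nat.
Hypothesis tc : (t <= d - M 0)%N.
Hypothesis t3 : (t <= M 3)%N.
Hypothesis Hpos : forall j, (t <= j < M 3)%N ->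
  (\sum_(1 <= i < r) (M i - j) <= 4 * edeg d M j - ddeg d M j)%N.
Hypothesis Hneg : forall j, (j < t)%N ->
  (4 * edeg d M j - ddeg d M j <= \sum_(1 <= i < r) (M i - j))%N.

Lemma Zk_squares k m : (t <= k <= M 3)%N -> (k <= d - M 0)%N -> hasdim (io2 K) (Zk d r M z k) m ->
  (m + squares k <= (d - 2 * k).+1 ^ 2)%N.
Proof.
move=> /andP [tk k3] kc dm.
have [|n dn] := Zk_bound sB sC phi0 Mle r3 std M0d zG zz zgen k3.
  by move=> j /andP [kj j3]; apply: Hpos; rewrite j3 (leq_trans tk).
by rewrite (hasdim_uniq dm dn) squares_split /edeg /ddeg kc addnA.
Qed.

(** Only the first three points remain, so monomials are counted. Level M 3 + 1 is included because
    the kernel of restriction at level t <= M 3 lives at level t + 1. *)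
Lemma Vk_three k n : (M 3 <= k <= (M 3).+1)%N -> (k <= d - M 0)%N -> hasdim (ioM K 4) (Vk k) n ->
  (n + cubes k <= 'C(d - 2 * k + 3, 3) + lines)%N.
Proof.
move=> /andP [k3 k3'] kc dn; have m1 := M31 Mle; have m2 := M10 Mle.
have [N uN rN] := special_frame.
have [||n' dn' E] := Vsys3_dim (mu := fun i => (M i - k)%N) (d := (d - 2 * k)%N) uN rN.
- move=> i i3'; have : (M i <= M 0)%N by apply: Mle.
  by lia.
- by lia.
have nn' : (n <= n')%N.
  apply: hasdim_leq dn' dn => f [fd fm]; split=> // i i3'; apply: fm.
  exact: leq_trans i3' (ltnW r3).
have -> : cubes k = ('C(M 0 - k + 2, 3) + 'C(M 1 - k + 2, 3) + 'C(M 2 - k + 2, 3))%N.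
  rewrite /cubes big_ltn ?(ltn_trans _ r3) // big_ltn ?(ltn_trans _ r3) // big_ltn ?(ltn_trans _ r3) //.
  rewrite big_nat big1 ?addn0 ?addnA // => i /andP [i3' _].
  by have : (M i <= M 3)%N by [apply: Mle]; move=> H; have -> : (M i - k = 0)%N by lia.
have : ('C(M 0 + M 1 - d + 1, 3) + 'C(M 0 + M 2 - d + 1, 3) + 'C(M 1 + M 2 - d + 1, 3) <= lines)%N.
  rewrite /lines big_ltn ?(ltn_trans _ r3) // big_ltn ?(ltn_trans _ r3) //.
  by move: (\sum_(_ <= _ < _) _)%N; move: 'C(_, _) 'C(_, _) 'C(_, _) => x y w v; lia.
have : ('C(M 0 - k + (M 1 - k) - (d - 2 * k) + 1, 3) <= 'C(M 0 + M 1 - d + 1, 3))%N.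
  by apply: bin_mono; lia.
have : ('C(M 0 - k + (M 2 - k) - (d - 2 * k) + 1, 3) <= 'C(M 0 + M 2 - d + 1, 3))%N.
  by apply: bin_mono; lia.
have : ('C(M 1 - k + (M 2 - k) - (d - 2 * k) + 1, 3) <= 'C(M 1 + M 2 - d + 1, 3))%N.
  by apply: bin_mono; lia.
move: E nn'; clear; move: 'C(_, _) 'C(_, _) 'C(_, _) 'C(_, _) => x1 x2 x3 x4.
by move: 'C(_, _) 'C(_, _) 'C(_, _) 'C(_, _) 'C(_, _) 'C(_, _) lines => *; lia.
Qed.

Lemma Vk_empty k n : (k <= M 0)%N -> (d - 2 * k < M 0 - k)%N -> hasdim (ioM K 4) (Vk k) n -> n = 0%N.
Proof.
move=> k0 dk; case: n => // n [x [Px ix _]].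
have [fd fm] := Px ord0.
have x0 : x ord0 = 0.
  apply/mpolyP => a; rewrite mcoeff0; apply/eqP; apply: contraT => xa.
  have := mult_coord_coef fd (fm 0%N ltac:(lia)) xa.
  lia.
have := ix (delta_mx 0 ord0).
rewrite /lincomb (bigD1 ord0) //= x0 mulr0 big1 ?addr0 => [|i i0'].
  by move=> /(_ erefl) /rowP /(_ ord0) /eqP; rewrite !mxE !eqxx oner_eq0.
by rewrite mxE (negbTE i0') andbF rmorph0 mul0r.
Qed.

(** Below d - M 0 the expected dimension on Q is added to the bound at the next level. At d - M 0
    itself the next degree is smaller than the multiplicity at p_1, so that level contributes
    nothing and [forms_line] concludes. *)
Lemma Vk_step_lines k n n' : (t <= k)%N -> (k < M 3)%N -> (k <= d - M 0)%N ->
  hasdim (ioM K 4) (Vk k) n -> hasdim (ioM K 4) (Vk k.+1) n' ->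
  ((k < d - M 0)%N -> (n' + cubes k.+1 <= 'C(d - 2 * k.+1 + 3, 3) + lines)%N) ->
  (n + cubes k <= 'C(d - 2 * k + 3, 3) + lines)%N.
Proof.
move=> tk k3 kc dn dn' H.
have [m dm] := Zk_finite sB sC Mle r3 std M0d z (ltnW k3).
have h1 := Vk_step kc dn dn' dm.
have h2 := Zk_squares (k := k) ltac:(by rewrite tk ltnW) kc dm.
have m1 := M31 Mle; have m2 := M10 Mle.
have [kc'|kc'] := ltnP k (d - M 0).
  have := H kc'; rewrite (cubesS k); have -> : (d - 2 * k = (d - 2 * k.+1).+2)%N by lia.
  rewrite forms_step; move: h1 h2; have -> : ((d - 2 * k).+1 = (d - 2 * k.+1).+3)%N by lia.
  by move: (_ ^ 2)%N (cubes _) (squares _) 'C(_, _) => x1 x2 x3 x4; lia.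
have ec : (k = d - M 0)%N by lia.
have n'0 : n' = 0%N by apply: Vk_empty dn'; lia.
have := forms_line ec (ltnW k3); move: h1 h2; rewrite n'0.
by move: (_ ^ 2)%N (cubes _) (squares _) 'C(_, _) => x1 x2 x3 x4; lia.
Qed.

Lemma Vk_lines k n : (t <= k <= (M 3).+1)%N -> (k <= d - M 0)%N -> hasdim (ioM K 4) (Vk k) n ->
  (n + cubes k <= 'C(d - 2 * k + 3, 3) + lines)%N.
Proof.
move: {2}(M 3 - k)%N (leqnn (M 3 - k)) => l.
elim: l k n => [|l IH] k n lk /andP [tk k3] kc dn; first by apply: Vk_three dn => //; lia.
have [k3'|k3'] := ltnP k (M 3); last by apply: Vk_three dn => //; lia.
have [n' dn'] := Vsys_finite (d - 2 * k.+1) r special_point (fun i => M i - k.+1)%N.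
apply: (Vk_step_lines tk k3' kc dn dn') => kc'.
by apply: (IH k.+1) dn' => //; lia.
Qed.

(** Forms vanishing on Q are the quadric times level t + 1, to which [Vk_lines] applies. This upper
    bound later bounds the rank of restriction to Q from below. *)
Lemma Vk_kernel_lines n : hasdim (ioM K 4) (kernelof (@rho K) (Vk t)) n ->
  (n + (d - 2 * t).+1 ^ 2 + cubes t <= 'C(d - 2 * t + 3, 3) + lines + squares t)%N.
Proof.
move=> dn; have m1 := M31 Mle; have m2 := M10 Mle.
have [n' dn'] := Vsys_finite (d - 2 * t.+1) r special_point (fun i => M i - t.+1)%N.
have [nn' n0] := Vk_kernel_dim dn' dn.
have [tc'|tc'] := ltnP t (d - M 0); last first.
  have ec : (t = d - M 0)%N by lia.
  have n'0 : n = 0%N.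
    have [/n0 //|d2] := ltnP (d - 2 * t) 2.
    by have : n' = 0%N by [apply: Vk_empty dn'; lia]; lia.
  have := forms_line ec t3; rewrite n'0.
  by move: (_ ^ 2)%N (cubes _) (squares _) 'C(_, _) => x1 x2 x3 x4; lia.
have [d2|d2] := leqP 2 (d - 2 * t).
  have := Vk_lines (k := t.+1) ltac:(lia) tc' dn'.
  rewrite (cubesS t); have -> : (d - 2 * t = (d - 2 * t.+1).+2)%N by lia.
  rewrite forms_step; move: nn'.
  by move: (_ ^ 2)%N (cubes _) (squares _) 'C(_, _) => x1 x2 x3 x4; lia.
(* What remains is d - 2t = 1 with all M i <= t: linear forms with no condition, none of which
   vanishes on Q. *)
have M0t : (M 0 = t)%N by lia.
have -> : cubes t = 0%N.
  by rewrite /cubes big1 // => i _; have -> : (M i - t = 0)%N by have := Mle (leq0n i); lia.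
by rewrite n0 //; have -> : (d - 2 * t = 1)%N by lia.
Qed.

(** Each of the t restrictions to Q below level t contributes at most the dimension m of the system
    on Q at level t, by [Zk_leq]; level t itself is bounded by [Vk_lines]. *)
Lemma Vk0_bound n : hasdim (ioM K 4) (Vk 0) n ->
  (n + t * squares t + cubes t <= 'C(d - 2 * t + 3, 3) + lines + t * (d - 2 * t).+1 ^ 2)%N.
Proof.
have [m dm] := Zk_finite sB sC Mle r3 std M0d z t3.
have [n' dn'] := Vsys_finite (d - 2 * t) r special_point (fun i => M i - t)%N.
have h1 := Zk_squares (k := t) ltac:(by rewrite leqnn) tc dm.
have h2 := Vk_lines (k := t) ltac:(by rewrite leqnn ltnW) tc dn'.
suff H k k' l : (k + l = t)%N -> hasdim (ioM K 4) (Vk k) k' -> (k' <= l * m + n')%N.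
  move=> /(H 0%N _ t (add0n t)) h3; have := leq_mul (leqnn t) h1; rewrite mulnDr.
  by move: h2 h3; move: (t * m)%N (t * squares t)%N (t * _)%N => x1 x2 x3; lia.
elim: l k k' => [|l IH] k k' kl dk.
  rewrite addn0 in kl; rewrite kl in dk; rewrite mul0n add0n.
  by rewrite (hasdim_uniq dk dn').
have [k'' dk'] := Vsys_finite (d - 2 * k.+1) r special_point (fun i => M i - k.+1)%N.
have k3 : (k <= M 3)%N by lia.
have [m' dm'] := Zk_finite sB sC Mle r3 std M0d z k3.
have h3 := Vk_step (k := k) ltac:(lia) dk dk' dm'.
have h4 : (m' <= m)%N.
  by apply: (Zk_leq sB sC phi0 Mle r3 std M0d zG zgen _ Hneg dm' dm); lia.
by have := IH k.+1 k'' ltac:(lia) dk'; rewrite mulSn; lia.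
Qed.

End Bounds.

End SpecialPoints.

(** * The sign of the degree on B along the tower *)

Section CurveDegrees.

Variables (d r t : nat) (M : nat -> nat).
Hypothesis Mle : forall i j, (i <= j)%N -> (M j <= M i)%N.
Hypothesis r0 : (0 < r)%N.
Hypothesis std : (M 0 + M 1 + M 2 + M 3 <= 2 * d)%N.
Hypothesis tc : (t + M 0 <= d)%N.
Hypothesis tM : forall i, (i < r)%N -> (t <= M i)%N.
Hypothesis Mr : forall i, (r <= i)%N -> M i = 0%N.

(** Every point of index 1 to k - 1 still has multiplicity above j, so its term loses the full j -
    t. *)
Lemma sum_shift j k : (t <= j)%N -> (0 < k <= r)%N -> (j < M k.-1)%N ->
  (\sum_(1 <= i < r) (M i - j) + k.-1 * (j - t) <= \sum_(1 <= i < r) (M i - t))%N.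
Proof.
move=> tj /andP [k0 kr] kM.
have -> : (k.-1 * (j - t) = \sum_(1 <= i < r) (if i < k then j - t else 0))%N.
  rewrite (big_cat_nat k0 kr) /=.
  rewrite [X in (_ + X)%N]big_nat [X in (_ + X)%N]big1 ?addn0; last by move=> i /andP [ki _]; rewrite ltnNge ki.
  have -> : (k.-1 = k - 1)%N by rewrite subn1.
  rewrite -sum_nat_const_nat big_nat [RHS]big_nat.
  by apply: eq_bigr => i /andP [_ ->].
rewrite -big_split /= big_nat [X in (_ <= X)%N]big_nat; apply: leq_sum => i /andP [_ ir].
have := tM ir; case: ltnP => ik; last by lia.
by have : (M k.-1 <= M i)%N by [apply: Mle; lia]; lia.
Qed.

Lemma sum_truncate j k : (0 < k)%N -> (M k <= j)%N ->
  (\sum_(1 <= i < r) (M i - j) <= \sum_(1 <= i < k) (M i - j))%N.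
Proof.
move=> k0 Mk; have z i : (k <= i)%N -> (M i - j = 0)%N by move=> /Mle; lia.
have [rk|kr] := leqP r k.
  by rewrite [leqRHS](big_cat_nat (n := r)) //= leq_addr.
rewrite (big_cat_nat k0 (ltnW kr)) /= [X in (_ + X <= _)%N]big_nat [X in (_ + X <= _)%N]big1 ?addn0 //.
by move=> i /andP [/z].
Qed.

(** When few points survive at level j, standardness suffices. When many survive, passing from t to
    j takes away at least as much from the multiplicities as from the degree, and positivity at
    level t carries over. *)
Lemma degrees_pos : (\sum_(1 <= i < r) (M i - t) + (M 0 - t) < 4 * (d - 2 * t))%N ->
  forall j, (t <= j < M 3)%N -> (\sum_(1 <= i < r) (M i - j) <= 4 * edeg d M j - ddeg d M j)%N.
Proof.
move=> T1 j /andP [tj j3].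
have m i : (i < 3)%N -> (M i.+1 <= M i)%N by move=> _; apply: Mle.
have m0 := m 0%N isT; have m1 := m 1%N isT; have m2 := m 2%N isT.
have b i k : (i <= k)%N -> (M k - j <= M i - j)%N by move=> /Mle; lia.
have b4 := b 3%N 4%N isT; have b5 := b 3%N 5%N isT; have b6 := b 3%N 6%N isT.
have b7 := b 3%N 7%N isT; have b8 := b 3%N 8%N isT; have b9 := b 3%N 9%N isT.
have ex i : (i <= 3)%N -> exists x, M i = (x + j)%N.
  by move=> /Mle Mi; exists (M i - j)%N; rewrite subnK // ltnW // (leq_trans j3).
have [x0 e0] := ex 0%N isT; have [x1 e1] := ex 1%N isT; have [x2 e2] := ex 2%N isT.
have [x3 e3] := ex 3%N isT.
have e0t : (M 0 - t = x0 + (j - t))%N by rewrite e0 addnBA.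
have std' := std; have tc' := tc.
rewrite e0t in T1; rewrite e0 e1 e2 e3 in std'; rewrite e0 e1 in m0; rewrite e1 e2 in m1; rewrite e2 e3 in m2.
rewrite e0 in tc'.
rewrite e3 addnK in b4 b5 b6 b7 b8 b9.
rewrite /edeg /ddeg e0; have [jc|jc] := leqP j (d - (x0 + j)).
  (* Eight points or fewer: two groups of four, each of sum at most 2d. With nine, the
     multiplicities fall by at least 9(j - t) against 8(j - t) for the degree. *)
  have [M8|M8] := leqP (M 8) j.
    apply: leq_trans (sum_truncate _ M8) _ => //.
    rewrite -[index_iota 1 8]/[:: 1; 2; 3; 4; 5; 6; 7]%N !big_cons big_nil e1 e2 e3 !addnK.
    move: b4 b5 b6 b7 m0 m1 m2 std'; clear; move: (M 4 - j)%N (M 5 - j)%N (M 6 - j)%N (M 7 - j)%N; lia.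
  have r8 : (8 < r)%N by rewrite ltnNge; apply/negP => /Mr E; rewrite E in M8.
  have := sum_shift (k := 9) tj r8 M8; move: T1 tc' jc tj; clear.
  by move: (\sum_(_ <= _ < _) _)%N (\sum_(_ <= _ < _) _)%N; lia.
(* On triangles the degree is 3(2d - M 0 - 3j), to be compared with three triples of sum at most 2d
   - M 0. With ten further points the loss 10(j - t) and t + M 0 <= d suffice. *)
have [M10|M10] := leqP (M 10) j.
  apply: leq_trans (sum_truncate _ M10) _ => //.
  rewrite -[index_iota 1 10]/[:: 1; 2; 3; 4; 5; 6; 7; 8; 9]%N !big_cons big_nil e1 e2 e3 !addnK.
  move: b4 b5 b6 b7 b8 b9 m0 m1 m2 std'; clear.
  by move: (M 4 - j)%N (M 5 - j)%N (M 6 - j)%N (M 7 - j)%N (M 8 - j)%N (M 9 - j)%N; lia.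
have r10 : (10 < r)%N by rewrite ltnNge; apply/negP => /Mr E; rewrite E in M10.
have := sum_shift (k := 11) tj r10 M10; move: T1 tc' jc tj; clear.
by move: (\sum_(_ <= _ < _) _)%N (\sum_(_ <= _ < _) _)%N; lia.
Qed.

(** The hypothesis says that the degree at level t - 1 is nonpositive, and since r >= 8 it is at
    most that at every lower level. *)
Lemma degrees_neg : (8 <= r)%N ->
    (4 * d + r * t.-1 <= \sum_(0 <= i < r) M i + 8 * t.-1)%N ->
  forall j, (j < t)%N -> (4 * edeg d M j - ddeg d M j <= \sum_(1 <= i < r) (M i - j))%N.
Proof.
move=> r8 T2 j jt; have jc : (j <= d - M 0)%N by move: tc jt; clear; lia.
rewrite /edeg /ddeg jc.
have E : (\sum_(1 <= i < r) (M i - j) + r.-1 * j = \sum_(1 <= i < r) M i)%N.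
  rewrite -subn1 -sum_nat_const_nat -big_split /= big_nat [RHS]big_nat.
  apply: eq_bigr => i /andP [_ ir]; have := tM ir; lia.
rewrite big_ltn // -E in T2; have := tM r0.
move: T2; move: (\sum_(_ <= _ < _) _)%N => s.
have : (r * t.-1 = 8 * t.-1 + (r - 8) * t.-1)%N by rewrite -mulnDl subnKC.
have : (r.-1 * j = 7 * j + (r - 8) * j)%N by rewrite -mulnDl; congr (_ * _)%N; lia.
have : ((r - 8) * j <= (r - 8) * t.-1)%N by rewrite leq_mul2l; apply/orP; right; lia.
move: tc jt; clear.
move: ((r - 8) * j)%N ((r - 8) * t.-1)%N (r.-1 * j)%N (r * t.-1)%N.
lia.
Qed.

End CurveDegrees.

(** * Multiplicity through partial derivatives, and multihomogeneous polynomials *)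

Section Derivatives.

Variable K : fieldType.
Hypothesis charK : [pchar K] =i pred0.
Local Notation M4 := {mpoly K[4]}.
Implicit Types (f : M4) (v : 'rV[K]_4).

Lemma mpoly_chain_rule (S : comNzRingType) (th : {rmorphism M4 -> S}) (dl : {additive M4 -> S}) :
    (forall F G, dl (F * G) = dl F * th G + th F * dl G) -> (forall c, dl c%:MP = 0) ->
  forall F, dl F = \sum_i th (F^`M(i)) * dl 'X_i.
Proof.
move=> dlM dlC; have HM F G : dl F = \sum_i th (F^`M(i)) * dl 'X_i ->
    dl G = \sum_i th (G^`M(i)) * dl 'X_i -> dl (F * G) = \sum_i th ((F * G)^`M(i)) * dl 'X_i.
  move=> EF EG; rewrite dlM EF EG mulr_suml mulr_sumr -big_split; apply: eq_bigr => i _ /=.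
  by rewrite mderivM rmorphD !rmorphM /=; ring.
have HC c : dl c%:MP = \sum_i th ((c%:MP)^`M(i)) * dl 'X_i.
  by rewrite dlC big1 // => i _; rewrite mderivC rmorph0 mul0r.
elim/mpolyind => [|c m p _ _ IH]; first by rewrite -mpolyC0.
have -> : dl (c *: 'X_[m] + p) = dl (c *: 'X_[m]) + dl p by rewrite raddfD.
have -> : \sum_i th ((c *: 'X_[m] + p)^`M(i)) * dl 'X_i =
    \sum_i th ((c *: 'X_[m])^`M(i)) * dl 'X_i + \sum_i th (p^`M(i)) * dl 'X_i.
  by rewrite -big_split; apply: eq_bigr => i _; rewrite mderivD rmorphD mulrDl.
rewrite -IH; congr (_ + _); rewrite -mul_mpolyC; apply: (HM) => //; rewrite mpolyXE_id.
elim/big_ind: _ => //; first by rewrite -mpolyC1; apply: HC.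
move=> i _; elim: (m i) => [|k IHk]; first by rewrite expr0 -mpolyC1; apply: HC.
rewrite exprS; apply: (HM) => //; rewrite (bigD1 i) //= big1 => [|j ji].
  have -> : ('X_i)^`M(i) = 1 :> M4.
    rewrite mderivX mnm1E eqxx scale1r -mpolyX0; congr 'X_[_].
    by apply/mnmP => l; rewrite mnmBE subnn mnm0E.
  by rewrite rmorph1 mul1r addr0.
by rewrite mderivX mnm1E eq_sym (negbTE ji) scale0r rmorph0 mul0r.
Qed.

Lemma germ_deriv v f : (germ v f)^`() = \sum_i germ v f^`M(i) * ('X_i)%:P.
Proof.
pose dl : {additive M4 -> {poly M4}} := @deriv _ \o germ v.
rewrite -[LHS]/(dl f) (@mpoly_chain_rule _ (germ v) dl) /dl /=.
- apply: eq_bigr => i _; rewrite germX derivD derivM derivX derivC.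
  by rewrite /mpC2 /= derivC add0r mul0r add0r mulr1.
- by move=> F G; rewrite rmorphM /= derivM.
- by move=> c; rewrite germC derivC.
Qed.

Lemma germ_mderiv v f i : map_poly (mderiv i) (germ v f) = germ v f^`M(i) * 'X.
Proof.
pose D : {additive {poly M4} -> {poly M4}} := map_poly (mderiv i).
have DM F G : D (F * G) = D F * G + F * D G.
  apply/polyP => k; rewrite coefD !coefM /D /= coef_map /= coefM raddf_sum -big_split.
  by apply: eq_bigr => j _; rewrite /= mderivM !coef_map.
have DC p : D p%:P = (p^`M(i))%:P by rewrite /D /= map_polyC.
have DX : D 'X = 0.
  by apply/polyP => k; rewrite /D /= coef_map /= coefX coef0; case: (k == _); rewrite ?mderiv0 // -mpolyC1 mderivC.
pose dl : {additive M4 -> {poly M4}} := D \o germ v.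
rewrite -[LHS]/(dl f) (@mpoly_chain_rule _ (germ v) dl) /dl /=.
- rewrite (bigD1 i) //= big1 ?addr0 => [|j ji]; rewrite germX raddfD /= DM DX mulr0 addr0 !DC.
    rewrite /mpC2 /= mderivC polyC0 add0r.
    have -> : ('X_i)^`M(i) = 1 :> M4.
      rewrite mderivX mnm1E eqxx scale1r -mpolyX0; congr 'X_[_].
      by apply/mnmP => l; rewrite mnmBE subnn mnm0E.
    by rewrite mul1r.
  by rewrite mderivC mderivX mnm1E (negbTE ji) scale0r polyC0 mul0r addr0 mulr0.
- by move=> F G; rewrite rmorphM /= DM.
- by move=> c; rewrite germC DC mderivC polyC0.
Qed.

(** The T-derivative of the germ is the sum of the germs of the partial derivatives times x_i; in
    characteristic 0 it determines all coefficients of the germ but the constant one. *)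
Lemma multS m v f : mult m.+1 v f <-> f.@[v 0] = 0 /\ forall i, mult m v f^`M(i).
Proof.
split=> [mf|[f0 fi]].
  split; first by apply/mult1; apply: mult_leq mf.
  move=> i; have [h E] := mf; exists (map_poly (mderiv i) h).
  apply: (@mulIf _ 'X); first by rewrite polyX_eq0.
  rewrite -germ_mderiv E -mulrA -exprSr; apply/polyP => k.
  by rewrite coef_map /= !coefMXn coef_map; case: ifP; rewrite // raddf0.
have [h Eh] : exists h, (germ v f)^`() = h * 'X^m.
  rewrite germ_deriv; elim/big_rec: _ => [|i p _ [h ->]]; first by exists 0; rewrite mul0r.
  by have [h' ->] := fi i; exists (h' * ('X_i)%:P + h); rewrite mulrDl mulrAC.
exists (drop_poly m.+1 (germ v f)); rewrite -{1}[germ v f](poly_take_drop m.+1).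
suff -> : take_poly m.+1 (germ v f) = 0 by rewrite add0r.
apply/polyP => k; rewrite coef_take_poly coef0; case: ltnP => // km.
case: k km => [|k] km; first by rewrite germ0 f0 mpolyC0.
have : (germ v f)^`()`_k = 0 by rewrite Eh coefMXn ifT.
rewrite coef_deriv -mulr_natr => /eqP; rewrite mulf_eq0 => /orP [/eqP //|].
by rewrite -mpolyC_nat mpolyC_eq0 ((pcharf0P K).1 charK).
Qed.

(** Sequences of fewer than m differentiations, with the repetitions due to symmetry kept: the
    recursion on the first letter is that of [multS]. *)
Fixpoint words m : seq (seq 'I_4) :=
  if m is m'.+1 then [::] :: [seq i :: w | i <- enum 'I_4, w <- words m'] else [::].

Definition derivs w f : M4 := foldl (fun g i => g^`M(i)) f w.

Lemma mult_words m v f : mult m v f <-> forall w, w \in words m -> (derivs w f).@[v 0] = 0.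
Proof.
elim: m f => [|m IH] f; first by split=> // _; apply: mult0.
rewrite multS; split=> [[f0 fi] w|H].
  rewrite inE => /orP [/eqP -> //|/allpairsP [[i u] [_ uw ->]]] /=.
  by have /IH := fi i; apply.
split; first by apply: (H [::]); rewrite inE eqxx.
move=> i; apply/IH => w ww; apply: (H (i :: w)); rewrite inE; apply/orP; right.
by apply/allpairsP; exists (i, w); split=> //; rewrite mem_enum.
Qed.

Lemma derivs_homog w d f : f \is d.-homog -> derivs w f \is (d - size w).-homog.
Proof.
elim: w d f => [|i w IH] d f fd; first by rewrite subn0.
have -> : (d - size (i :: w) = d - 1 - size w)%N by rewrite /= -subnDA.
apply: IH.
apply/dhomogP => a; rewrite mcoeff_msupp mcoeff_deriv => H.
have : f@_(a + U_(i)) != 0 by apply: contraNneq H => ->; rewrite mul0rn.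
rewrite -mcoeff_msupp => /(dhomog_mf fd) /=; rewrite mdegD mdeg1 => <-.
by rewrite addn1 subn1.
Qed.

Lemma derivs_klinear w c f g : derivs w (c%:MP * f + g) = c%:MP * derivs w f + derivs w g.
Proof.
elim: w f g => //= i w IH f g; rewrite -IH; congr (derivs w _).
by rewrite mderivD mderivM mderivC mul0r add0r.
Qed.

End Derivatives.

Section Multihomogeneous.

Variables (K : fieldType) (r : nat).
Local Notation R := {mpoly K[r * 4]}.
Implicit Types (e : 'I_r -> nat) (G : R).

Definition multidegree e G := forall a, a \in msupp G ->
  forall i, (\sum_(j < 4) a (mxvec_index i j))%N = e i.

Lemma multidegreeP e G :
  multidegree e G <-> forall a, G@_a != 0 -> forall i, (\sum_(j < 4) a (mxvec_index i j))%N = e i.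
Proof. by split=> H a; have := H a; rewrite mcoeff_msupp. Qed.

Lemma eq_multidegree e e' G : e =1 e' -> multidegree e G -> multidegree e' G.
Proof. by move=> E H a /H Ha i; rewrite Ha E. Qed.

Lemma multidegree0 e : multidegree e 0.
Proof. by move=> a; rewrite msupp0. Qed.

Lemma multidegreeC c : multidegree (fun=> 0%N) c%:MP.
Proof.
apply/multidegreeP => a; rewrite mcoeffC; case: (eqVneq 0%MM a) => [<- _ i|]; last by rewrite mulr0 eqxx.
by rewrite big1 // => j _; rewrite mnm0E.
Qed.

Lemma multidegreeD e F G : multidegree e F -> multidegree e G -> multidegree e (F + G).
Proof. by move=> hF hG a /msuppD_le; rewrite mem_cat => /orP [/hF|/hG]. Qed.

Lemma multidegreeM e e' F G : multidegree e F -> multidegree e' G ->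
  multidegree (fun i => e i + e' i)%N (F * G).
Proof.
move=> hF hG a /msuppM_le /allpairsP [[b c] [/hF Fb /hG Gc ->]] i /=.
by rewrite -Fb -Gc -big_split; apply: eq_bigr => j _; rewrite mnmDE.
Qed.

Lemma multidegree_sum (I : Type) (s : seq I) e (F : I -> R) :
  (forall k, multidegree e (F k)) -> multidegree e (\sum_(k <- s) F k).
Proof.
move=> hF; elim/big_rec: _ => [|k G _ hG]; first exact: multidegree0.
exact: multidegreeD.
Qed.

Lemma multidegree_prod (I : Type) (s : seq I) (e : I -> 'I_r -> nat) (F : I -> R) :
  (forall k, multidegree (e k) (F k)) ->
  multidegree (fun i => \sum_(k <- s) e k i)%N (\prod_(k <- s) F k).
Proof.
move=> hF; elim: s => [|k s IH].
  rewrite big_nil -mpolyC1; apply: (eq_multidegree (e := fun=> 0%N)); last exact: multidegreeC.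
  by move=> i; rewrite big_nil.
rewrite big_cons; apply: (eq_multidegree (e := fun i => e k i + \sum_(l <- s) e l i)%N).
  by move=> i; rewrite big_cons.
exact: multidegreeM.
Qed.

Lemma multidegreeXn n e G : multidegree e G -> multidegree (fun i => n * e i)%N (G ^+ n).
Proof.
move=> hG; elim: n => [|n IH]; first by rewrite expr0 -mpolyC1; apply: multidegreeC.
by rewrite exprS; apply: (multidegreeM hG IH).
Qed.

(** Each term takes one entry from every row, so it is enough that the multidegree be constant along
    rows. *)
Lemma multidegree_det n (A : 'M[R]_n) (e : 'I_n -> 'I_r -> nat) :
  (forall i j, multidegree (e i) (A i j)) -> multidegree (fun k => \sum_i e i k)%N (\det A).
Proof.
move=> hA; apply: multidegree_sum => s.
have -> : (-1) ^+ s = ((-1) ^+ s : K)%:MP :> R by rewrite rmorphXn /= mpolyCN mpolyC1.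
apply: (eq_multidegree (e := fun k => (0 + \sum_i e i k)%N)) => [i|]; first by rewrite add0n.
by apply: multidegreeM; [apply: multidegreeC | apply: multidegree_prod].
Qed.

Lemma multidegreeXU i j :
  multidegree (fun k => (k == i) : nat) ('X_(mxvec_index i j) : R).
Proof.
apply/multidegreeP => a; rewrite mcoeffX.
case: (eqVneq U_(mxvec_index i j)%MM a) => [<- _ k|]; last by rewrite eqxx.
rewrite (eq_bigr (fun l => ((k == i) && (l == j)) : nat)) => [|l _]; last first.
  by rewrite mnm1E (inj_eq (@cast_ord_inj _ _ _)) (inj_eq enum_rank_inj) -pair_eqE /= eq_sym [j == l]eq_sym.
case: (k == i); last by rewrite big1.
by rewrite (bigD1 j) //= eqxx big1 ?addn0 // => l /negbTE ->.
Qed.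

Definition coords i : 4.-tuple R := [tuple 'X_(mxvec_index i j) | j < 4].

Lemma multidegree_comp d i (f : {mpoly K[4]}) : f \is d.-homog ->
  multidegree (fun k => if k == i then d else 0%N) (f \mPo coords i).
Proof.
move=> fd; rewrite comp_mpolyEX big_seq.
elim/big_rec: _ => [|a G /(dhomog_mf fd) ad hG]; first exact: multidegree0.
apply: multidegreeD hG; rewrite -mul_mpolyC.
apply: (eq_multidegree (e := fun k => (0 + \sum_(l < 4) a l * (k == i))%N)).
  by move=> k; rewrite add0n -big_distrl -mdegE ad /=; case: (k == i); rewrite ?muln1 ?muln0.
apply: multidegreeM; first exact: multidegreeC.
rewrite comp_mpolyX; apply: multidegree_prod => l; rewrite tnth_mktuple.
exact/multidegreeXn/multidegreeXU.
Qed.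

Lemma eval_coords (p : 'M[K]_(r, 4)) i (f : {mpoly K[4]}) :
  (f \mPo coords i).@[mxvec p 0] = f.@[(row i p) 0].
Proof.
rewrite comp_mpoly_meval; apply: meval_eq => j.
by rewrite tnth_mktuple mevalXU mxvecE mxE.
Qed.

End Multihomogeneous.

(** * Semicontinuity of dimensions in the points *)

Section Minors.

Variable K : fieldType.

Lemma rank_minor m n (A : 'M[K]_(m, n)) :
  exists (f : 'I_(\rank A) -> 'I_m) (g : 'I_(\rank A) -> 'I_n),
    \det (\matrix_(a, b) A (f b) (g a)) != 0.
Proof.
pose A1 := (rowsub (maxrankfun A) A)^T.
have fA1 : row_full A1 by rewrite /row_full mxrank_tr; apply: maxrowsub_free.
exists (maxrankfun A), (fullrankfun fA1).
have := fullrowsub_unit fA1; rewrite unitmxE unitfE; congr (\det _ != 0).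
by apply/matrixP => a b; rewrite !mxE.
Qed.

Lemma minor_rank m n h (A : 'M[K]_(m, n)) (f : 'I_h -> 'I_m) (g : 'I_h -> 'I_n) :
  \det (\matrix_(a, b) A (f b) (g a)) != 0 -> (h <= \rank A)%N.
Proof.
rewrite -unitfE -unitmxE -row_free_unit => /eqP <-.
have -> : \matrix_(a, b) A (f b) (g a) = rowsub g (rowsub f A)^T.
  by apply/matrixP => a b; rewrite !mxE.
rewrite rowsubE (leq_trans (mxrankM_maxr _ _)) // mxrank_tr rowsubE.
exact: mxrankM_maxr.
Qed.

End Minors.

Section Openness.

Variable K : fieldType.
Hypothesis charK : [pchar K] =i pred0.
Local Notation M4 := {mpoly K[4]}.

Lemma hasdim_kernel (V : comNzRingType) (io : {rmorphism K -> V}) m n (x : 'I_m -> V) (A : 'M[K]_(m, n)) :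
  independent io x ->
  hasdim io (fun v => exists2 c, c *m A = 0 & v = lincomb io x c) (m - \rank A).
Proof.
move=> ix; rewrite -mxrank_ker; exists (fun i => lincomb io x (row i (row_base (kermx A)))); split.
- move=> i; exists (row i (row_base (kermx A))) => //; apply/eqP.
  by rewrite -sub_kermx (submx_trans (row_sub _ _)) // eq_row_base.
- by apply: independent_row_free => //; apply: row_base_free.
move=> v [c /eqP]; rewrite -sub_kermx -(eq_row_base (kermx A)) => /submxP [c' ->] ->.
by exists c'; rewrite lincomb_mulmx.
Qed.

Variable r : nat.

Definition conditions (mu : 'I_r -> nat) : seq ('I_r * seq 'I_4) :=
  [seq (i, w) | i <- enum 'I_r, w <- words (mu i)].

Lemma conditionsP mu i w : reflect (w \in words (mu i)) ((i, w) \in conditions mu).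
Proof.
apply: (iffP allpairsPdep) => [[j [u [_ uw [-> ->]]]] //|iw].
by exists i, w; rewrite mem_enum.
Qed.

Lemma derivs_lincomb w n (x : 'I_n -> AM K 4) c :
  derivs w (lincomb (ioM K 4) x c) = \sum_k (c 0 k)%:MP * derivs w (x k).
Proof.
apply: (big_rec2 (fun f g : M4 => derivs w f = g)) => [|k f g _ <-].
  by elim: w => //= i w IH; rewrite mderiv0.
exact: derivs_klinear.
Qed.

(** On a fixed basis the conditions form a matrix whose entries are forms in the points. A maximal
    nonzero minor at [p0] stays nonzero on an open set, where the rank is at least that at [p0]. *)
Theorem multiplicities_open (P : AM K 4 -> Prop) n d (mu : 'I_r -> nat) (p0 : 'M[K]_(r, 4)) k0 :
    hasdim (ioM K 4) P n -> (forall f : M4, P f -> f \is d.-homog) -> subspace (ioM K 4) P ->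
    hasdim (ioM K 4) (fun f => P f /\ forall i, mult (mu i) (row i p0) f) k0 ->
  exists G : {mpoly K[r * 4]}, [/\ exists e, multidegree e G, G.@[mxvec p0 0] != 0 &
    forall p : 'M[K]_(r, 4), G.@[mxvec p 0] != 0 -> forall k,
      hasdim (ioM K 4) (fun f => P f /\ forall i, mult (mu i) (row i p) f) k -> (k <= k0)%N].
Proof.
move=> [x [Px ix Pspan]] Phom sP d0.
pose N := size (conditions mu).
pose cnd (l : 'I_N) := tnth (in_tuple (conditions mu)) l.
pose gmat : 'M[{mpoly K[r * 4]}]_(n, N) := \matrix_(k, l) (derivs (cnd l).2 (x k) \mPo coords K (cnd l).1).
pose cmat (p : 'M[K]_(r, 4)) : 'M[K]_(n, N) := \matrix_(k, l) (derivs (cnd l).2 (x k)).@[row (cnd l).1 p 0].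
have ker p c : c *m cmat p = 0 <-> forall i, mult (mu i) (row i p) (lincomb (ioM K 4) x c).
  have E l : (c *m cmat p) 0 l = (derivs (cnd l).2 (lincomb (ioM K 4) x c)).@[row (cnd l).1 p 0].
    rewrite mxE derivs_lincomb raddf_sum; apply: eq_bigr => k _ /=.
    by rewrite mxE mevalM mevalC.
  split=> [c0 i|H].
    apply/(mult_words charK) => w /conditionsP wi; have /(@tnthP _ _ (in_tuple (conditions mu))) [l El] := wi.
    by have := E l; rewrite c0 mxE /cnd -El.
  apply/rowP => l; rewrite E mxE; have : cnd l \in conditions mu by apply: mem_tnth.
  case: (cnd l) => i w /conditionsP wi /=.
  by have /(mult_words charK) := H i; apply.
have dker p : hasdim (ioM K 4) (fun f => P f /\ forall i, mult (mu i) (row i p) f) (n - \rank (cmat p)).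
  apply: hasdim_eq (hasdim_kernel (cmat p) ix) => f; split=> [[Pf mf]|[c /ker cm ->]].
    have [c Ec] := Pspan f Pf; exists c => //.
    by apply/ker => i; rewrite -Ec.
  by split=> //; apply: subspace_lincomb.
have [f [g fg]] := rank_minor (cmat p0).
(* The minor is transposed: its rows are conditions, each involving one point and one order of
   differentiation, so each row has a single multidegree. *)
exists (\det (\matrix_(a, b) gmat (f b) (g a))).
have ev p : (\det (\matrix_(a, b) gmat (f b) (g a))).@[mxvec p 0] = \det (\matrix_(a, b) cmat p (f b) (g a)).
  rewrite -[LHS](det_map_mx (meval (mxvec p 0))); congr (\det _).
  by apply/matrixP => a b; rewrite !mxE; apply: eval_coords.
split; last 1 first.
- move=> p; rewrite ev => /minor_rank h k dk.
  by rewrite (hasdim_uniq dk (dker p)) (hasdim_uniq d0 (dker p0)) leq_sub2l.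
- eexists; apply: multidegree_det => a b; rewrite !mxE.
  apply: multidegree_comp; apply: derivs_homog; apply: Phom; apply: Px.
- by rewrite ev.
Qed.

(** Rows not assigned to a point are frozen at their values in [N0], and the determinant is a
    polynomial in the remaining ones. *)
Theorem frame_open (rho : 'I_4 -> option 'I_r) (N0 : 'M[K]_4) (p0 : 'M[K]_(r, 4)) :
    N0 \in unitmx -> (forall a i, rho a = Some i -> row a N0 = row i p0) ->
  exists G : {mpoly K[r * 4]}, [/\ exists e, multidegree e G, G.@[mxvec p0 0] != 0 &
    forall p : 'M[K]_(r, 4), G.@[mxvec p 0] != 0 -> exists2 N : 'M[K]_4, N \in unitmx &
      forall a i, rho a = Some i -> row a N = row i p].
Proof.
move=> uN0 rN0.
pose N p : 'M[K]_4 := \matrix_(a, b) if rho a is Some i then p i b else N0 a b.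
pose gN : 'M[{mpoly K[r * 4]}]_4 :=
  \matrix_(a, b) if rho a is Some i then 'X_(mxvec_index i b) else (N0 a b)%:MP.
have ev p : (\det gN).@[mxvec p 0] = \det (N p).
  rewrite -[LHS](det_map_mx (meval (mxvec p 0))); congr (\det _).
  apply/matrixP => a b; rewrite !mxE; case: (rho a) => [i|]; last exact: mevalC.
  by rewrite /= mevalXU mxvecE.
exists (\det gN); split.
- eexists; apply: (multidegree_det (e := fun a k => if rho a is Some i then (k == i : nat) else 0%N)).
  move=> a b; rewrite mxE; case: (rho a) => [i|]; [exact: multidegreeXU | exact: multidegreeC].
- rewrite ev; have -> : N p0 = N0; last by rewrite -unitfE -unitmxE.
  apply/matrixP => a b; rewrite mxE; case E: (rho a) => [i|//].
  by have /rowP /(_ b) := rN0 a i E; rewrite !mxE.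
move=> p; rewrite ev => Np; exists (N p); first by rewrite unitmxE unitfE.
by move=> a i E; apply/rowP => b; rewrite !mxE E.
Qed.

End Openness.

(** * Quadratic forms in four variables *)

Section QuadraticForms.

Variable K : fieldType.
Hypothesis closedK : forall p : {poly K}, size p != 1%N -> exists x, root p x.
Hypothesis charK : [pchar K] =i pred0.
Local Notation M4 := {mpoly K[4]}.
Implicit Types (A D N : 'M[K]_4) (v w x y : 'rV[K]_4).
Local Notation i0 := (inord 0 : 'I_4).
Local Notation i1 := (inord 1 : 'I_4).
Local Notation i2 := (inord 2 : 'I_4).
Local Notation i3 := (inord 3 : 'I_4).

Lemma two0 : 2%:R != 0 :> K.
Proof. by rewrite ((pcharf0P K).1 charK). Qed.

Definition qform A : M4 := \sum_i \sum_j (A i j)%:MP * ('X_i * 'X_j).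

Definition bform A v w : K := (v *m A *m w^T) 0 0.

Lemma bformE A v w : bform A v w = \sum_i \sum_j A i j * (v 0 i * w 0 j).
Proof.
rewrite /bform mxE exchange_big; apply: eq_bigr => j _; rewrite !mxE mulr_suml.
by apply: eq_bigr => i _; ring.
Qed.

Lemma qform_eval A v : (qform A).@[v 0] = bform A v v.
Proof.
rewrite bformE raddf_sum; apply: eq_bigr => i _; rewrite raddf_sum; apply: eq_bigr => j _ /=.
by rewrite !mevalM mevalC !mevalXU.
Qed.

Lemma qform_repr f : f \is 2.-homog -> exists2 A, A^T = A & f = qform A.
Proof.
move=> fd; rewrite (mpolyE f) big_seq.
elim/big_rec: _ => [|a g /(dhomog_mf fd) /= ad [A sA ->]].
  exists 0; first exact: trmx0.
  by rewrite /qform big1 // => i _; rewrite big1 // => j _; rewrite mxE mpolyC0 mul0r.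
have [k ak] : exists k, (0 < a k)%N.
  apply: NNPP => H; have : mdeg a = 0%N.
    rewrite mdegE big1 // => i _; apply/eqP; rewrite -leqn0 leqNgt; apply/negP => ai.
    by apply: H; exists i.
  by rewrite ad.
have Ea : a = (a - U_(k) + U_(k))%MM.
  rewrite submK //; apply/mnm_lepP => i; rewrite mnm1E; case: eqP => // <-.
  exact: ak.
have d1 : mdeg (a - U_(k))%MM == 1%N.
  by have := ad; rewrite {1}Ea mdegD mdeg1 => /eqP; rewrite addn1 eqSS.
have [l El] : exists l, (a - U_(k))%MM = U_(l)%MM.
  by move: d1; rewrite mdeg_eq1 => /existsP [l /eqP ->]; exists l.
pose c := f@_a * 2%:R^-1.
exists (c *: (delta_mx k l + delta_mx l k) + A).
  by rewrite raddfD /= sA linearZ /= raddfD /= !trmx_delta [delta_mx l k + _]addrC.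
have E (B B' : 'M[K]_4) : qform (B + B') = qform B + qform B'.
  rewrite -big_split; apply: eq_bigr => i _; rewrite -big_split; apply: eq_bigr => j _ /=.
  by rewrite mxE mpolyCD mulrDl.
have EZ u (B : 'M[K]_4) : qform (u *: B) = u%:MP * qform B.
  rewrite mulr_sumr; apply: eq_bigr => i _; rewrite mulr_sumr; apply: eq_bigr => j _ /=.
  by rewrite mxE mpolyCM -mulrA.
have Ed (i j : 'I_4) : qform (delta_mx i j) = 'X_i * 'X_j.
  rewrite /qform (bigD1 i) //= [X in _ + X]big1 ?addr0 => [|u ui]; last first.
    by rewrite big1 // => s _; rewrite mxE (negbTE ui) mpolyC0 mul0r.
  rewrite (bigD1 j) //= [X in _ + X]big1 ?addr0 => [|u ui]; first by rewrite mxE !eqxx mpolyC1 mul1r.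
  by rewrite mxE (negbTE ui) andbF mpolyC0 mul0r.
rewrite E EZ E !Ed; congr (_ + _).
have -> : 'X_[a] = 'X_l * 'X_k :> M4 by rewrite {1}Ea El mpolyXD.
have cc : (f@_a)%:MP = c%:MP + c%:MP :> M4.
  by rewrite -mpolyCD; congr (_%:MP); rewrite /c; field; apply: two0.
by rewrite -mul_mpolyC cc; ring.
Qed.

Lemma bformDl A v v' w : bform A (v + v') w = bform A v w + bform A v' w.
Proof. by rewrite /bform !mulmxDl mxE. Qed.

Lemma bformDr A v w w' : bform A v (w + w') = bform A v w + bform A v w'.
Proof. by rewrite /bform raddfD /= mulmxDr mxE. Qed.

Lemma bformZl A c v w : bform A (c *: v) w = c * bform A v w.
Proof. by rewrite /bform -!scalemxAl mxE. Qed.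

Lemma bformZr A c v w : bform A v (c *: w) = c * bform A v w.
Proof. by rewrite /bform linearZ /= -scalemxAr mxE. Qed.

Lemma bformC A v w : A^T = A -> bform A v w = bform A w v.
Proof.
move=> sA; rewrite !bformE exchange_big; apply: eq_bigr => i _; apply: eq_bigr => j _ /=.
by rewrite -{1}sA mxE [v 0 j * _]mulrC.
Qed.

Lemma lsub_qform N A : lsub N (qform A) = qform (N *m A *m N^T).
Proof.
rewrite raddf_sum /=.
transitivity (\sum_i \sum_j (A i j)%:MP * (linear_form N i * linear_form N j) : M4).
  apply: eq_bigr => i _; rewrite raddf_sum; apply: eq_bigr => j _ /=.
  by rewrite !rmorphM /= lsubC !lsubX.
transitivity (\sum_i \sum_j \sum_k \sum_l (N k i * A i j * N l j)%:MP * ('X_k * 'X_l) : M4).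
  apply: eq_bigr => i _; apply: eq_bigr => j _; rewrite /linear_form mulr_suml mulr_sumr.
  apply: eq_bigr => k _; rewrite mulr_sumr mulr_sumr; apply: eq_bigr => l _.
  by rewrite !mpolyCM; ring.
under eq_bigr do rewrite exchange_big /=.
rewrite exchange_big /=; apply: eq_bigr => k _.
under eq_bigr do rewrite exchange_big /=.
rewrite exchange_big /=; apply: eq_bigr => l _.
rewrite !mxE rmorph_sum mulr_suml exchange_big /=; apply: eq_bigr => j _.
by rewrite !mxE mulr_suml rmorph_sum mulr_suml.
Qed.

Lemma qform_deriv A v j : A^T = A -> ((qform A)^`M(j)).@[v 0] = 2%:R * (v *m A) 0 j.
Proof.
move=> sA; rewrite /qform [X in X.@[_]]raddf_sum raddf_sum /=.
have E i k : (((A i k)%:MP * ('X_i * 'X_k))^`M(j)).@[v 0] =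
    A i k * ((i == j)%:R * v 0 k + v 0 i * (k == j)%:R).
  by rewrite mderivM mderivC mul0r add0r mderivM !mderivXU mevalM mevalD !mevalM !mevalC !mevalXU.
transitivity (\sum_i ((i == j)%:R * (\sum_k A i k * v 0 k) + v 0 i * A i j)).
  apply: eq_bigr => i _; rewrite [X in X.@[_]]raddf_sum raddf_sum /=.
  under eq_bigr do rewrite E mulrDr.
  rewrite big_split; congr (_ + _).
    by rewrite mulr_sumr; apply: eq_bigr => k _; ring.
  rewrite (bigD1 j) //= eqxx big1 ?addr0 => [|k kj]; first by rewrite mulr1 mulrC.
  by rewrite (negbTE kj) !mulr0.
rewrite big_split (bigD1 j) //= eqxx mul1r [X in _ + X + _]big1 ?addr0 => [|i ij]; last first.
  by rewrite (negbTE ij) mul0r.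
have -> : \sum_k A j k * v 0 k = (v *m A) 0 j.
  by rewrite mxE; apply: eq_bigr => k _; rewrite -{1}sA mxE mulrC.
have -> : \sum_i v 0 i * A i j = (v *m A) 0 j by rewrite mxE.
by ring.
Qed.

Lemma binary_root a b c : exists x y : K, (x, y) != (0, 0) /\ a * x ^+ 2 + b * x * y + c * y ^+ 2 = 0.
Proof.
have [a0|a0] := eqVneq a 0.
  exists 1, 0; split; last by rewrite a0; ring.
  by rewrite xpair_eqE oner_eq0.
have [|x] := closedK (p := Poly [:: c; b; a]).
  by rewrite (@PolyK _ 0) //= .
rewrite /root horner_Poly /= => /eqP Ex; exists x, 1; split; last by rewrite -[RHS]Ex; ring.
by rewrite xpair_eqE oner_eq0 andbF.
Qed.

Lemma kernel_vector n (M : 'M[K]_(4, n)) : (n < 4)%N -> exists2 v : 'rV[K]_4, v != 0 & v *m M = 0.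
Proof.
move=> n4; have [v vM v0] : exists2 v : 'rV[K]_4, (v <= kermx M)%MS & v != 0.
  apply/rowV0Pn; rewrite -mxrank_eq0 mxrank_ker -lt0n subn_gt0.
  exact: leq_ltn_trans (rank_leq_col _) n4.
by exists v => //; apply/eqP; rewrite -sub_kermx.
Qed.

(** The kernel of [M] has dimension at least two; on x and a vector y orthogonal to it, the form is
    a diagonal binary form and has a zero. *)
Lemma isotropic_vector n (M : 'M[K]_(4, n)) A : A^T = A -> (n < 3)%N ->
  exists v : 'rV[K]_4, [/\ v != 0, v *m M = 0 & bform A v v = 0].
Proof.
move=> sA n3; have [x x0 xM] := kernel_vector M (ltnW n3).
have n14 : (n + 1 < 4)%N by rewrite addn1.
have [y y0] := kernel_vector (row_mx M (A *m x^T)) n14.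
rewrite mul_mx_row => /eqP; rewrite row_mx_eq0 => /andP [/eqP yM /eqP yx].
have [qx|qx] := eqVneq (bform A x x) 0; first by exists x.
have [a [b [ab Eab]]] := binary_root (bform A x x) 0 (bform A y y).
have byx : bform A y x = 0 by rewrite /bform -mulmxA yx mxE.
exists (a *: x + b *: y); split.
- apply: contraNneq ab => E.
  have : bform A (a *: x + b *: y) x = 0 by rewrite E /bform !mul0mx mxE.
  rewrite bformDl !bformZl byx mulr0 addr0 => /eqP; rewrite mulf_eq0 (negbTE qx) orbF => /eqP a0.
  by move/eqP: E; rewrite a0 scale0r add0r scaler_eq0 (negbTE y0) orbF => /eqP ->.
- by rewrite mulmxDl -!scalemxAl xM yM !scaler0 addr0.
- rewrite !(bformDl, bformDr, bformZl, bformZr) (bformC x y sA) byx.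
  by rewrite -[RHS]Eab; ring.
Qed.

Definition row4 (a b c e : K) : 'rV[K]_4 := \row_j nth 0 [:: a; b; c; e] j.

Lemma row4E a b c e : let v := row4 a b c e in
  [/\ v 0 i0 = a, v 0 i1 = b, v 0 i2 = c & v 0 i3 = e] :> Prop.
Proof. by split; rewrite mxE inordK. Qed.

Definition onehalf : K := 2%:R^-1.

Lemma onehalfD : onehalf + onehalf = 1.
Proof. by rewrite /onehalf; field; apply: two0. Qed.

Definition Jmat : 'M[K]_4 := \matrix_(i, j)
  nth 0 (nth [::] [:: [:: 0; 0; 0; onehalf]; [:: 0; 0; - onehalf; 0]; [:: 0; - onehalf; 0; 0]; [:: onehalf; 0; 0; 0]] i) j.

Lemma bformJ v w : bform Jmat v w =
  onehalf * (v 0 i0 * w 0 i3 + v 0 i3 * w 0 i0 - v 0 i1 * w 0 i2 - v 0 i2 * w 0 i1).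
Proof. by rewrite bformE !big_ord4 /= !mxE !inordK //=; ring. Qed.

Lemma qform_Jmat : qform Jmat = quadric0 K.
Proof.
rewrite /qform !big_ord4 /= !mxE !inordK //= !mpolyC0 !mul0r !add0r !addr0 mpolyCN.
have H : onehalf%:MP + onehalf%:MP = 1 :> M4 by rewrite -mpolyCD onehalfD mpolyC1.
transitivity ((onehalf%:MP + onehalf%:MP) * ('X_i0 * 'X_i3) - (onehalf%:MP + onehalf%:MP) * ('X_i1 * 'X_i2) : M4).
  by ring.
by rewrite H !mul1r.
Qed.

Lemma mulJ v : v *m Jmat = row4 (onehalf * v 0 i3) (- (onehalf * v 0 i2)) (- (onehalf * v 0 i1)) (onehalf * v 0 i0).
Proof.
apply/rowP => j; rewrite !mxE big_ord4 /= !mxE.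
by have [->|[->|[->|->]]] := ord4_cases j; rewrite !inordK //=; ring.
Qed.

Lemma Jmat_unit : Jmat \in unitmx.
Proof.
rewrite -row_free_unit; apply: inj_row_free => v; rewrite mulJ => E.
have h0 : onehalf != 0 by rewrite invr_eq0 two0.
have [e0 e1 e2 e3] := row4E (onehalf * v 0 i3) (- (onehalf * v 0 i2)) (- (onehalf * v 0 i1)) (onehalf * v 0 i0).
rewrite E !mxE in e0 e1 e2 e3.
have Z (c : K) : 0 = onehalf * c -> c = 0 by move/esym/eqP; rewrite mulf_eq0 (negbTE h0) => /eqP.
apply/rowP => j; rewrite mxE; have [->|[->|[->|->]]] := ord4_cases j; apply: Z => //;
  by apply: oppr_inj; rewrite oppr0.
Qed.

Lemma gram_entry N A i j : (N *m A *m N^T) i j = bform A (row i N) (row j N).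
Proof.
rewrite /bform -row_mul tr_row !mxE; apply: eq_bigr => k _; by rewrite !mxE.
Qed.

(** Two hyperbolic planes are split off: an isotropic vector, a partner corrected to be isotropic,
    and the same again in the orthogonal complement. *)
Lemma hyperbolic_basis A : A^T = A -> A \in unitmx -> exists N, N *m A *m N^T = Jmat.
Proof.
move=> sA uA; have pair v : v != 0 -> forall c, exists w, bform A v w = c.
  move=> v0 c; have vA0 : v *m A != 0.
    by apply: contraNneq v0 => E; rewrite -(mulmxK uA v) E mul0mx.
  have [j vj] : exists j, (v *m A) 0 j != 0.
    apply: NNPP => H; case/eqP: vA0; apply/rowP => j; rewrite [RHS]mxE.
    by case: (eqVneq ((v *m A) 0 j) 0) => // vj; case: H; exists j.
  exists ((c / (v *m A) 0 j) *: delta_mx 0 j).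
  have E : bform A v (delta_mx 0 j) = (v *m A) 0 j by rewrite /bform trmx_delta -colE [LHS]mxE.
  by rewrite bformZr E divfK.
have [e0 [e00 _ q0]] := isotropic_vector (0 : 'M_(4, 0)) sA isT.
have [w Ew] := pair e0 e00 onehalf.
(* Adding this multiple of e0 kills the value at w, because the pairing with e0 is one half. *)
pose f0 := w + (- bform A w w) *: e0.
have e0f0 : bform A e0 f0 = onehalf by rewrite bformDr bformZr q0 mulr0 addr0.
have f0f0 : bform A f0 f0 = 0.
  rewrite !(bformDl, bformDr, bformZl, bformZr) q0 (bformC w e0 sA) Ew.
  transitivity (bform A w w * (1 - (onehalf + onehalf))); first by ring.
  by rewrite onehalfD subrr mulr0.
clearbody f0.
have [e1 [e10 eM q1]] := isotropic_vector (row_mx (A *m e0^T) (A *m f0^T)) sA isT.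
have [e1e0 e1f0] : bform A e1 e0 = 0 /\ bform A e1 f0 = 0.
  move: eM; rewrite mul_mx_row => /eqP; rewrite row_mx_eq0 => /andP [/eqP h1 /eqP h2].
  by rewrite /bform -!mulmxA h1 h2 mxE.
have [u Eu] := pair e1 e10 (- onehalf).
(* The projection of u to the orthogonal complement of the plane of e0 and f0. *)
pose u' := u + (- (2%:R * bform A u f0)) *: e0 + (- (2%:R * bform A u e0)) *: f0.
have f0e0 : bform A f0 e0 = onehalf by rewrite bformC.
have u'e0 : bform A u' e0 = 0.
  rewrite !bformDl !bformZl q0 f0e0.
  transitivity (bform A u e0 * (1 - (onehalf + onehalf))); first by ring.
  by rewrite onehalfD subrr mulr0.
have u'f0 : bform A u' f0 = 0.
  rewrite !bformDl !bformZl f0f0 e0f0.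
  transitivity (bform A u f0 * (1 - (onehalf + onehalf))); first by ring.
  by rewrite onehalfD subrr mulr0.
have e1u' : bform A e1 u' = - onehalf.
  by rewrite !bformDr !bformZr e1e0 e1f0 Eu; ring.
clearbody u'; pose f1 := u' + bform A u' u' *: e1.
have f1e0 : bform A f1 e0 = 0 by rewrite bformDl bformZl u'e0 e1e0; ring.
have f1f0 : bform A f1 f0 = 0 by rewrite bformDl bformZl u'f0 e1f0; ring.
have e1f1 : bform A e1 f1 = - onehalf by rewrite bformDr bformZr e1u' q1; ring.
have f1f1 : bform A f1 f1 = 0.
  rewrite !(bformDl, bformDr, bformZl, bformZr) q1 (bformC u' e1 sA) e1u'.
  transitivity (bform A u' u' * (1 - (onehalf + onehalf))); first by ring.
  by rewrite onehalfD subrr mulr0.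
exists (\matrix_i nth 0 [:: e0; e1; f1; f0] i).
apply/matrixP => i j; rewrite gram_entry !rowK.
have [->|[->|[->|->]]] := ord4_cases i; have [->|[->|[->|->]]] := ord4_cases j;
  by rewrite mxE !inordK //= // bformC.
Qed.

(** In the chart f = 1 the difference of both sides is a polynomial in h; if it is a nonzero
    constant, its coefficient of h^4 vanishes and (0 : 1) is a root. *)
Lemma quartic_root (a0 a1 a2 b0 b1 b2 c0 c1 c2 : K) : exists f h : K, (f, h) != (0, 0) /\
  (a0 * f ^+ 2 + a1 * f * h + a2 * h ^+ 2) * (c0 * f ^+ 2 + c1 * f * h + c2 * h ^+ 2)
  = (b0 * f ^+ 2 + b1 * f * h + b2 * h ^+ 2) ^+ 2.
Proof.
pose Q (x y z : K) : {poly K} := x%:P + y%:P * 'X + z%:P * 'X^2.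
pose P := Q a0 a1 a2 * Q c0 c1 c2 - Q b0 b1 b2 ^+ 2.
have [/eqP P1|/closedK [h]] := boolP (size P == 1%N); last first.
  have E (x y z : K) : (Q x y z).[h] = x + y * h + z * h ^+ 2.
    by rewrite /Q !(hornerD, hornerM, hornerXn, hornerX, hornerC).
  rewrite /root /P hornerD hornerN hornerM horner_exp !E subr_eq0 => /eqP H.
  exists 1, h; split; first by rewrite xpair_eqE oner_eq0.
  by rewrite !expr1n !mulr1 H.
have P4 : P`_4 = a2 * c2 - b2 ^+ 2.
  have -> : P = (a2 * c2 - b2 ^+ 2)%:P * 'X^4 + (a1 * c2 + a2 * c1 - 2%:R * b1 * b2)%:P * 'X^3 +
     (a0 * c2 + a1 * c1 + a2 * c0 - 2%:R * b0 * b2 - b1 ^+ 2)%:P * 'X^2 +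
     (a0 * c1 + a1 * c0 - 2%:R * b0 * b1)%:P * 'X + (a0 * c0 - b0 ^+ 2)%:P.
    by rewrite /P /Q !(polyCD, polyCM, polyCN, rmorphXn, polyC_natr) /=; ring.
  by rewrite !coefD !coefCM !coefXn !coefX !coefC /= !mulr0 !addr0 mulr1.
exists 0, 1; split; first by rewrite xpair_eqE oner_eq0 andbF.
have : P`_4 = 0 by rewrite nth_default // P1.
rewrite P4 => /eqP; rewrite subr_eq0 => /eqP H.
by rewrite expr1n expr0n /= !mulr0 !mul0r !mulr1 !add0r H.
Qed.

Lemma singular_form (a b c : K) : a * c = b ^+ 2 ->
  exists x y : K, [/\ (x, y) != (0, 0), a * x + b * y = 0 & b * x + c * y = 0].
Proof.
move=> H; have [/eqP|ab] := eqVneq (a, b) (0, 0).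
  rewrite xpair_eqE => /andP [/eqP -> /eqP ->]; exists 1, 0.
  by split; rewrite ?xpair_eqE ?oner_eq0 // ?mul0r ?mulr0 addr0.
exists b, (- a); split; [|by ring|by rewrite -expr2 -H; ring].
by rewrite xpair_eqE oppr_eq0 andbC -xpair_eqE.
Qed.

Lemma unimodular_completion (x y : K) : (x, y) != (0, 0) -> exists z w : K, z * y - w * x = 1.
Proof.
rewrite xpair_eqE negb_and; have [->|y0 _] := eqVneq y 0.
  by rewrite orbF => x0; exists 0, (- x^-1); field.
by exists y^-1, 0; field.
Qed.

End QuadraticForms.

(** * Normal form of the pair of quadrics and smoothness *)

Section NormalForm.

Variable K : fieldType.
Hypothesis closedK : forall p : {poly K}, size p != 1%N -> exists x, root p x.
Hypothesis charK : [pchar K] =i pred0.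
Local Notation M4 := {mpoly K[4]}.
Implicit Types (A D N : 'M[K]_4) (v w : 'rV[K]_4).
Local Notation i0 := (inord 0 : 'I_4).
Local Notation i1 := (inord 1 : 'I_4).
Local Notation i2 := (inord 2 : 'I_4).
Local Notation i3 := (inord 3 : 'I_4).
Local Notation J := (Jmat K).

(** The Jacobian criterion in the form in which it is contradicted below: at no common point is the
    gradient of [D] a multiple of that of [A]. *)
Definition smooth_pencil A D := forall v, v != 0 -> bform A v v = 0 -> bform D v v = 0 ->
  forall a b, a *: (v *m A) + b *: (v *m D) = 0 -> b = 0.

Lemma smooth_pencil_change N A D : N \in unitmx -> smooth_pencil A D ->
  smooth_pencil (N *m A *m N^T) (N *m D *m N^T).
Proof.
move=> uN H v v0 vA vD a b E.
have bE B : bform (N *m B *m N^T) v v = bform B (v *m N) (v *m N).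
  by rewrite /bform trmx_mul !mulmxA.
apply: (H (v *m N) _ _ _ a b); rewrite -?bE //.
  by apply: contraNneq v0 => vN; rewrite -(mulmxK uN v) vN mul0mx.
have uT : N^T \in unitmx by rewrite unitmx_tr.
rewrite -(mulmxK uT (_ + _)) mulmxDl -!scalemxAl.
by rewrite !mulmxA in E *; rewrite E mul0mx.
Qed.

Lemma bformD4 D v w : D^T = D -> bform D v w =
   D i0 i0 * (v 0 i0 * w 0 i0) + D i1 i1 * (v 0 i1 * w 0 i1) + D i2 i2 * (v 0 i2 * w 0 i2)
   + D i3 i3 * (v 0 i3 * w 0 i3)
   + D i0 i1 * (v 0 i0 * w 0 i1 + v 0 i1 * w 0 i0) + D i0 i2 * (v 0 i0 * w 0 i2 + v 0 i2 * w 0 i0)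
   + D i0 i3 * (v 0 i0 * w 0 i3 + v 0 i3 * w 0 i0) + D i1 i2 * (v 0 i1 * w 0 i2 + v 0 i2 * w 0 i1)
   + D i1 i3 * (v 0 i1 * w 0 i3 + v 0 i3 * w 0 i1) + D i2 i3 * (v 0 i2 * w 0 i3 + v 0 i3 * w 0 i2).
Proof.
move=> sD; have s i j : D j i = D i j by rewrite -{1}sD mxE.
rewrite bformE !big_ord4 /= (s i0 i1) (s i0 i2) (s i0 i3) (s i1 i2) (s i1 i3) (s i2 i3); ring.
Qed.

Lemma mulD4 D v : v *m D = row4 (v 0 i0 * D i0 i0 + v 0 i1 * D i1 i0 + v 0 i2 * D i2 i0 + v 0 i3 * D i3 i0)
  (v 0 i0 * D i0 i1 + v 0 i1 * D i1 i1 + v 0 i2 * D i2 i1 + v 0 i3 * D i3 i1)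
  (v 0 i0 * D i0 i2 + v 0 i1 * D i1 i2 + v 0 i2 * D i2 i2 + v 0 i3 * D i3 i2)
  (v 0 i0 * D i0 i3 + v 0 i1 * D i1 i3 + v 0 i2 * D i2 i3 + v 0 i3 * D i3 i3).
Proof.
apply/rowP => j; rewrite !mxE big_ord4 /=.
by have [->|[->|[->|->]]] := ord4_cases j; rewrite !inordK //= !addrA.
Qed.

Lemma row4Z a (x y z t : K) : a *: row4 x y z t = row4 (a * x) (a * y) (a * z) (a * t).
Proof.
by apply/rowP => j; rewrite !mxE; have [->|[->|[->|->]]] := ord4_cases j; rewrite inordK.
Qed.

Lemma row40 : row4 0 0 0 0 = 0 :> 'rV[K]_4.
Proof.
by apply/rowP => j; rewrite !mxE; have [->|[->|[->|->]]] := ord4_cases j; rewrite inordK.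
Qed.

Lemma row4_neq0 (x y z t : K) : (row4 x y z t == 0) = [&& x == 0, y == 0, z == 0 & t == 0].
Proof.
apply/eqP/and4P => [E|[/eqP -> /eqP -> /eqP -> /eqP ->]]; last exact: row40.
have [e0 e1 e2 e3] := row4E x y z t; rewrite E !mxE in e0 e1 e2 e3.
by rewrite -e0 -e1 -e2 -e3 eqxx.
Qed.

(* [f, h] is chosen so that the line P^1 x (f : h) is tangent to the second quadric, at ((x : y), (f : h)). *)
Lemma tangent_frame D : D^T = D -> exists N, [/\ N *m J *m N^T = J,
  (N *m D *m N^T) i3 i3 = 0 & (N *m D *m N^T) i2 i3 = 0].
Proof.
move=> sD.
have [f [h [fh Efh]]] := quartic_root closedK (D i0 i0) (2%:R * D i0 i2) (D i2 i2)
   (D i0 i1) (D i0 i3 + D i1 i2) (D i2 i3) (D i1 i1) (2%:R * D i1 i3) (D i3 i3).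
have [x [y [xy E1 E2]]] := singular_form Efh.
have [z [w zw]] := unimodular_completion xy.
have [k [l kl]] := unimodular_completion fh.
(* Tensor products of two bases of determinant one, so that [J] is preserved. The vector (x, y)
   spans the kernel of the binary form which the second quadric induces on the ruling (f : h); this
   makes the two entries vanish. *)
pose n := [:: row4 (z * k) (w * k) (z * l) (w * l); row4 (x * k) (y * k) (x * l) (y * l);
              row4 (z * f) (w * f) (z * h) (w * h); row4 (x * f) (y * f) (x * h) (y * h)].
exists (\matrix_i nth 0 n i).
have pE (a b c e a' b' c' e' : K) := (row4E a b c e, row4E a' b' c' e').
split.
- apply/matrixP => i j; rewrite gram_entry !rowK.
  have unit_det : (z * y - w * x) * (k * h - l * f) = 1 by rewrite zw kl mulr1.
  have [->|[->|[->|->]]] := ord4_cases i; have [->|[->|[->|->]]] := ord4_cases j;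
    rewrite !inordK //= bformJ ![row4 _ _ _ _ 0 _]mxE [RHS]mxE !inordK //=; first [by ring |
      rewrite -[RHS]mulr1 -unit_det; by ring].
- rewrite gram_entry !rowK inordK //= bformD4 // ![row4 _ _ _ _ 0 _]mxE !inordK //=.
  rewrite -[RHS](_ : x * 0 + y * 0 = 0); last by ring.
  by rewrite -{1}E1 -E2; ring.
- rewrite gram_entry !rowK !inordK //= bformD4 // ![row4 _ _ _ _ 0 _]mxE !inordK //=.
  rewrite -[RHS](_ : z * 0 + w * 0 = 0); last by ring.
  by rewrite -{1}E1 -E2; ring.
Qed.

Section Ramified.

Variable D : 'M[K]_4.
Hypothesis sD : D^T = D.
Hypothesis smD : smooth_pencil J D.
Hypothesis D33 : D i3 i3 = 0.
Hypothesis D23 : D i2 i3 = 0.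

Let s i j : D j i = D i j. Proof. by rewrite -{1}sD mxE. Qed.

Let contact (v : 'rV[K]_4) c : v != 0 -> bform J v v = 0 -> bform D v v = 0 ->
  v *m D = c *: (v *m J) -> False.
Proof.
move=> v0 vJ vD E; have H : (- c) *: (v *m J) + 1 *: (v *m D) = 0.
  by rewrite E scale1r scaleNr addNr.
by have /eqP := smD v0 vJ vD H; rewrite oner_eq0.
Qed.

(** Otherwise the gradient of [D] at (0:0:0:1) has only its coordinate of index 0, like that of [J],
    and the two quadrics are tangent there. *)
Lemma ramified_cross_neq0 : D i1 i3 != 0.
Proof.
apply/eqP => D13; have [e0 e1 e2 e3] := row4E 0 0 0 (1 : K).
apply: (@contact (row4 0 0 0 1) (D i0 i3 * 2%:R)).
- by rewrite row4_neq0 oner_eq0 !andbF.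
- by rewrite bformJ e0 e1 e2 e3; ring.
- by rewrite bformD4 // e0 e1 e2 e3 D33; ring.
- rewrite mulJ mulD4 row4Z e0 e1 e2 e3 D33 (s i0 i3) (s i1 i3) (s i2 i3) D13 D23.
  by congr row4; rewrite /onehalf; field; apply: two0.
Qed.

(** Otherwise the line x0 = x1 = 0 lies on both quadrics. Along it, proportionality of the gradients
    is a binary quadratic equation in (x : y), whose root is a singular point of the
    intersection. *)
Lemma ramified_lead_neq0 : D i2 i2 != 0.
Proof.
apply/eqP => D22.
have [x [y [xy E]]] := binary_root closedK (D i0 i2) (D i0 i3 + D i1 i2) (D i1 i3).
have [e0 e1 e2 e3] := row4E 0 0 x y.
have [c [Ec1 Ec2]] : exists c, x * D i0 i2 + y * D i0 i3 = c * (onehalf K * y) /\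
    x * D i1 i2 + y * D i1 i3 = c * (- (onehalf K * x)).
  have t0 := two0 charK.
  have [y0|y0] := eqVneq y 0.
    move: xy E; rewrite y0 xpair_eqE eqxx andbT => x0 E.
    have D02 : D i0 i2 = 0.
      apply/eqP; have /eqP : D i0 i2 * x ^+ 2 = 0 by rewrite -[RHS]E; ring.
      by rewrite mulf_eq0 expf_eq0 (negbTE x0) andbF orbF.
    by exists (- (2%:R * D i1 i2)); rewrite D02; split; rewrite /onehalf; field.
  exists (2%:R * (x * D i0 i2 + y * D i0 i3) / y); split; first by rewrite /onehalf; field; rewrite ?t0 ?y0.
  apply: (mulfI y0); have Ey : y * (x * D i1 i2 + y * D i1 i3) = - (x * (x * D i0 i2 + y * D i0 i3)).
    by apply/eqP; rewrite -addr_eq0; apply/eqP; rewrite -[RHS]E; ring.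
  by rewrite Ey /onehalf; field; rewrite ?t0 ?y0.
apply: (@contact (row4 0 0 x y) c).
- by move: xy; rewrite row4_neq0 xpair_eqE !eqxx.
- by rewrite bformJ e0 e1 e2 e3; ring.
- by rewrite bformD4 // e0 e1 e2 e3 D33 D23 D22; ring.
- rewrite mulJ mulD4 row4Z e0 e1 e2 e3 D33 D22 (s i2 i3) (s i0 i2) (s i0 i3) (s i1 i2) (s i1 i3) D23.
  by rewrite !mul0r !add0r Ec1 Ec2; congr row4; ring.
Qed.

Let a := D i2 i2.
(** In the equation on Q, the coefficient of u^2 is D_22 + 2 D_23 s + D_33 s^2, reduced to the
    constant D_22 by ramification; dividing by it gives a monic equation. *)
Definition fibreB : {poly K} := a^-1%:P *
  ((2%:R * D i0 i2)%:P + (2%:R * (D i0 i3 + D i1 i2))%:P * 'X + (2%:R * D i1 i3)%:P * 'X^2).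
Definition fibreC : {poly K} := a^-1%:P *
  ((D i0 i0)%:P + (2%:R * D i0 i1)%:P * 'X + (D i1 i1)%:P * 'X^2).

Lemma rho_qform : rho (qform D) = io2 K a * curve fibreB fibreC.
Proof.
have E : rho (qform D) = \sum_i \sum_j io2 K (D i j) * (segre K i * segre K j).
  rewrite /qform raddf_sum; apply: eq_bigr => i _; rewrite raddf_sum; apply: eq_bigr => j _ /=.
  by rewrite !rmorphM /= rhoC /rho !mevX.
rewrite E !big_ord4 /= /segre !inordK //= D33 (s i0 i1) (s i0 i2) (s i0 i3) (s i1 i2) (s i1 i3) (s i2 i3) D23.
have aa : io2 K a * (a^-1%:P)%:P = 1.
  by rewrite /io2 /= /polyC2 /= -polyCM -polyCM mulfV ?polyC1 // ramified_lead_neq0.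
have -> : io2 K a * curve fibreB fibreC = io2 K a * 'X^2 + (io2 K a * (a^-1%:P)%:P) *
  (((2%:R * D i0 i2)%:P + (2%:R * (D i0 i3 + D i1 i2))%:P * 'X + (2%:R * D i1 i3)%:P * 'X^2)%:P * 'X +
   ((D i0 i0)%:P + (2%:R * D i0 i1)%:P * 'X + (D i1 i1)%:P * 'X^2)%:P).
  by rewrite /curve /fibreB /fibreC !polyCM; ring.
rewrite aa mul1r /io2 /= /polyC2 /= -/a ?polyC0.
by rewrite !(polyCD, polyCM, rmorphXn, polyC1) /=; ring.
Qed.

Lemma size_fibreB : size fibreB = 3%N.
Proof.
rewrite /fibreB mul_polyC size_scale; last by rewrite invr_eq0 ramified_lead_neq0.
have -> : (2%:R * D i0 i2)%:P + (2%:R * (D i0 i3 + D i1 i2))%:P * 'X + (2%:R * D i1 i3)%:P * 'X^2 =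
  Poly [:: 2%:R * D i0 i2; 2%:R * (D i0 i3 + D i1 i2); 2%:R * D i1 i3] :> {poly K}.
  by rewrite /= !cons_poly_def mul0r add0r; ring.
by rewrite (@PolyK _ 0) //= mulf_neq0 ?ramified_cross_neq0 ?two0.
Qed.

Lemma size_fibreC : (size fibreC <= 3)%N.
Proof.
rewrite /fibreC mul_polyC (leq_trans (size_scale_leq _ _)) //.
have -> : (D i0 i0)%:P + (2%:R * D i0 i1)%:P * 'X + (D i1 i1)%:P * 'X^2 =
  Poly [:: D i0 i0; 2%:R * D i0 i1; D i1 i1] :> {poly K}.
  by rewrite /= !cons_poly_def mul0r add0r; ring.
exact: size_Poly.
Qed.

(** A square of degree 4 would have a double root [al], and the curve would be singular at the
    double point of the fibre s = al. *)
Lemma fibre_discr_nsq e : fibreB ^+ 2 - 4%:R * fibreC <> e ^+ 2.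
Proof.
move=> E; have t0 := two0 charK.
have B0 : fibreB != 0 by rewrite -size_poly_eq0 size_fibreB.
have sB2 : size (fibreB ^+ 2) = 5%N by rewrite expr2 size_mul // size_fibreB.
have sz : size (e ^+ 2) = 5%N.
  rewrite -E size_polyDl // sB2 size_polyN -polyC_natr mul_polyC.
  by rewrite (leq_ltn_trans (size_scale_leq _ _)) // (leq_ltn_trans size_fibreC).
have [|al] := closedK (p := e).
  apply/eqP => e1; have en0 : e != 0 by rewrite -size_poly_eq0 e1.
  by move: sz; rewrite expr2 size_mul // e1.
rewrite /root => /eqP eal.
have h4 p : (4%:R * p).[al] = 4%:R * p.[al] by rewrite !mulr_natl hornerMn.
have E1 : fibreB.[al] ^+ 2 - 4%:R * fibreC.[al] = 0.
  have := congr1 (fun p : {poly K} => p.[al]) E.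
  by rewrite /= hornerD hornerN h4 !horner_exp eal expr0n.
have E2 : 2%:R * fibreB.[al] * fibreB^`().[al] - 4%:R * fibreC^`().[al] = 0.
  have := congr1 (fun p : {poly K} => p^`().[al]) E.
  have d4 : (4%:R * fibreC)^`() = 4%:R * fibreC^`() by rewrite !mulr_natl derivMn.
  rewrite /= derivB d4 !expr2 !derivM.
  by rewrite hornerD hornerN h4 !(hornerD, hornerM) eal mul0r mulr0 addr0 => <-; ring.
(* The double root of the fibre equation over s = al. *)
pose u := - (fibreB.[al] / 2%:R).
have a0 : a != 0 := ramified_lead_neq0.
have Bu : fibreB.[al] = - (2%:R * u) by rewrite /u; field.
clearbody u.
have f4 : 4%:R != 0 :> K by rewrite (natrM _ 2 2) mulf_neq0.
have Cu : fibreC.[al] = u ^+ 2.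
  apply: (mulfI f4); have := E1; rewrite Bu => /eqP; rewrite subr_eq0 => /eqP <-; ring.
have Du : u * fibreB^`().[al] + fibreC^`().[al] = 0.
  apply/eqP; rewrite -(mulrI_eq0 _ (mulfI f4)) -oppr_eq0; apply/eqP; rewrite -[RHS]E2 Bu; ring.
have hB : a * fibreB.[al] = 2%:R * (D i0 i2 + (D i0 i3 + D i1 i2) * al + D i1 i3 * al ^+ 2).
  by rewrite /fibreB !(hornerD, hornerM, hornerXn, hornerX, hornerC); field.
have hC : a * fibreC.[al] = D i0 i0 + 2%:R * D i0 i1 * al + D i1 i1 * al ^+ 2.
  by rewrite /fibreC !(hornerD, hornerM, hornerXn, hornerX, hornerC); field.
have hB' : a * fibreB^`().[al] = 2%:R * (D i0 i3 + D i1 i2 + 2%:R * D i1 i3 * al).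
  by rewrite /fibreB !(derivD, derivM, derivC, derivXn, derivX) !hornerE /=; field.
have hC' : a * fibreC^`().[al] = 2%:R * (D i0 i1 + D i1 i1 * al).
  by rewrite /fibreC !(derivD, derivM, derivC, derivXn, derivX) !hornerE /=; field.
(* [k2] and [k1] are half the u- and s-derivatives of the equation at (al, u), up to the factor a;
   [k0] is the equation itself, simplified by [k2]. *)
have k2 : D i0 i2 + al * D i1 i2 + u * a + al * D i0 i3 + al ^+ 2 * D i1 i3 = 0.
  apply: (mulfI t0); rewrite mulr0; have := hB; rewrite Bu => /eqP; rewrite -subr_eq0 => /eqP H.
  by apply: oppr_inj; rewrite oppr0 -H; ring.
have k1 : D i0 i1 + al * D i1 i1 + u * D i1 i2 + u * D i0 i3 + 2%:R * al * u * D i1 i3 = 0.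
  apply: (mulfI t0); rewrite mulr0.
  transitivity (u * (a * fibreB^`().[al]) + a * fibreC^`().[al]); first by rewrite hB' hC'; ring.
  by transitivity (a * (u * fibreB^`().[al] + fibreC^`().[al])); [ring | rewrite Du mulr0].
have k0 : D i0 i0 + 2%:R * D i0 i1 * al + D i1 i1 * al ^+ 2 = a * u ^+ 2 by rewrite -hC Cu.
have [e0 e1 e2 e3] := row4E 1 al u (al * u).
(* The factor is read off from the last coordinate, where v J has the entry one half. *)
apply: (@contact (row4 1 al u (al * u)) (2%:R * (D i0 i3 + al * D i1 i3))).
- by rewrite row4_neq0 oner_eq0.
- by rewrite bformJ e0 e1 e2 e3; ring.
- rewrite bformD4 // e0 e1 e2 e3 D33 D23 -/a.
  transitivity (D i0 i0 + 2%:R * D i0 i1 * al + D i1 i1 * al ^+ 2 - a * u ^+ 2 +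
    2%:R * u * (D i0 i2 + al * D i1 i2 + u * a + al * D i0 i3 + al ^+ 2 * D i1 i3)); first by ring.
  by rewrite k0 k2 subrr mulr0 addr0.
- rewrite mulJ mulD4 row4Z e0 e1 e2 e3 D33 (s i2 i3) (s i0 i2) (s i0 i3) (s i1 i2) (s i1 i3) (s i0 i1) D23 -/a.
  have hh (c : K) : 2%:R * c * onehalf K = c by rewrite /onehalf; field.
  rewrite !mulrN !mulrA !hh; congr row4; try by ring.
  + apply/eqP; rewrite -subr_eq0; apply/eqP; transitivity
      ((D i0 i0 + 2%:R * D i0 i1 * al + D i1 i1 * al ^+ 2 - a * u ^+ 2)
       - al * (D i0 i1 + al * D i1 i1 + u * D i1 i2 + u * D i0 i3 + 2%:R * al * u * D i1 i3)
       + u * (D i0 i2 + al * D i1 i2 + u * a + al * D i0 i3 + al ^+ 2 * D i1 i3)); first by ring.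
    by rewrite k0 k1 k2; ring.
  + by apply/eqP; rewrite -subr_eq0; apply/eqP; rewrite -[RHS]k1; ring.
  + by apply/eqP; rewrite -subr_eq0; apply/eqP; rewrite -[RHS]k2; ring.
Qed.

End Ramified.

End NormalForm.

(** * From the geometric hypotheses to the normal form *)

Section SmoothPair.

Variable K : closedFieldType.
Hypothesis charK : [pchar K] =i pred0.
Local Notation M4 := {mpoly K[4]}.
Local Notation i3 := (inord 3 : 'I_4).

Lemma closedK (p : {poly K}) : size p != 1%N -> exists x, root p x.
Proof. by move=> /closed_rootP. Qed.

Lemma smooth_quadric_unit (A : 'M[K]_4) : A^T = A -> smooth_quadric (qform A) -> A \in unitmx.
Proof.
move=> sA [_ sm]; rewrite -row_free_unit; apply: inj_row_free => v vA.
apply: NNPP => /eqP v0; have := sm v v0; rewrite (_ : jacobian_at _ _ = 0).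
  rewrite mxrank0 => H; have : 0%N = 1%N by apply: H => i; rewrite (tnth_nth 0) ord1 /= qform_eval /bform vA mul0mx mxE.
  by [].
apply/matrixP => i j; rewrite !mxE (tnth_nth 0) ord1 /= qform_deriv // vA mxE mulr0 //.
Qed.

Lemma smooth_curve_pencil (A D : 'M[K]_4) : A^T = A -> D^T = D ->
  smooth_anticanonical_curve (qform A) (qform D) -> smooth_pencil A D.
Proof.
move=> sA sD [_ sm] v v0 vA vD a b E; have rk := sm v v0 _.
have {rk} rk : \rank (jacobian_at [tuple qform A; qform D] v) = 2%N.
  by apply: rk => -[[|[|]] ii] //; rewrite (tnth_nth 0) /= qform_eval.
pose u : 'rV[K]_2 := \row_i nth 0 [:: a; b] i.
have : u *m jacobian_at [tuple qform A; qform D] v == 0.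
  apply/eqP/rowP => j; rewrite !mxE !big_ord_recl big_ord0 addr0 !mxE !(tnth_nth 0) /=.
  have /rowP /(_ j) := E; rewrite !mxE => Ej.
  rewrite !qform_deriv //.
  transitivity (2%:R * (a * (v *m A) 0 j + b * (v *m D) 0 j)); first by ring.
  by move: Ej; rewrite !mxE => ->; rewrite mulr0.
rewrite mulmx_free_eq0; last by rewrite /row_free rk.
by move=> /eqP /rowP /(_ (inord 1)); rewrite !mxE inordK.
Qed.

(** A first change of coordinates brings the quadric to x0 x3 - x1 x2; a second one preserves it and
    moves a ramification point of the curve to (0:0:0:1). *)
Lemma normal_form (q g : M4) : smooth_quadric q -> smooth_anticanonical_curve q g ->
  exists (N : 'M[K]_4) (a : K) (B C : {poly K}),
    [/\ N \in unitmx, lsub N q = quadric0 K, (lsub N g).@[coordv K i3 0] = 0 &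
        a != 0 /\ rho (lsub N g) = io2 K a * curve B C] /\
    [/\ size B = 3%N, (size C <= 3)%N & forall e, B ^+ 2 - 4%:R * C <> e ^+ 2].
Proof.
move=> smq smg; have [q2 _] := smq; have [g2 _] := smg.
have [A sA Eq] := qform_repr charK q2; have [D sD Eg] := qform_repr charK g2.
rewrite {}Eq {}Eg in smq smg *.
have uA := smooth_quadric_unit sA smq.
have [N1 E1] := hyperbolic_basis closedK charK sA uA.
have uJ := Jmat_unit charK.
have uN1 : N1 \in unitmx by move: uJ; rewrite -E1 !unitmx_mul => /andP [/andP []].
have symT (N B : 'M[K]_4) : B^T = B -> (N *m B *m N^T)^T = N *m B *m N^T.
  by move=> sB; rewrite !trmx_mul trmxK sB mulmxA.
have [N2 [E2 D33 D23]] := tangent_frame closedK (symT N1 D sD).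
have uN2 : N2 \in unitmx by move: uJ; rewrite -E2 !unitmx_mul => /andP [/andP []].
have sm2 := smooth_pencil_change uN2 (smooth_pencil_change uN1 (smooth_curve_pencil sA sD smg)).
rewrite E1 E2 in sm2; have sD2 := symT N2 _ (symT N1 D sD).
set D2 := N2 *m _ *m N2^T in D33 D23 sm2 sD2.
have LN (B : 'M[K]_4) : lsub (N2 *m N1) (qform B) = qform (N2 *m (N1 *m B *m N1^T) *m N2^T).
  by rewrite -lsub_comp !lsub_qform.
exists (N2 *m N1), (D2 (inord 2) (inord 2)), (fibreB D2), (fibreC D2).
split; split.
- by rewrite unitmx_mul uN2.
- by rewrite LN E1 E2 qform_Jmat.
- by rewrite LN -/D2 qform_eval /bform /coordv -rowE trmx_delta -colE mxE mxE.
- split; first exact: (ramified_lead_neq0 closedK charK sD2 sm2 D33 D23).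
  rewrite LN -/D2; exact: (rho_qform closedK charK sD2 sm2 D33 D23).
- exact: (size_fibreB closedK charK sD2 sm2 D33 D23).
- exact: size_fibreC.
- exact: (fibre_discr_nsq closedK charK sD2 sm2 D33 D23).
Qed.

Lemma linsys_hasdim d r (m : r.-tuple nat) (p : 'M[K]_(r, 4)) : (forall i, row i p != 0) ->
  hasdim (ioM K 4) (fun f : AM K 4 => (f : M4) \is d.-homog /\ forall i, mult (tnth m i) (row i p) f)
    (\dim (linsys d m p)).
Proof.
move=> p0; pose b := vbasis (linsys d m p).
pose x (i : 'I_(\dim (linsys d m p))) : AM K 4 := (b`_i : dhomog 4 K d).
have lc c : lincomb (ioM K 4) x c = (\sum_i c 0 i *: b`_i : dhomog 4 K d).
  by rewrite raddf_sum; apply: eq_bigr => i _ /=; rewrite mul_mpolyC.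
have memP (F : dhomog 4 K d) : F \in linsys d m p <-> forall i, mult (tnth m i) (row i p) F.
  rewrite mem_linsys; split=> [/forallP H i|H]; last apply/forallP => i.
    by apply/(mult_at_leastP _ (dhomog_is_dhomog F) (p0 i)).
  by apply/(mult_at_leastP _ (dhomog_is_dhomog F) (p0 i)).
exists x; split.
- move=> i; split; first exact: dhomog_is_dhomog.
  by apply/memP; apply: vbasis_mem; apply: mem_nth; rewrite size_tuple.
- move=> c; rewrite lc => c0.
  have /freeP := basis_free (vbasisP (linsys d m p)); move/(_ (fun i => c 0 i)) => H.
  by apply/rowP => i; rewrite mxE; apply: H; apply: val_inj; rewrite /= c0.
- move=> f [fd fm]; pose F : dhomog 4 K d := DHomog fd.
  have FL : F \in linsys d m p by apply/memP.
  exists (\row_i coord b i F); rewrite lc.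
  rewrite -[LHS]/(F : M4) {1}(coord_vbasis FL); congr (mpoly_of_dhomog _).
  by apply: eq_bigr => i _; rewrite mxE.
Qed.

End SmoothPair.

(** * Summation of the expected dimensions over the levels *)

Section Numerics.

Variables (d r t : nat) (M : nat -> nat).
Hypothesis tM : forall i, (i < r)%N -> (t <= M i)%N.
Hypothesis td : (2 * t <= d)%N.
Let CL : int := 4 * d%:Z - (\sum_(0 <= i < r) M i)%:Z.
Let n : int := (8 - r%:Z) * (t%:Z - 1) - CL.

Let X k : int := ((d - 2 * k).+1 ^ 2)%N%:Z - (squares r M k)%:Z.
Let Y k : int := 'C(d - 2 * k + 3, 3)%:Z - (cubes r M k)%:Z.

(** [X k] and [Y k] are the expected dimensions at level k on Q and in P^3. One has Y_k - Y_(k+1) =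
    X_k and X_k - X_(k+1) = C.L_k, which is affine in k with slope r - 8 and equals -n at t - 1; two
    summations down from t give the binomials. *)
Lemma dimension_count : Y 0 + (r%:Z - 8) * 'C(t.+1, 3)%:Z + n * 'C(t.+1, 2)%:Z = Y t + t%:Z * X t.
Proof.
have stepX k : (k < t)%N -> X k = X k.+1 + (CL + k%:Z * (r%:Z - 8)).
  move=> kt; have Es : squares r M k = (squares r M k.+1 + \sum_(0 <= i < r) (M i - k))%N.
    rewrite /squares -big_split; apply: eq_bigr => i _ /=.
    by rewrite subnS; case: (M i - k)%N => // x; rewrite binS2.
  have Em : (\sum_(0 <= i < r) (M i - k) + r * k = \sum_(0 <= i < r) M i)%N.
    rewrite -{2}(subn0 r) -sum_nat_const_nat -big_split /= big_nat [RHS]big_nat.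
    by apply: eq_bigr => i /andP [_ ir]; have := tM ir; lia.
  have Erk : k%:Z * (r%:Z - 8) = (r * k)%N%:Z - 8 * k%:Z by rewrite PoszM; ring.
  rewrite /X /CL Es -Em Erk; have -> : (d - 2 * k = (d - 2 * k.+1).+2)%N by lia.
  have Ed : d = (d - 2 * k.+1 + 2 * k.+1)%N by lia.
  have Esq e : (e.+3 ^ 2 = e.+1 ^ 2 + 4 * e.+2)%N by rewrite -!mulnn; lia.
  rewrite Esq; move: Ed; move: (d - 2 * k.+1)%N => e.
  move: (e.+1 ^ 2)%N (r * k)%N (squares _ _ _) (\sum_(_ <= _ < _) _)%N => x1 x2 x3 x4.
  by clear; lia.
have stepY k : (k < t)%N -> Y k = Y k.+1 + X k.
  move=> kt; rewrite /Y /X cubesS; have -> : (d - 2 * k = (d - 2 * k.+1).+2)%N by lia.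
  by rewrite forms_step !PoszD; ring.
(* The index l counts levels downwards from t, where C.L at level t - 1 - l is -n - l(r - 8). *)
have H l : (l <= t)%N -> X (t - l)%N = X t - n * l%:Z - (r%:Z - 8) * 'C(l, 2)%:Z /\
   Y (t - l)%N = Y t + l%:Z * X t - n * 'C(l.+1, 2)%:Z - (r%:Z - 8) * 'C(l.+1, 3)%:Z.
  elim: l => [|l IH] lt; first by rewrite subn0 !bin_small //; split; ring.
  have [IX IY] := IH (ltnW lt).
  have kt : (t - l.+1 < t)%N by lia.
  have Ek : (t - l.+1).+1 = (t - l)%N by lia.
  have kZ : (t - l.+1)%N%:Z = t%:Z - 1 - l%:Z by lia.
  have EX : X (t - l.+1)%N = X t - n * l.+1%:Z - (r%:Z - 8) * 'C(l.+1, 2)%:Z.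
    rewrite stepX // Ek IX kZ binS2 PoszD intS /n; ring.
  split=> //; rewrite stepY // Ek IY EX (binS2 l.+1) (binS3 l.+1) !PoszD intS; ring.
have [_] := H t (leqnn t); rewrite subnn => ->; ring.
Qed.

End Numerics.

(** * The lower bound, and the special configuration in the original coordinates *)

Section Dimension.

Variable K : fieldType.
Hypothesis closedK : forall p : {poly K}, size p != 1%N -> exists x, root p x.
Hypothesis charK : [pchar K] =i pred0.
Local Notation M4 := {mpoly K[4]}.
Variables (q g : M4) (N : 'M[K]_4) (a : K) (B C : {poly K}).
Hypothesis uN : N \in unitmx.
Hypothesis Eq : lsub N q = quadric0 K.
Hypothesis g3 : (lsub N g).@[coordv K (inord 3) 0] = 0.
Hypothesis a0 : a != 0.
Hypothesis Eg : rho (lsub N g) = io2 K a * curve B C.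
Hypothesis sB : size B = 3%N.
Hypothesis sC : (size C <= 3)%N.
Hypothesis nsq : forall e, B ^+ 2 - 4%:R * C <> e ^+ 2.
Hypothesis q2 : q \is 2.-homog.
Hypothesis g2 : g \is 2.-homog.

Variables (d r t : nat) (M : nat -> nat).
Hypothesis Mle : forall i j, (i <= j)%N -> (M j <= M i)%N.
Hypothesis r8 : (8 < r)%N.
Hypothesis std : (M 0 + M 1 + M 2 + M 3 <= 2 * d)%N.
Hypothesis tc : (t + M 0 <= d)%N.
Hypothesis tM : forall i, (i < r)%N -> (t <= M i)%N.
Hypothesis Mr : forall i, (r <= i)%N -> M i = 0%N.
Hypothesis T1 : (\sum_(0 <= i < r) M i + 8 * t < 4 * d + r * t)%N.
Hypothesis T2 : (4 * d + r * t.-1 <= \sum_(0 <= i < r) M i + 8 * t.-1)%N.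

Definition restr (f : AM K 4) : A2 K := rho (lsub N f).

Lemma restr_klinear : klinear (ioM K 4) (io2 K) restr.
Proof. by move=> c x y; rewrite /restr lsub_klinear rho_klinear. Qed.

Lemma restrM x y : restr (x * y) = restr x * restr y.
Proof. by rewrite /restr !rmorphM. Qed.

Definition through (p : 'M[K]_(r, 4)) e (mu : nat -> nat) (f : AM K 4) :=
  (f : M4) \is e.-homog /\ forall i : 'I_r, mult (mu i) (row i p) f.

Definition points (p : 'M[K]_(r, 4)) k : 'rV[K]_4 := if insub k is Some i then row i p else 0.

Lemma through_Vsys p e mu f : Vsys e r (points p) mu f <-> through p e mu f.
Proof.
split=> [[fe fm]|[fe fm]].
  by split=> [//|i]; have := fm (val i) (ltn_ord i); rewrite /points valK.
by split=> [//|i ir]; rewrite /points insubT; apply: (fm (Ordinal ir)).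
Qed.

Lemma through_subspace p e mu : subspace (ioM K 4) (through p e mu).
Proof.
have [V0 VP] := @Vsys_subspace K e r (points p) mu; split; first exact/through_Vsys.
by move=> c x y /through_Vsys hx /through_Vsys hy; apply/through_Vsys; apply: VP.
Qed.

Lemma through_finite p e mu : exists k, hasdim (ioM K 4) (through p e mu) k.
Proof.
have [k dk] := Vsys_finite e r (points p) mu; exists k.
by apply: hasdim_eq dk => f; split=> /through_Vsys.
Qed.

Lemma lsub_hasdim (P P' : AM K 4 -> Prop) k : (forall f, P' f <-> P (lsub N f)) ->
  subspace (ioM K 4) P -> hasdim (ioM K 4) P k -> hasdim (ioM K 4) P' k.
Proof.
move=> PP sP dP; have uV : invmx N \in unitmx by rewrite unitmx_inv.
have dI : hasdim (ioM K 4) (imageof (lsub (invmx N)) P) k.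
  apply: hasdim_image_inj dP => [|f _ f0|]; [exact: lsub_klinear| |exact: sP].
  exact: (lsub_inj uV f0).
apply: hasdim_eq dI => f; split=> [/PP Pf|[h Ph ->]].
  by exists (lsub N f) => //; rewrite lsubVK.
by apply/PP; rewrite lsubK.
Qed.

(** In terms of the expected dimensions X_t and Y_t: D <= Y_t + lines + t X_t here, and k <= Y_t -
    X_t + lines for [kernel_bound], both written without subtraction. *)
Definition curve_bound (D : nat) :=
  (D + t * squares r M t + cubes r M t <= 'C(d - 2 * t + 3, 3) + lines d r M + t * (d - 2 * t).+1 ^ 2)%N.
Definition kernel_bound (k : nat) :=
  (k + (d - 2 * t).+1 ^ 2 + cubes r M t <= 'C(d - 2 * t + 3, 3) + lines d r M + squares r M t)%N.

Let r0 : (0 < r)%N. Proof. exact: leq_trans r8. Qed.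

(** Level t has dimension at least Y_t + lines by [Vsys_lower]; subtracting the kernel bound, its
    restriction to Q has rank at least X_t. Each of the t levels below contains at least that rank
    on top of [q] times the next level. *)
Lemma lower_bound (p : 'M[K]_(r, 4)) D :
    (forall i, q.@[row i p 0] = 0 /\ g.@[row i p 0] = 0) ->
    (exists2 N' : 'M[K]_4, N' \in unitmx & forall (b : 'I_4) (i : 'I_r),
       (if (b < 3)%N then insub (val b) else None) = Some i -> row b N' = row i p) ->
    (forall i : 'I_r, (2 < i)%N -> exists2 N' : 'M[K]_4, N' \in unitmx & forall b j,
       nth None [:: insub 0%N; Some i] (b : 'I_4) = Some j -> row b N' = row j p) ->
    (forall k, hasdim (ioM K 4) (kernelof restr (through p (d - 2 * t) (fun i => M i - t)%N)) k ->
       kernel_bound k) ->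
  hasdim (ioM K 4) (through p d M) D ->
  ('C(d - 2 * t + 3, 3) + lines d r M + t * (d - 2 * t).+1 ^ 2 <= D + t * squares r M t + cubes r M t)%N.
Proof.
move=> pX [N1 uN1 rN1] frame ker dD.
have m0 i : (i < 9)%N -> (t <= M i)%N by move=> i9; apply: tM; apply: leq_trans r8.
have t0 := m0 0%N isT; have t1 := m0 1%N isT; have t2 := m0 2%N isT; have t3 := m0 3%N isT.
have M0 i : (M i <= M 0)%N by apply: Mle.
have [||||||al dal lal] := @Vsys_lower K (d - 2 * t) r (points p) (fun i => M i - t)%N N1.
- exact: uN1.
- move=> b b3; have br : (b < r)%N by apply: leq_trans b3 _; apply: leq_trans r8.
  rewrite /points insubT; apply: rN1; rewrite b3 /= insubT //.
- move=> i /andP [i3 ir]; have [N2 uN2 rN2] := frame (Ordinal ir) i3; exists N2 => //.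
  split; rewrite /points insubT //; apply: rN2; last by rewrite inordK.
  by rewrite /= insubT.
- move=> i ir; have := M0 i; lia.
- lia.
- exact: leq_trans r8.
have {}dal : hasdim (ioM K 4) (through p (d - 2 * t) (fun i => M i - t)%N) al.
  by apply: hasdim_eq dal => f; split=> /through_Vsys.
have [rk [k [Eal drk dk]]] := rank_nullity restr_klinear (through_subspace _ _ _) dal.
have kb := ker k dk.
have gne0 : restr g != 0.
  rewrite /restr Eg mulf_neq0 //; first by rewrite /io2 /= /polyC2 /= !polyC_eq0.
  have [g1 _ _] := curve_sizes sB sC; by rewrite -size_poly_eq0 g1.
have step j Dj Dj' : (j < t)%N -> hasdim (ioM K 4) (through p (d - 2 * j) (fun i => M i - j)%N) Dj ->
    hasdim (ioM K 4) (through p (d - 2 * j.+1) (fun i => M i - j.+1)%N) Dj' -> (Dj' + rk <= Dj)%N.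
  move=> jt dj dj'.
  have [x [y [-> dx dy]]] := rank_nullity restr_klinear (through_subspace _ _ _) dj.
  rewrite addnC; apply: leq_add.
    (* The power t - j of the second quadric raises degree and multiplicities from level t to level
       j, and its restriction to Q is not a zero divisor. *)
    have dI : hasdim (io2 K) (imageof (fun F : A2 K => restr g ^+ (t - j) * F)
        (imageof restr (through p (d - 2 * t) (fun i => M i - t)%N))) rk.
      apply: hasdim_image_inj drk => [c u v|F _ /eqP|].
      - by rewrite mulrDr mulrCA.
      - by rewrite mulf_eq0 expf_eq0 (negbTE gne0) andbF => /eqP.
      - exact/(subspace_image restr_klinear)/through_subspace.
    apply: hasdim_leq dx dI => _ [_ [f [fe fm] ->] ->].
    exists (g ^+ (t - j) * f : AM K 4); last by rewrite restrM; congr (_ * _); rewrite /restr !rmorphXn.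
    split=> [|i].
      have -> : (d - 2 * j = 2 * (t - j) + (d - 2 * t))%N by lia.
      by rewrite dhomogM // dhomogMn.
    have -> : (M i - j = (t - j) + (M i - t))%N by have := tM (ltn_ord i); lia.
    apply: multM (fm i); have mg : mult 1 (row i p) g by apply/mult1; have [] := pX i.
    by elim: (t - j)%N => [|s IHs]; [apply: mult0 | rewrite exprS; apply: (multM mg IHs)].
  have qne0 : q != 0.
    apply/eqP => q0; have [i] := quadric0_grad (v := delta_mx 0 0 : 'rV[K]_4) ltac:(by apply/eqP => /rowP /(_ 0) /eqP; rewrite !mxE !eqxx oner_eq0).
    by rewrite -Eq q0 rmorph0 mderiv0 meval0 eqxx.
  have dI : hasdim (ioM K 4) (imageof (fun f : AM K 4 => q * f : AM K 4)
      (through p (d - 2 * j.+1) (fun i => M i - j.+1)%N)) Dj'.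
    apply: hasdim_image_inj dj' => [c u v|F _ /eqP|].
    - by rewrite mulrDr mulrCA.
    - by rewrite mulf_eq0 (negbTE qne0) => /eqP.
    - exact: through_subspace.
  apply: hasdim_leq dy dI => _ [f [fe fm] ->]; split; last by rewrite restrM /restr Eq rho_quadric0 mul0r.
  split=> [|i].
    have -> : (d - 2 * j = 2 + (d - 2 * j.+1))%N by lia.
    by rewrite dhomogM.
  have -> : (M i - j = 1 + (M i - j.+1))%N by have := tM (ltn_ord i); lia.
  by apply: multM (fm i); apply/mult1; have [] := pX i.
have tower l Dl : (l <= t)%N -> hasdim (ioM K 4) (through p (d - 2 * (t - l)) (fun i => M i - (t - l))%N) Dl ->
    (al + l * rk <= Dl)%N.
  elim: l Dl => [|l IH] Dl lt dl; first by rewrite subn0 in dl; rewrite (hasdim_uniq dal dl) mul0n addn0.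
  have [D' dD'] := through_finite p (d - 2 * (t - l)) (fun i => M i - (t - l))%N.
  have := IH D' (ltnW lt) dD'; have := step (t - l.+1)%N Dl D' ltac:(lia) dl.
  have -> : (t - l.+1).+1 = (t - l)%N by lia.
  by move=> /(_ dD') h1 h2; rewrite mulSn; lia.
have E0 : (al + t * rk <= D)%N.
  by apply: tower => //; rewrite subnn muln0 subn0; apply: hasdim_eq dD => f; split=> -[fe fm]; split=> // i; have := fm i; rewrite subn0.
have Elines : ('C(M 1 - t + (M 2 - t) - (d - 2 * t) + 1, 3) +
    \sum_(1 <= i < r) 'C(M 0 - t + (M i - t) - (d - 2 * t) + 1, 3) = lines d r M)%N.
  rewrite /lines; congr (_ + _)%N; first by congr 'C(_, 3); lia.
  rewrite big_nat [RHS]big_nat; apply: eq_bigr => i /andP [_ ir]; congr 'C(_, 3).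
  by have := tM ir; lia.
rewrite -addnA Elines -/(cubes r M t) in lal.
(* The lower bound for level t minus the upper bound for its kernel leaves rank at least X_t. *)
have := leq_mul (leqnn t) (_ : (d - 2 * t).+1 ^ 2 <= squares r M t + rk)%N.
rewrite mulnDr => H; move: kb lal E0 H; rewrite /kernel_bound Eal => kb lal E0 H.
have {}H := H ltac:(move: kb lal; move: (_ ^ 2)%N (squares _ _ _) (cubes _ _ _) 'C(_, _) (lines _ _ _) => *; lia).
move: lal E0 H; move: (t * _ ^ 2)%N (t * squares _ _ _)%N (t * rk)%N (cubes _ _ _) 'C(_, _) (lines _ _ _) => *; lia.
Qed.

Lemma pt_rho z (f : M4) : pt z (rho f) = f.@[(\row_j pt z (segre K j)) 0].
Proof.
apply: (@rmorph_mpoly_ext K 4 K (pt z \o @rho K) (meval ((\row_j pt z (segre K j)) 0))) => [c|i] /=.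
  by rewrite rhoC mevalC /pt ev2C.
by rewrite /rho mevX mevalXU mxE.
Qed.

(** The special points of the normal form are carried back by [N]. All that has to hold at a general
    configuration is collected at this single one, so that each item can be spread by openness. *)
Lemma special_position : exists p0 : 'M[K]_(r, 4),
  [/\ forall i, row i p0 != 0 /\ (q.@[row i p0 0] = 0 /\ g.@[row i p0 0] = 0),
    exists2 N' : 'M[K]_4, N' \in unitmx & forall (b : 'I_4) (i : 'I_r),
       (if (b < 3)%N then insub (val b) else None) = Some i -> row b N' = row i p0,
    forall i : 'I_r, (2 < i)%N -> exists2 N' : 'M[K]_4, N' \in unitmx & forall b j,
       nth None [:: insub 0%N; Some i] (b : 'I_4) = Some j -> row b N' = row j p0,
    exists2 D, hasdim (ioM K 4) (through p0 d M) D & curve_bound D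
  & exists2 k, hasdim (ioM K 4) (kernelof restr (through p0 (d - 2 * t) (fun i => M i - t)%N)) k &
      kernel_bound k].
Proof.
have [L [phi phi0]] := function_field nsq.
have r3 : (3 < r)%N by apply: leq_trans r8.
have M0d : (M 0 <= d)%N by apply: leq_trans tc; apply: leq_addl.
have tM3 : (t <= M 3)%N by apply: tM.
have tc' : (t <= d - M 0)%N by rewrite leq_subRL // addnC.
(* One system for each level k < M 3; index 0 carries no osculation, its condition being in the
   polygon. *)
pose mu (k : 'I_(M 3)) i := if i == 0%N then 0%N else (M i - k)%N.
have [||z [zG zz zd]] := general_points closedK charK nsq phi0 mu r
   (S := fun k : 'I_(M 3) => polygon (edeg d M k) (ddeg d M k))
   (N := fun k : 'I_(M 3) => (4 * edeg d M k - ddeg d M k)%N).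
- by move=> k; apply: polygon_subspace.
- move=> k; apply: (phi_polygon sB sC phi0); apply/andP; split.
    exact: (ddeg_gt0 sB sC Mle r3 std M0d (ltn_ord k)).
  exact: (ddeg_edeg sB sC Mle r3 std M0d (ltnW (ltn_ord k))).
have zgen k : (k < M 3)%N ->
  exists2 n, (n <= 4 * edeg d M k - ddeg d M k - \sum_(1 <= i < r) (M i - k))%N &
    hasdim (ioL phi) (imageof phi (fun F => polygon (edeg d M k) (ddeg d M k) F /\
      osculates B C z (fun i => if i == 0%N then 0%N else M i - k)%N r F)) n.
  move=> k3; have [n ln dn] := zd (Ordinal k3); exists n => //.
  apply: leq_trans ln _; rewrite -(big_mkord xpredT (mu (Ordinal k3))) big_ltn // add0n.
  by rewrite big_nat [X in (_ <= _ - X)%N]big_nat (eq_bigr (fun i => M i - k)%N) // => -[].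
pose sp := special_point z.
pose p0 : 'M[K]_(r, 4) := \matrix_i (sp (val i) *m N).
have rp i : row i p0 = sp (val i) *m N by rewrite rowK.
have thr e nu f : through p0 e nu f <-> Vsys e r sp nu (lsub N f).
  split=> -[fe fm]; split.
  - exact: lsub_homog.
  - by move=> i ir; apply: lsub_mult; rewrite -(rp (Ordinal ir)); apply: fm.
  - by rewrite -(lsubVK f uN); apply: lsub_homog.
  - by move=> i; rewrite -(lsubVK f uN) rp; apply: lsub_mult; rewrite mulmxK //; apply: fm.
have Es : (\sum_(0 <= i < r) (M i - t) + r * t = \sum_(0 <= i < r) M i)%N.
  rewrite -{2}(subn0 r) -sum_nat_const_nat -big_split /= big_nat [RHS]big_nat.
  by apply: eq_bigr => i /andP [_ ir]; rewrite subnK // tM.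
have Hpos : forall j, (t <= j < M 3)%N ->
    (\sum_(1 <= i < r) (M i - j) <= 4 * edeg d M j - ddeg d M j)%N.
  apply: (degrees_pos Mle r0 std tc tM Mr).
  move: T1; rewrite -Es big_ltn //; have := tM r0; clear -tc.
  by move: (\sum_(_ <= _ < _) _)%N (r * t)%N => *; lia.
have Hneg := degrees_neg r0 std tc tM (ltnW r8) T2.
exists p0; split.
- move=> i; rewrite rp; split.
    apply: contraNneq (special_point_neq0 z (val i)) => E.
    by rewrite -/(sp _) -(mulmxK uN (sp _)) E mul0mx.
  rewrite -!lsub_eval Eq special_point_quadric; split=> //.
  rewrite /sp /special_point; case: (val i =P 0%N) => [_|]; first exact: g3.
  by move=> _; rewrite -pt_rho Eg rmorphM /= (zG _ (ltn_ord i)).1 mulr0.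
- have [N' uN' rN'] := special_frame sB sC r3 std M0d zz.
  exists (N' *m N); first by rewrite unitmx_mul uN'.
  move=> b i; case: ifP => // b3; case: insubP => // i' _ ii' [<-].
  by rewrite row_mul rN' // rp ii'.
(* A frame through p_1 and the i-th point, completed by two coordinate vectors: the i-th point has
   first coordinate 1. *)
- move=> i i2; pose n := [:: sp 0%N; sp (val i); coordv K (inord 1); coordv K (inord 2)].
  exists (\matrix_b nth 0 n b *m N); last first.
    move=> [[|[|[|[|b]]]] bi] j //=; last by move=> [<-]; rewrite row_mul rowK rp.
    by rewrite insubT => -[<-]; rewrite row_mul rowK rp.
  rewrite unitmx_mul uN andbT -row_free_unit; apply: inj_row_free => v v0.
  have [c0 c1 c2 c3] := pt_segre (z (val i)); rewrite !mxE in c0 c1 c2 c3.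
  have ii : (val i == 0%N) = false by rewrite gtn_eqF // (ltn_trans _ i2).
  have E j : v 0 (inord 0) * (j == inord 3)%:R + (v 0 (inord 1) * pt (z (val i)) (segre K j) +
     (v 0 (inord 2) * (j == inord 1)%:R + v 0 (inord 3) * (j == inord 2)%:R)) = 0.
    have := congr1 (fun w : 'rV[K]_4 => w 0 j) v0; rewrite mxE big_ord4 /= [RHS]mxE => <-.
    by rewrite !mxE !inordK //= /sp /special_point /= ii /coordv !mxE ?eqxx.
  have := E (inord 0); rewrite c0 -!val_eqE /= !inordK //= !mulr0 add0r !mulr1 !addr0 => w1.
  have := E (inord 3); rewrite w1 mul0r -!val_eqE /= !inordK //= !mulr0 !addr0 mulr1 => w0.
  have := E (inord 1); rewrite w0 w1 !mul0r -!val_eqE /= !inordK //= !mulr0 !add0r addr0 mulr1 => w2.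
  have := E (inord 2); rewrite w0 w1 w2 !mul0r -!val_eqE /= !inordK //= !add0r mulr1 => w3.
  by apply/rowP => j; rewrite mxE; have [->|[->|[->|->]]] := ord4_cases j.
- have [D dD] := through_finite p0 d M; exists D => //.
  apply: (Vk0_bound sB sC phi0 Mle r3 std M0d zG zz zgen tc' tM3 Hpos Hneg).
  have sV := Vsys_subspace d r sp M.
  have dV : hasdim (ioM K 4) (Vsys d r sp M) D.
    have uV : invmx N \in unitmx by rewrite unitmx_inv.
    have dI : hasdim (ioM K 4) (imageof (lsub N) (through p0 d M)) D.
      apply: hasdim_image_inj dD => [|f _ f0|]; [exact: lsub_klinear| |exact: through_subspace].
      exact: (lsub_inj uN f0).
    apply: hasdim_eq dI => f; split=> [Vf|[h Ph ->]]; last exact/thr.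
    by exists (lsub (invmx N) f); [apply/thr; rewrite lsubK | rewrite lsubK].
  apply: hasdim_eq dV => f; rewrite /Vk muln0 subn0.
  by split=> -[fe fm]; split=> // i ir; have := fm i ir; rewrite subn0.
- pose Kr := kernelof (@rho K) (Vk d r M z t).
  have sKr : subspace (ioM K 4) Kr by apply: (subspace_kernel (@rho_klinear K)); apply: Vsys_subspace.
  have [kV dkV] := Vsys_finite (d - 2 * t) r sp (fun i => M i - t)%N.
  have [k _ dk] := hasdim_sub sKr (fun f (H : Kr f) => H.1) dkV.
  exists k; last by apply: (Vk_kernel_lines sB sC phi0 Mle r3 std M0d zG zz zgen tc' tM3 Hpos).
  by apply: lsub_hasdim sKr dk => f; split=> -[/thr Vf f0]; split.
Qed.

End Dimension.

(** * Assembly: both bounds on a common open set *)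

Theorem theorem7p1 (K : closedFieldType) (charK : [pchar K] =i pred0)
    (q g : {mpoly K[4]})
    (smQ : smooth_quadric q) (smB : smooth_anticanonical_curve q g)
    (d r : nat) (m : r.-tuple nat)
    (std : standard d m) (not_double : ~ double_form d m)
    (CL_lb : 1 + (mu m r)%:Z * (8 - r%:Z) <= Cdot d m) (CL_ub : Cdot d m <= 0)
    (d_lb : (mu m 1)%:Z + t_curve d m <= d%:Z) :
  (0 <= n_curve d m <= r%:Z - 9) /\
  for_general_points (on_curve q g) (fun p : 'M[K]_(r, 4) =>
    linsys_dim d m p
    = vdim d m
      + \sum_(1 <= i < r.+1) 'C(t_line d m i + 1, 3)%:Z
      + (r%:Z - 8) * 'C(absz (t_curve d m + 1), 3)%:Z
      + n_curve d m * 'C(absz (t_curve d m + 1), 2)%:Z).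
Proof.
pose M := nth 0%N m.
have sumZ (F : nat -> nat) a b : \sum_(a <= i < b) (F i)%:Z = (\sum_(a <= i < b) F i)%N%:Z.
  by rewrite (big_morph Posz PoszD (erefl 0%:Z)).
have ECL : Cdot d m = 4 * d%:Z - (\sum_(0 <= i < r) M i)%N%:Z by rewrite /Cdot sumZ big_add1.
have [sm std4] : sorted geq m /\ (M 0 + M 1 + M 2 + M 3 <= 2 * d)%N by apply/andP.
have Mr i : (r <= i)%N -> M i = 0%N by move=> ri; rewrite /M nth_default // size_tuple.
have Mle i j : (i <= j)%N -> (M j <= M i)%N.
  move=> ij; have [jr|/Mr -> //] := ltnP j r.
  have tr : transitive geq by move=> y x z xy yz; apply: leq_trans yz xy.
  have rf : reflexive geq by move=> x; apply: leqnn.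
  have ir := leq_ltn_trans ij jr.
  by apply: (sorted_leq_nth tr rf 0%N sm) ij; rewrite inE size_tuple.
have r8 : (8 < r)%N.
  rewrite ltnNge; apply/negP => r8; have := Order.POrderTheory.le_trans CL_lb CL_ub.
  have : 0 <= (mu m r)%:Z * (8 - r%:Z) by rewrite mulr_ge0 // subr_ge0 lez_nat.
  by move: (_ * _) => y; lia.
have r0 : (0 < r)%N by apply: leq_trans r8.
have rZ : 0 < (r%:Z - 8)%:~R :> rat by rewrite ltr0z; lia.
have [lo up] := andP (ceil_itv ((1 - Cdot d m)%:~R / (r%:Z - 8)%:~R : rat)).
rewrite -/(t_curve d m) in lo up.
have {}lo : (t_curve d m - 1) * (r%:Z - 8) < 1 - Cdot d m.
  by move: lo; rewrite ltr_pdivlMr // -intrM ltr_int.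
have {}up : 1 - Cdot d m <= t_curve d m * (r%:Z - 8).
  by move: up; rewrite ler_pdivrMr // -intrM ler_int.
(* The lower bound on C.L amounts to t <= m_r, so no multiplicity is truncated at the levels up to
   t. *)
have t_le : t_curve d m <= (mu m r)%:Z.
  rewrite /t_curve ceil_le_int ler_pdivrMr // -intrM ler_int.
  by move: CL_lb; rewrite -opprB mulrN; move: (_ * _) => y; lia.
have t_gt0 : 0 < t_curve d m.
  rewrite /t_curve ceil_gt0 divr_gt0 // ltr0z; lia.
have [t Et] : exists t : nat, t_curve d m = t%:Z by exists `|t_curve d m|%N; rewrite gtz0_abs.
have En : n_curve d m = (8 - r%:Z) * (t%:Z - 1) - (4 * d%:Z - (\sum_(0 <= i < r) M i)%N%:Z).
  by rewrite /n_curve Et ECL.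
rewrite Et in lo up t_le t_gt0 d_lb *; rewrite ECL in lo up.
have tM i : (i < r)%N -> (t <= M i)%N.
  move=> ir; have : (M r.-1 <= M i)%N by apply: Mle; lia.
  by apply: leq_trans; rewrite -lez_nat.
have tc : (t + M 0 <= d)%N by rewrite -lez_nat PoszD addrC; apply: d_lb.
have up' : (r * t)%N%:Z = t%:Z * (r%:Z - 8) + 8 * t%:Z by rewrite PoszM; ring.
(* [T1] and [T2] say that C.L_t >= 1 and C.L_(t-1) <= 0, the two sides of the ceiling. *)
have T1 : (\sum_(0 <= i < r) M i + 8 * t < 4 * d + r * t)%N.
  by move: up up'; clear; move: (_ * (_ - _)) (r * t)%N (\sum_(_ <= _ < _) _)%N => *; lia.
have tZ : t.-1%:Z = t%:Z - 1 by lia.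
have lo' : (r * t.-1)%N%:Z = (t%:Z - 1) * (r%:Z - 8) + 8 * (t%:Z - 1) by rewrite PoszM tZ; ring.
have T2 : (4 * d + r * t.-1 <= \sum_(0 <= i < r) M i + 8 * t.-1)%N.
  by move: lo lo' tZ; clear; move: (_ * (_ - _)) (r * t.-1)%N t.-1 (\sum_(_ <= _ < _) _)%N => *; lia.
have nE : n_curve d m = - ((t%:Z - 1) * (r%:Z - 8)) - (4 * d%:Z - (\sum_(0 <= i < r) M i)%N%:Z).
  by rewrite En; ring.
have nE' : n_curve d m = - (t%:Z * (r%:Z - 8)) + (r%:Z - 8) - (4 * d%:Z - (\sum_(0 <= i < r) M i)%N%:Z).
  by rewrite En; ring.
split.
  apply/andP; split; [move: nE lo | move: nE' up]; clear;
  move: (n_curve d m) (_ * (_ - _)) (\sum_(_ <= _ < _) _)%N => *; lia.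
have [N [a [B [C [[uN Eq g3 [a0 Eg]] [sB sC nsq]]]]]] := normal_form charK smQ smB.
have [q2 _] := smQ; have [g2 _] := smB.
have cK := @closedK K.
have [p0 [p0X fr0 fr [D0 dD0 bD0] [k0 dk0 bk0]]] :=
  special_position cK charK uN Eq g3 Eg sB sC nsq Mle r8 std4 tc tM Mr T1 T2.
have homP e : subspace (ioM K 4) (fun f : AM K 4 => (f : {mpoly K[4]}) \is e.-homog).
  split=> [|c x y hx hy]; first exact: dhomog0.
  by rewrite /ioM /= mul_mpolyC rpredD // rpredZ.
have [n1 dn1] : exists n, hasdim (ioM K 4) (fun f : AM K 4 => (f : {mpoly K[4]}) \is d.-homog) n.
  have [n dn] := @Vsys_finite K d 0 (fun=> 0) (fun=> 0%N); exists n.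
  by apply: hasdim_eq dn => f; split=> [|[]].
have [n2 dn2] : exists n, hasdim (ioM K 4) (fun f : AM K 4 => (f : {mpoly K[4]}) \is (d - 2 * t).-homog) n.
  have [n dn] := @Vsys_finite K (d - 2 * t) 0 (fun=> 0) (fun=> 0%N); exists n.
  by apply: hasdim_eq dn => f; split=> [|[]].
have sk := subspace_kernel (restr_klinear N) (homP (d - 2 * t)%N).
have [n3 _ dn3] := hasdim_sub sk (fun f H => H.1) dn2.
(* Nonvanishing of [G1] keeps the upper bound for L, that of [G2] the upper bound for the kernel on
   Q at level t, that of [G3] and the [G4 i] the frames required by the lower bound. *)
have [G1 [[e1 mG1] G10 HG1]] := multiplicities_open charK (mu := fun i : 'I_r => M i) dn1 (fun f H => H) (homP d) dD0.
have [|G2 [[e2 mG2] G20 HG2]] := multiplicities_open (mu := fun i : 'I_r => (M i - t)%N) (p0 := p0) (k0 := k0)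
  charK dn3 (fun f H => H.1) sk.
  by apply: hasdim_eq dk0 => f; split=> [[[fe f0] fm]|[[fe fm] f0]]; split.
have [N3 uN3 rN3] := fr0; have [G3 [[e3 mG3] G30 HG3]] := frame_open uN3 rN3.
have HG4 (i : 'I_r) : exists G : {mpoly K[r * 4]}, [/\ exists e, multidegree e G, G.@[mxvec p0 0] != 0 &
    forall p : 'M[K]_(r, 4), G.@[mxvec p 0] != 0 -> (2 < i)%N -> exists2 N' : 'M[K]_4, N' \in unitmx &
      forall b j, nth None [:: insub 0%N; Some i] (b : 'I_4) = Some j -> row b N' = row j p].
  have [i2|i2] := leqP i 2.
    exists 1; split=> //; last by rewrite meval1 oner_eq0.
    by exists (fun=> 0%N); rewrite -mpolyC1; apply: multidegreeC.
  have [N' uN' rN'] := fr i i2; have [G [mG G0 HG]] := frame_open uN' rN'.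
  by exists G; split=> // p /HG.
have [G4 {}HG4] := choice _ HG4.
have mG : forall i, exists e, multidegree e (G4 i) by move=> i; have [] := HG4 i.
have [e4 mG4] := choice _ mG.
pose G := G1 * G2 * G3 * \prod_i G4 i.
have Gev p : G.@[mxvec p 0] = G1.@[mxvec p 0] * G2.@[mxvec p 0] * G3.@[mxvec p 0] * \prod_i (G4 i).@[mxvec p 0].
  by rewrite !mevalM rmorph_prod.
exists [:: G].
  move=> G'; rewrite inE => /eqP ->.
  have mGt : exists e, multidegree e G.
    eexists; rewrite /G; apply: multidegreeM; last exact: multidegree_prod.
    by apply: multidegreeM mG3; apply: multidegreeM mG1 mG2.
  by case: mGt => e me; exists e.
split.
  exists p0; split=> [i|]; first by have [h1 [h2 h3]] := p0X i.
  exists G; rewrite ?inE // Gev !mulf_neq0 //; apply/prodf_neq0 => i _.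
  by have [] := HG4 i.
move=> p [pX [G']]; rewrite inE => /eqP -> {G'}; rewrite Gev !mulf_eq0 !negb_or => /andP [/andP [/andP [p1 p2] p3] /prodf_neq0 p4].
have dD := linsys_hasdim d m (fun i => (pX i).1).
have {}dD : hasdim (ioM K 4) (through p d M) (\dim (linsys d m p)).
  by apply: hasdim_eq dD => f; split=> -[fd fm]; split=> // i; have := fm i; rewrite (tnth_nth 0%N).
have D1 := HG1 p p1 _ dD.
have D2 : ('C(d - 2 * t + 3, 3) + lines d r M + t * (d - 2 * t).+1 ^ 2 <=
    \dim (linsys d m p) + t * squares r M t + cubes r M t)%N.
  eapply lower_bound with (q := q) (g := g) (N := N) (a := a) (B := B) (C := C) (p := p); try eassumption.
  - by move=> i; have [_ []] := pX i.
  - exact: HG3.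
  - by move=> i i2; have [_ _ H] := HG4 i; apply: H => //; apply: p4.
  move=> k dk; apply: leq_trans bk0; rewrite -!addnA leq_add2r.
  by apply: (HG2 p p2); apply: hasdim_eq dk => f; split=> [[[fe f0] fm]|[[fe fm] f0]]; split.
(* The upper bound from [G1] and the lower bound are the same number, Y_t + lines + t X_t. *)
have DE : (\dim (linsys d m p) + t * squares r M t + cubes r M t =
    'C(d - 2 * t + 3, 3) + lines d r M + t * (d - 2 * t).+1 ^ 2)%N.
  apply/eqP; rewrite eqn_leq D2 andbT; apply: leq_trans bD0; rewrite -!addnA leq_add2r.
  exact: D1.
have td : (2 * t <= d)%N.
  by have := tM 0%N r0; move: tc; clear; lia.
have := dimension_count tM td; rewrite -En muln0 subn0 => DC.
have E1 : \sum_(1 <= i < r.+1) 'C(t_line d m i + 1, 3)%:Z = (lines d r M)%:Z.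
  rewrite sumZ big_ltn // big_add1 /lines; congr (Posz (_ + _)).
  by rewrite big_nat [RHS]big_nat; apply: eq_bigr => i /andP [i1 _]; rewrite /t_line -[i.+1 == 1%N]/(i == 0%N) gtn_eqF.
have E2 : vdim d m = 'C(d + 3, 3)%:Z - (cubes r M 0)%:Z - 1.
  rewrite /vdim sumZ big_add1 /cubes; congr (_ - Posz _ - 1).
  by apply: eq_bigr => i _; rewrite subn0.
have -> : absz (t%:Z + 1) = t.+1 by rewrite -PoszD addn1.
rewrite /linsys_dim E1 E2.
rewrite mulrBr -!PoszM in DC; move: DC DE; clear.
move: (t * squares _ _ _)%N (t * _)%N (cubes r M t) (cubes r M 0) (lines d r M) (\dim _).
move: ((r%:Z - 8) * _) (n_curve d m * _) 'C(d - 2 * t + 3, 3) 'C(d + 3, 3) => *.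
lia.
Qed.
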